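(* Let $G$ be a countable $C^*$-simple group, and let $Z\subseteq \mathrm{Sub}(G)$ be an infinite uniformly recurrent subgroup of $G$. Then there exists an uncountable set $Y\subseteq Z$, dense in $Z$, such that $R_a(H)=\{e\}$ for every $H\in Y$.
   Context: $\mathrm{Sub}(G)$ denotes the set of all subgroups of $G$ with the Chabauty topology, i.e. the topology induced from the product topology on $\{0,1\}^G$ by identifying a subgroup with its indicator function; it is a compact space on which $G$ acts continuously by conjugation. A uniformly recurrent subgroup (URS) of $G$ is a non-empty closed $G$-invariant subset of $\mathrm{Sub}(G)$ that is minimal (every orbit in it is dense). A countable group is $C^*$-simple if its reduced group $C^*$-algebra is simple. $R_a(H)$ denotes the amenable radical of $H$, the largest amenable normal subgroup of $H$. *)

(* Defs.v *)
From HB Require Import structures.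
From mathcomp Require Import all_boot all_order all_algebra.
From mathcomp Require Import boolp classical_sets functions cardinality reals.
From mathcomp Require Import complex.
From Stdlib Require List.
Set Implicit Arguments. Unset Strict Implicit. Unset Printing Implicit Defensive.
Import Order.TTheory GRing.Theory Num.Theory.
Local Open Scope classical_set_scope.
Local Open Scope ring_scope.

Record group := Group {
  gcar :> Type;
  gmul : gcar -> gcar -> gcar;
  gone : gcar;
  ginv : gcar -> gcar;
  gmulA : forall x y z, gmul x (gmul y z) = gmul (gmul x y) z;
  gmul1 : forall x, gmul gone x = x;
  gmulV : forall x, gmul (ginv x) x = gone }.

Section GroupDefs.
Variable G : group.

Definition is_subgroup (H : set G) : Prop :=
  H (gone G) /\ (forall x y, H x -> H y -> H (gmul x y)) /\
  (forall x, H x -> H (ginv x)).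

Definition normal_in (N H : set G) : Prop :=
  is_subgroup N /\ N `<=` H /\
  forall h n, H h -> N n -> N (gmul (gmul h n) (ginv h)).

Definition conjs (g : G) (H : set G) : set G :=
  [set x | H (gmul (gmul (ginv g) x) g)].

(** Closure in the Chabauty topology (product topology on {0,1}^G):
    H is in the closure of S iff every basic neighbourhood of H,
    given by a finite set F of G, meets S. *)
Definition chab_closure (S : set (set G)) : set (set G) :=
  [set H | forall F : seq G, exists K, S K /\
      forall g, List.In g F -> (K g <-> H g)].

Definition URS (Z : set (set G)) : Prop :=
  Z !=set0 /\
  (forall H, Z H -> is_subgroup H) /\
  chab_closure Z `<=` Z /\
  (forall g H, Z H -> Z (conjs g H)) /\
  (forall H, Z H -> Z `<=` chab_closure [set conjs g H | g in [set: G]]).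

Variable R : realType.

Definition amenable (N : set G) : Prop :=
  exists m : set G -> R,
    (forall A, A `<=` N -> 0 <= m A) /\ m N = 1 /\
    (forall A B, A `<=` N -> B `<=` N -> A `&` B = set0 ->
        m (A `|` B) = m A + m B) /\
    (forall g A, N g -> A `<=` N -> m [set gmul g a | a in A] = m A).

Definition amenable_radical (H : set G) : set G :=
  \bigcup_(N in [set N | normal_in N H /\ amenable N]) N.

Local Notation C := (R[i]).

Definition csq (z : C) : R := let: Complex a b := z in a ^+ 2 + b ^+ 2.

Definition sqsums (f : G -> C) : set R :=
  [set r | exists s : seq G, List.NoDup s /\ r = \sum_(g <- s) csq (f g)].

Definition l2 (f : G -> C) : Prop := has_ubound (sqsums f).

Definition l2norm (f : G -> C) : R := Num.sqrt (sup (sqsums f)).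

Definition op := (G -> C) -> (G -> C).

Definition bounded_op (T : op) : Prop :=
  (forall f, l2 f -> l2 (T f)) /\
  (forall (a : C) f h, l2 f -> l2 h ->
     T (fun x => a * f x + h x) = (fun x => a * T f x + T h x)) /\
  exists M : R, forall f, l2 f -> l2norm (T f) <= M * l2norm f.

Definition opnorm (T : op) : R :=
  sup [set r | exists f, l2 f /\ l2norm f <= 1 /\ r = l2norm (T f)].

(** finite linear combination  sum_i c_i lambda(g_i), with
    (lambda(g) f)(x) = f(g^-1 x) the left regular representation *)
Definition lincomb (s : seq (C * G)) : op :=
  fun f x => \sum_(p <- s) p.1 * f (gmul (ginv p.2) x).

Definition opsub (T S : op) : op := fun f x => T f x - S f x.

Definition Cred : set op :=
  [set T | bounded_op T /\ forall eps : R, 0 < eps ->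
     exists s, opnorm (opsub T (lincomb s)) < eps].

Definition closed_ideal (I : set op) : Prop :=
  I `<=` Cred /\ I (fun _ _ => 0) /\
  (forall T S, I T -> I S -> I (fun f x => T f x + S f x)) /\
  (forall (a : C) T, I T -> I (fun f x => a * T f x)) /\
  (forall A T, Cred A -> I T -> I (fun f => A (T f)) /\ I (fun f => T (A f))) /\
  (forall T, Cred T -> (forall eps : R, 0 < eps ->
       exists S, I S /\ opnorm (opsub T S) < eps) -> I T).

Definition Cstar_simple : Prop :=
  forall I, closed_ideal I -> (forall T, I T -> opnorm T = 0) \/ Cred `<=` I.

End GroupDefs.

(* Main.v *)
(** For a non-trivial [s], the set of [H] in [Z] whose amenable radical contains
    [s] is closed; so Baire's theorem in [Z], which is perfect because it is
    infinite and minimal, gives [Y] as soon as these sets have empty interior.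
    Otherwise, by minimality and compactness, there are [H] in [Z] and a finite
    [F] without the identity meeting every conjugate of [K = R_a(H)], and this
    contradicts C*-simplicity as follows.

    Let [Q] be a minimal invariant compact convex set of means on [G] (given
    below by its support function [h]). The amenable group [K] fixes some [q] in
    [Q], so every point of the orbit of [q] is fixed by an element of [F]. Choose
    [q] with [F] as small as possible. Translating a probability measure on the
    orbit so that its barycentre nearly maximizes a sum of squares concentrates
    it near a point (strong proximality), and by the choice of [F] one can then
    move it to points fixed by a single [s] in [F]. By minimax there are weights
    on finitely many non-trivial [t] such that every conjugate of the stabilizer
    [K'] of [q] contains more than 3/4 of the total weight. The group [K'] is
    amenable, having the invariant mean [q], so [l^2(G/K')] is weakly contained
    in [l^2(G)]. If [a] is the weighted average of the [t], then [Re a >= 1/2] on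
    [l^2(G/K')] whereas the trace of [a] vanishes; hence with [u] a multiple of
    [Re a - 1/4], the element [|u| - u] is non-zero in the reduced C*-algebra but
    vanishes on [l^2(G/K')]. *)
From HB Require Import structures.
Require Import Defs.
From mathcomp Require Import all_boot all_order all_algebra.
From mathcomp Require Import boolp classical_sets functions cardinality filter reals.
From mathcomp Require Import complex ring lra.
Set Implicit Arguments. Unset Strict Implicit. Unset Printing Implicit Defensive.
Import Order.TTheory GRing.Theory Num.Theory.
Local Open Scope classical_set_scope.
Local Open Scope ring_scope.

Local Notation "x ** y" := (gmul x y) (at level 40, left associativity).

(** * Ultralimits, sublinear functionals and invariant means *)

(** The constant 3/4 carries the argument. Off its fixed points [t] may act on [l^2(G/K')] with real
    part as low as -1, so weights of which a conjugate of [K'] captures a proportion [p] give only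
    the bound [2 p - 1], which is useful once [p > 1/2]. Knowing that [F] meets every conjugate
    yields no better than [1/|F|] from uniform weights; strong proximality raises the proportion,
    and any number strictly between 1/2 and 1 would do.

    No topology is put on means and no Hilbert space is built for [G/K']. A compact convex set of
    means is represented by a sublinear functional, so that Zorn, Hahn-Banach and ultralimits
    replace weak-* compactness, and a mean on [G] acts as a measure on an orbit. The two
    representations are two positive forms on one group algebra, where [bd] compares operator norms.
    This is why the absolute value is reached by an algebraic iteration: the same elements are then
    estimated in both forms. *)

Lemma eq_ler (R : numDomainType) (x y : R) : x = y -> x <= y.
Proof. by move->. Qed.

Section Bounded.
Variables (R : realType) (X : Type).
Implicit Types f g : X -> R.

Definition bdd f := exists B : R, forall x, `|f x| <= B.

Lemma bdd_cst (c : R) : bdd (fun=> c).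
Proof. by exists `|c|. Qed.

Lemma bddD f g : bdd f -> bdd g -> bdd (fun x => f x + g x).
Proof.
move=> [A fA] [B gB]; exists (A + B) => x.
by apply: le_trans (ler_normD _ _) _; apply: lerD.
Qed.

Lemma bddM f g : bdd f -> bdd g -> bdd (fun x => f x * g x).
Proof.
move=> [A fA] [B gB]; exists (A * B) => x.
by rewrite normrM; apply: ler_pM.
Qed.

Lemma bddZ (c : R) f : bdd f -> bdd (fun x => c * f x).
Proof. exact: bddM (bdd_cst c). Qed.

Lemma bddN f : bdd f -> bdd (fun x => - f x).
Proof. by move=> [A fA]; exists A => x; rewrite normrN. Qed.

Lemma bddB f g : bdd f -> bdd g -> bdd (fun x => f x - g x).
Proof. by move=> fb gb; apply: bddD fb (bddN gb). Qed.

Lemma bdd_sum (I : Type) (s : seq I) (F : I -> X -> R) :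
  (forall i, bdd (F i)) -> bdd (fun x => \sum_(i <- s) F i x).
Proof.
move=> Fb; elim: s => [|i s IHs].
  by exists 0 => x; rewrite big_nil normr0.
have [B FB] := bddD (Fb i) IHs.
by exists B => x; rewrite big_cons.
Qed.

Lemma bdd_nat (b : X -> bool) : bdd (fun x => (b x)%:R).
Proof. by exists 1 => x; rewrite normr_nat; case: (b x). Qed.

End Bounded.

Lemma bdd_comp (R : realType) (X Y : Type) (f : Y -> R) (u : X -> Y) :
  bdd f -> bdd (fun x => f (u x)).
Proof. by move=> [B fB]; exists B => x. Qed.

#[global] Hint Resolve bdd_cst bdd_nat : core.

Section UltraLimit.
Variables (R : realType) (I : Type) (U : set_system I).
Hypothesis UU : UltraFilter U.
Implicit Types a b : I -> R.

(** The supremum of the lower bounds valid [U]-almost everywhere. For bounded [a] it is the limit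
    along [U], which always exists, so no subsequence has to be extracted. *)
Definition ulim a : R := sup [set r | U [set i | r <= a i]].

Lemma ulimP a : bdd a -> forall e, 0 < e -> U [set i | `|a i - ulim a| < e].
Proof.
move=> [B aB] e e0; set S := [set r | U [set i | r <= a i]].
have BP i : - B <= a i /\ a i <= B by move: (aB i); rewrite ler_norml => /andP.
have hS : has_sup S.
  split; first by exists (- B); rewrite /S /=; apply: filterS (filterT) => i _ /=; exact: (BP i).1.
  exists B => r Sr; have [i /= ri] := filter_ex Sr.
  exact: le_trans ri (BP i).2.
have [r Sr rlt] := sup_adherent e0 hS.
have nS : ~ S (ulim a + e).
  move=> /(sup_upper_bound hS); rewrite -/(ulim a) gerDl => /le_lt_trans/(_ e0).
  by rewrite ltxx.
have [//|nSC] := in_ultra_setVsetC [set i | ulim a + e <= a i] UU.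
apply: filterS (filterI Sr nSC) => i /= [ri /negP].
rewrite -ltNge => li; rewrite ltr_norml.
have := lt_le_trans rlt ri; rewrite -/(ulim a) => rlt'.
by apply/andP; split; lra.
Qed.

Lemma ulim_unique a l : bdd a -> (forall e, 0 < e -> U [set i | `|a i - l| <= e]) ->
  ulim a = l.
Proof.
move=> ab al; apply/eqP; rewrite -subr_eq0 -normr_eq0 eq_le normr_ge0 andbT.
apply/ler_addgt0Pr => e e0; rewrite add0r.
have e2 : 0 < e / 2 by lra.
have [i /= [h1 h2]] := filter_ex (filterI (ulimP ab e2) (al _ e2)).
rewrite -(subrK (a i) (ulim a)) -addrA; apply: le_trans (ler_normD _ _) _.
by rewrite distrC; lra.
Qed.

Lemma ulim_near a l : bdd a -> U [set i | a i = l] -> ulim a = l.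
Proof.
move=> ab al; apply: ulim_unique => // e e0; apply: filterS al => i /= ->.
by rewrite subrr normr0 ltW.
Qed.

Lemma ulim_le a (B : R) : bdd a -> U [set i | a i <= B] -> ulim a <= B.
Proof.
move=> ab aB; apply/ler_addgt0Pr => e e0.
have [i /= [h1 h2]] := filter_ex (filterI (ulimP ab e0) aB).
by move: h1; rewrite ltr_norml => /andP[]; lra.
Qed.

Lemma ulimD a b : bdd a -> bdd b -> ulim (fun i => a i + b i) = ulim a + ulim b.
Proof.
move=> ab bb; apply: ulim_unique => [|e e0]; first exact: bddD.
have e2 : 0 < e / 2 by lra.
apply: filterS (filterI (ulimP ab e2) (ulimP bb e2)) => i /= [].
by rewrite !ltr_norml ler_norml => /andP[? ?] /andP[? ?]; apply/andP; split; lra.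
Qed.

Lemma ulimM a b : bdd a -> bdd b -> ulim (fun i => a i * b i) = ulim a * ulim b.
Proof.
move=> ab bb; apply: ulim_unique => [|e e0]; first exact: bddM.
have [B aB] := ab.
set M := `|B| + `|ulim b| + 1.
have M0 : 0 < M by rewrite /M ltr_wpDl // addr_ge0.
have d0 : 0 < e / M by apply: divr_gt0.
apply: filterS (filterI (ulimP ab d0) (ulimP bb d0)) => i /= [h1 h2].
have -> : a i * b i - ulim a * ulim b = a i * (b i - ulim b) + ulim b * (a i - ulim a) by ring.
apply: le_trans (ler_normD _ _) _; rewrite !normrM.
have h3 : `|a i| * `|b i - ulim b| <= `|B| * (e / M).
  by apply: ler_pM => //; [exact: le_trans (aB i) (ler_norm _) | exact: ltW].
have h4 : `|ulim b| * `|a i - ulim a| <= `|ulim b| * (e / M).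
  by apply: ler_wpM2l => //; exact: ltW.
apply: (le_trans (lerD h3 h4)).
rewrite -mulrDl mulrA ler_pdivrMr // mulrC ler_wpM2l ?ltW//.
by rewrite /M ltrDl.
Qed.

Lemma ulim_cst (c : R) : ulim (fun=> c) = c.
Proof. by apply: ulim_near => //; apply: filterS filterT. Qed.

Lemma ulimZ (c : R) a : bdd a -> ulim (fun i => c * a i) = c * ulim a.
Proof. by move=> ab; rewrite ulimM // ulim_cst. Qed.

Lemma ulim_sum (J : Type) (s : seq J) (F : J -> I -> R) :
  (forall j, bdd (F j)) ->
  ulim (fun i => \sum_(j <- s) F j i) = \sum_(j <- s) ulim (F j).
Proof.
move=> Fb; elim: s => [|j s IHs].
  by under eq_fun do rewrite big_nil; rewrite big_nil ulim_cst.
under eq_fun do rewrite big_cons.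
by rewrite big_cons ulimD ?IHs//; apply: bdd_sum.
Qed.

End UltraLimit.

(** The tails of a directed preorder form a filter base; an ultrafilter above it turns convergence
    along a net into [ulim]. *)
Lemma directed_ultra (I : Type) (le : I -> I -> Prop) (i0 : I) :
  (forall i, le i i) -> (forall i j k, le i j -> le j k -> le i k) ->
  (forall i j, exists k, le i k /\ le j k) ->
  exists U : set_system I, UltraFilter U /\ forall i, U [set j | le i j].
Proof.
move=> lexx letr ledir.
pose F : set_system I := [set A | exists i, [set j | le i j] `<=` A].
have FF : ProperFilter F.
  split; first by move=> [i /(_ i)]; apply; exact: lexx.
  split=> [|A B [i iA] [j jB]|A B AB [i iA]].
  - by exists i0.
  - have [k [ik jk]] := ledir i j; exists k => l /= kl; split.
      by apply: iA; apply: letr kl.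
    by apply: jB; apply: letr kl.
  - by exists i; apply: subset_trans AB.
have [U [UU FU]] := ultraFilterLemma FF.
by exists U; split=> // i; apply: FU; exists i.
Qed.

Lemma nat_ultra : exists U : set_system nat, UltraFilter U /\
  forall n, U [set m | (n <= m)%N].
Proof.
apply: (@directed_ultra nat (fun m n => is_true (m <= n)%N) 0%N) => //.
- by move=> i j k; exact: leq_trans.
- by move=> i j; exists (maxn i j); rewrite leq_maxl leq_maxr.
Qed.

Section Sublinear.
Variables (R : realType) (X : Type).
Implicit Types (f g : X -> R) (p q m : (X -> R) -> R).

(** These are the support functions of non-empty compact convex sets of means. Inclusion of sets
    becomes the order [le_bdd], and a single point becomes a [mean]. *)
Definition sublin p :=
  (forall f g, bdd f -> bdd g -> p (fun x => f x + g x) <= p f + p g) /\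
  (forall c f, 0 <= c -> bdd f -> p (fun x => c * f x) = c * p f) /\
  (forall f B, bdd f -> (forall x, f x <= B) -> p f <= B).

Definition mean m :=
  (forall f g, bdd f -> bdd g -> m (fun x => f x + g x) = m f + m g) /\
  (forall c f, bdd f -> m (fun x => c * f x) = c * m f) /\
  (forall f B, bdd f -> (forall x, f x <= B) -> m f <= B).

Definition le_bdd p q := forall f, bdd f -> p f <= q f.

Lemma sublin_ge p f B : sublin p -> bdd f -> (forall x, B <= f x) -> B <= p f.
Proof.
move=> [pD [pZ pB]] fb Bf.
have p0 : p (fun=> 0) = 0.
  have := pZ 0 (fun=> 0) (lexx _) (@bdd_cst R X 0); under eq_fun do rewrite mul0r.
  by rewrite mul0r.
have := pD f (fun x => - f x) fb (bddN fb).
under eq_fun do rewrite subrr.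
rewrite p0 => h; have h2 : p (fun x => - f x) <= - B.
  by apply: pB (bddN fb) _ => x; rewrite lerN2.
lra.
Qed.

Lemma mean_sublin m : mean m -> sublin m.
Proof. by move=> [mD [mZ mB]]; split=> [f g fb gb|]; [rewrite mD | split=> // c f _; exact: mZ]. Qed.

Lemma mean_ge m f B : mean m -> bdd f -> (forall x, B <= f x) -> B <= m f.
Proof. by move=> /mean_sublin; exact: sublin_ge. Qed.

Lemma mean_cst m (c : R) : mean m -> m (fun=> c) = c.
Proof.
move=> mm; apply/eqP; rewrite eq_le; apply/andP; split.
  exact: mm.2.2.
exact: mean_ge.
Qed.

Lemma meanN m f : mean m -> bdd f -> m (fun x => - f x) = - m f.
Proof.
move=> [_ [mZ _]] fb; rewrite -mulN1r -mZ//.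
by congr m; apply/funext => x; rewrite mulN1r.
Qed.

Lemma meanB m f g : mean m -> bdd f -> bdd g -> m (fun x => f x - g x) = m f - m g.
Proof. by move=> mm fb gb; rewrite mm.1 ?meanN//; exact: bddN. Qed.

Lemma mean_sum m (I : Type) (s : seq I) (F : I -> X -> R) : mean m ->
  (forall i, bdd (F i)) ->
  m (fun x => \sum_(i <- s) F i x) = \sum_(i <- s) m (F i).
Proof.
move=> mm Fb; elim: s => [|i s IHs].
  by under eq_fun do rewrite big_nil; rewrite big_nil mean_cst.
under eq_fun do rewrite big_cons.
by rewrite big_cons mm.1 ?IHs//; apply: bdd_sum.
Qed.

Definition fun_inv (Ga : set (X -> X)) p :=
  forall u f, Ga u -> bdd f -> p (fun x => f (u x)) = p f.

(** Zorn's lemma, where a chain is bounded by its pointwise infimum. An empty [Ga] serves for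
    Hahn-Banach, the translations of [G] for minimal invariant sets of means. *)
Lemma minimal_sublin (Ga : set (X -> X)) p0 : sublin p0 -> fun_inv Ga p0 ->
  exists p, [/\ sublin p, fun_inv Ga p, le_bdd p p0 &
    forall q, sublin q -> fun_inv Ga q -> le_bdd q p -> le_bdd p q].
Proof.
move=> p0s p0i.
pose T := {p | [/\ sublin p, fun_inv Ga p & le_bdd p p0]}.
have P0 : [/\ sublin p0, fun_inv Ga p0 & le_bdd p0 p0] by split.
pose t0 : T := exist _ p0 P0.
(* The order is reversed, so a maximal element for [Rel] is a minimal functional. *)
pose Rel (s t : T) : bool := `[< le_bdd (sval t) (sval s) >].
have [|||[p [ps pi pp0]] pmin] := @ZL_preorder T t0 Rel.
- by move=> t; apply/asboolP => f.
- by move=> r s t /asboolP h1 /asboolP h2; apply/asboolP => f fb; exact: le_trans (h2 f fb) (h1 f fb).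
- move=> A Atot.
  have [->|/set0P[t1 At1]] := eqVneq A set0; first by exists t0.
  pose S f := [set sval t f | t in A].
  pose p f := inf (S f).
  have hS f : bdd f -> has_inf (S f).
    move=> [B fB]; split; first by exists (sval t1 f), t1.
    exists (- B) => _ [t At <-].
    have [ts _ _] := svalP t.
    apply: sublin_ge ts _ _; first by exists B.
    by move=> x; move: (fB x); rewrite ler_norml => /andP[].
  have lep t f : A t -> bdd f -> p f <= sval t f.
    move=> At fb; apply: ge_inf; first exact: (hS f fb).2.
    by exists t.
  have gep f B : bdd f -> (forall t, A t -> B <= sval t f) -> B <= p f.
    move=> fb h; apply: lb_le_inf; first exact: (hS f fb).1.
    by move=> _ [t At <-]; exact: h.
  have ps : sublin p.
    split; [|split].
    - move=> f g fb gb.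
      (* The infima at [f] and [g] may be approached by different members of the chain; the lower of
         the two serves for both. *)
      suff h : forall t s, A t -> A s -> p (fun x => f x + g x) <= sval t f + sval s g.
        rewrite -lerBlDl; apply: (gep) => // s As; rewrite lerBlDl -lerBlDr.
        by apply: gep => // t At; rewrite lerBlDr; exact: h.
      move=> t s At As.
      have [/asboolP ts|/asboolP st] := Atot t s At As.
        apply: le_trans (lep s _ As (bddD fb gb)) _.
        have [[sD _] _ _] := svalP s.
        by apply: le_trans (sD _ _ fb gb) _; apply: lerD => //; exact: ts.
      apply: le_trans (lep t _ At (bddD fb gb)) _.
      have [[tD _] _ _] := svalP t.
      by apply: le_trans (tD _ _ fb gb) _; apply: lerD => //; exact: st.
    - move=> c f c0 fb.
      have tZ (t : T) : sval t (fun x => c * f x) = c * sval t f.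
        by have [[_ [tZ _]] _ _] := svalP t; exact: tZ.
      apply/eqP; rewrite eq_le; apply/andP; split; last first.
        apply: gep; first exact: bddZ.
        by move=> t At; rewrite tZ ler_wpM2l // lep.
      move: c0; rewrite [0 <= c]le_eqVlt => /orP[/eqP c0|c0].
        by have := lep t1 _ At1 (bddZ c fb); rewrite tZ -c0 !mul0r.
      rewrite mulrC -ler_pdivrMr//; apply: gep => // t At.
      by rewrite ler_pdivrMr// mulrC -tZ; apply: lep => //; exact: bddZ.
    - move=> f B fb fB; apply: le_trans (lep t1 f At1 fb) _.
      by have [[_ [_ tB]] _ _] := svalP t1; exact: tB.
  have pi : fun_inv Ga p.
    move=> u f Gu fb; rewrite /p; congr inf; apply/seteqP.
    have h (t : T) : sval t (fun x => f (u x)) = sval t f by have [_ ti _] := svalP t; exact: ti.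
    by split=> [_ [t At <-]|_ [t At <-]]; exists t.
  have pp0 : le_bdd p p0.
    move=> f fb; apply: le_trans (lep t1 f At1 fb) _.
    by have [_ _] := svalP t1; exact.
  have Pp : [/\ sublin p, fun_inv Ga p & le_bdd p p0] by split.
  exists (exist _ p Pp) => s As; apply/asboolP => f fb /=.
  exact: lep.
- exists p; split=> // q qs qi qp.
  have Pq : [/\ sublin q, fun_inv Ga q & le_bdd q p0].
    by split=> // f fb; apply: le_trans (qp f fb) (pp0 f fb).
  have /asboolP := pmin (exist _ q Pq) (asboolT qp).
  exact.
Qed.

(* A minimal sublinear functional is linear: otherwise its directional
   derivative at some [f] would be strictly smaller. *)
Lemma hahn_banach_mean p0 : sublin p0 -> exists m, mean m /\ le_bdd m p0.
Proof.
move=> p0s.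
have [|p [ps _ pp0 pmin]] := @minimal_sublin set0 p0 p0s; first by [].
have [pD [pZ pB]] := ps.
suff pN f : bdd f -> p (fun x => - f x) <= - p f.
  have pN' f : bdd f -> p (fun x => - f x) = - p f.
    move=> fb; apply/eqP; rewrite eq_le pN//= lerNl.
    have := pD _ _ fb (bddN fb); under eq_fun do rewrite subrr.
    have := sublin_ge ps (bdd_cst X 0) (fun=> lexx 0); lra.
  exists p; split=> //; split; [|split=> //].
  - move=> f g fb gb; apply/eqP; rewrite eq_le pD//=.
    have := pD _ _ (bddN fb) (bddN gb).
    under eq_fun do rewrite -opprD.
    by rewrite !pN'//; [lra|exact: bddD].
  - move=> c f fb; have [c0|c0] := leP 0 c; first exact: pZ.
    have -> : (fun x => c * f x) = (fun x => - (- c * f x)).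
      by apply/funext => x; rewrite mulNr opprK.
    rewrite pN'; last exact: bddZ.
    by rewrite pZ ?oppr_ge0 ?ltW// mulNr opprK.
move=> f0b; set f0 := f in f0b *.
pose S f := [set p (fun x => f x + t * f0 x) - t * p f0 | t in [set t : R | 0 <= t]].
pose q g := inf (S g).
have bt g t : bdd g -> bdd (fun x => g x + t * f0 x) by move=> gb; apply: bddD gb (bddZ _ f0b).
have hS g : bdd g -> has_inf (S g).
  move=> gb; split; first by exists (p (fun x => g x + 0 * f0 x) - 0 * p f0), 0 => //=.
  exists (- p (fun x => - g x)) => _ [t t0 <-].
  have := pD _ _ (bt g t gb) (bddN gb).
  have -> : (fun x => g x + t * f0 x + - g x) = (fun x => t * f0 x).
    by apply/funext => x; ring.
  rewrite pZ//; lra.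
have leq g t : bdd g -> 0 <= t -> q g <= p (fun x => g x + t * f0 x) - t * p f0.
  by move=> gb t0; apply: ge_inf; [exact: (hS g gb).2|exists t].
have geq g B : bdd g -> (forall t, 0 <= t -> B <= p (fun x => g x + t * f0 x) - t * p f0) -> B <= q g.
  by move=> gb h; apply: lb_le_inf; [exact: (hS g gb).1|move=> _ [t t0 <-]; exact: h].
have qp : le_bdd q p.
  move=> g gb; have := leq g 0 gb (lexx _).
  by under eq_fun do rewrite mul0r addr0; rewrite mul0r subr0.
have qs : sublin q.
  split; [|split].
  - move=> f1 f2 b1 b2.
    rewrite -lerBlDl; apply: (geq) => // s s0; rewrite lerBlDl -lerBlDr.
    apply: geq => // t t0; rewrite lerBlDr.
    apply: le_trans (leq _ (t + s) (bddD b1 b2) (addr_ge0 t0 s0)) _.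
    have -> : (fun x => f1 x + f2 x + (t + s) * f0 x) =
      (fun x => (f1 x + t * f0 x) + (f2 x + s * f0 x)) by apply/funext => x; ring.
    have := pD _ _ (bt _ t b1) (bt _ s b2); lra.
  - move=> c g c0 gb; apply/eqP; rewrite eq_le; apply/andP; split; last first.
      apply: geq => [|t t0]; first exact: bddZ.
      move: c0; rewrite [0 <= c]le_eqVlt => /orP[/eqP c0|c0].
        rewrite -c0 mul0r; under eq_fun do rewrite mul0r add0r.
        by rewrite pZ// subrr.
      have tc : 0 <= t / c by rewrite divr_ge0// ltW.
      have := leq g (t / c) gb tc; rewrite -(ler_pM2l c0) => /le_trans; apply.
      rewrite mulrBr -[c * p _]pZ ?(ltW c0)//; last exact: bt.
      have -> : (fun x => c * (g x + t / c * f0 x)) = (fun x => c * g x + t * f0 x).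
        by apply/funext => x; field; rewrite gt_eqF.
      by apply: eq_ler; field; rewrite gt_eqF.
    move: c0; rewrite [0 <= c]le_eqVlt => /orP[/eqP c0|c0].
      rewrite -c0 mul0r; have -> : (fun x => 0 * g x) = fun=> 0.
        by apply/funext => x; rewrite mul0r.
      by apply: le_trans (qp _ (bdd_cst X 0)) _; exact: pB.
    rewrite mulrC -ler_pdivrMr//; apply: geq => // t t0; rewrite ler_pdivrMr//.
    apply: le_trans (leq _ (c * t) (bddZ c gb) (mulr_ge0 (ltW c0) t0)) _.
    have -> : (fun x => c * g x + c * t * f0 x) = (fun x => c * (g x + t * f0 x)).
      by apply/funext => x; ring.
    rewrite pZ ?(ltW c0)//; last exact: bt.
    by apply: eq_ler; ring.
  - by move=> g B gb gB; apply: le_trans (qp g gb) _; exact: pB.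
(* By minimality [p (- f0) <= q (- f0)], and the choice [t = 1] in [q] leaves [p 0 - p f0]. *)
have := pmin q qs (fun _ _ h => False_ind _ h) qp (fun x => - f0 x) (bddN f0b).
move=> /le_trans; apply.
have := leq (fun x => - f0 x) 1 (bddN f0b) ler01.
have -> : (fun x => - f0 x + 1 * f0 x) = fun=> 0.
  by apply/funext => x; rewrite mul1r addNr.
rewrite mul1r => /le_trans; apply.
by rewrite gerDr pB.
Qed.

Lemma sup_sublin : inhabited X -> sublin (fun f => sup (range f)).
Proof.
move=> [x0].
have hs f : bdd f -> has_sup (range f).
  move=> [B fB]; split; first by exists (f x0), x0.
  by exists B => _ [x _ <-]; move: (fB x); rewrite ler_norml => /andP[].
have les f x : bdd f -> f x <= sup (range f).
  by move=> fb; apply: ub_le_sup; [exact: (hs f fb).2|exists x].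
have ges f B : bdd f -> (forall x, f x <= B) -> sup (range f) <= B.
  by move=> fb h; apply: ge_sup; [exact: (hs f fb).1|move=> _ [x _ <-]].
split; [|split] => //.
- move=> f g fb gb; apply: ges; first exact: bddD.
  by move=> x; apply: lerD; exact: les.
- move=> c f c0 fb; apply/eqP; rewrite eq_le; apply/andP; split.
    by apply: ges; [exact: bddZ|move=> x; apply: ler_wpM2l => //; exact: les].
  move: c0; rewrite [0 <= c]le_eqVlt => /orP[/eqP<-|c0].
    rewrite mul0r; apply: le_trans (les _ x0 _); first by rewrite mul0r.
    exact: bddZ.
  rewrite mulrC -ler_pdivlMr//; apply: ges => // x; rewrite ler_pdivlMr// mulrC.
  exact: (les (fun x => c * f x)  x (bddZ c fb)).
Qed.

(** Hahn-Banach for [q f], the infimum over non-negative combinations [c] of the supremum of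
    [f + c]. The hypothesis keeps [q] finite, and a mean below [q] is at most 0 on every [- u t]. *)
Lemma minimax (T : Type) (u : T -> X -> R) : inhabited X -> (forall t, bdd (u t)) ->
  (forall c : seq (R * T), List.Forall (fun w => 0 <= w.1) c ->
    exists x, 0 <= \sum_(w <- c) w.1 * u w.2 x) ->
  exists m, mean m /\ forall t, 0 <= m (u t).
Proof.
move=> X0 ub hc.
have [sD [sZ sB]] := sup_sublin X0.
pose s f := sup (range f).
pose cm (c : seq (R * T)) := fun x => \sum_(w <- c) w.1 * u w.2 x.
have cb c : bdd (cm c) by apply: bdd_sum => w; apply: bddZ.
pose P (c : seq (R * T)) := List.Forall (fun w => 0 <= w.1) c.
pose S f := [set s (fun x => f x + cm c x) | c in [set c | P c]].
pose q f := inf (S f).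
have bc f c : bdd f -> bdd (fun x => f x + cm c x) by move=> fb; exact: bddD.
have P0 : P [::] by exact: List.Forall_nil.
have cm0 : cm [::] = fun=> 0 by apply/funext => x; rewrite /cm big_nil.
have sub : sublin s by [].
have hS f : bdd f -> has_inf (S f).
  move=> fb; split; first by exists (s (fun x => f x + cm [::] x)), [::].
  have [B fB] := fb.
  exists (- B) => _ [c Pc <-].
  have [x cx] := hc c Pc.
  apply: (@le_trans _ _ (f x + cm c x)).
    by rewrite -[leLHS]addr0 lerD//; move: (fB x); rewrite ler_norml => /andP[].
  have [D DB] := bc f c fb.
  apply: ub_le_sup; last by exists x.
  by exists D => _ [y _ <-]; move: (DB y); rewrite ler_norml => /andP[].
have leq f c : bdd f -> P c -> q f <= s (fun x => f x + cm c x).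
  by move=> fb Pc; apply: ge_inf; [exact: (hS f fb).2|exists c].
have geq f B : bdd f -> (forall c, P c -> B <= s (fun x => f x + cm c x)) -> B <= q f.
  by move=> fb h; apply: lb_le_inf; [exact: (hS f fb).1|move=> _ [c Pc <-]; exact: h].
pose sc (a : R) (c : seq (R * T)) := [seq (a * w.1, w.2) | w <- c].
have Psc a c : 0 <= a -> P c -> P (sc a c).
  move=> a0; elim: c => [//|w c IHc] /List.Forall_cons_iff[w0 Pc].
  by apply/List.Forall_cons_iff; split; [exact: mulr_ge0|exact: IHc].
have cmsc a c x : cm (sc a c) x = a * cm c x.
  by rewrite /cm /sc big_map mulr_sumr; apply: eq_bigr => w _; rewrite mulrA.
have qs : sublin q.
  split; [|split].
  - move=> f g fb gb.
    rewrite -lerBlDl; apply: (geq) => // c Pc; rewrite lerBlDl -lerBlDr.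
    apply: geq => // d Pd; rewrite lerBlDr.
    have Pdc : P (d ++ c) by apply/List.Forall_app.
    apply: le_trans (leq _ _ (bddD fb gb) Pdc) _.
    have -> : (fun x => f x + g x + cm (d ++ c) x) =
      (fun x => (f x + cm d x) + (g x + cm c x)).
      by apply/funext => x; rewrite /cm big_cat /=; ring.
    by apply: sD; exact: bc.
  - move=> a f a0 fb; apply/eqP; rewrite eq_le; apply/andP; split; last first.
      apply: geq => [|c Pc]; first exact: bddZ.
      move: a0; rewrite [0 <= a]le_eqVlt => /orP[/eqP a0|a0].
        rewrite -a0 mul0r; have [x cx] := hc c Pc.
        apply: (@le_trans _ _ (0 * f x + cm c x)); first by rewrite mul0r add0r.
        have [D DB] := bc _ c (bddZ 0 fb).
        apply: ub_le_sup; last by exists x.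
        by exists D => _ [y _ <-]; move: (DB y); rewrite ler_norml => /andP[].
      have ai : 0 <= a^-1 by rewrite invr_ge0 ltW.
      have := leq f (sc a^-1 c) fb (Psc _ _ ai Pc); rewrite -(ler_pM2l a0) => /le_trans; apply.
      rewrite -sZ ?(ltW a0)//; last exact: bc.
      apply: eq_ler; congr s; apply/funext => x; rewrite cmsc.
      by field; rewrite gt_eqF.
    move: a0; rewrite [0 <= a]le_eqVlt => /orP[/eqP a0|a0].
      rewrite -a0 mul0r; have := leq _ _ (bddZ 0 fb) P0.
      by rewrite cm0 => /le_trans; apply; apply: sB => [|x]; rewrite ?mul0r ?addr0//; apply: bddD => //; exact: bddZ.
    rewrite mulrC -ler_pdivrMr//; apply: geq => // c Pc; rewrite ler_pdivrMr//.
    apply: le_trans (leq _ _ (bddZ a fb) (Psc a c (ltW a0) Pc)) _.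
    rewrite mulrC -sZ ?(ltW a0)//; last exact: bc.
    by apply: eq_ler; congr s; apply/funext => x; rewrite cmsc mulrDr.
  - move=> f B fb fB; apply: le_trans (leq f _ fb P0) _.
    by apply: sB => [|x]; [exact: bc|rewrite cm0 addr0].
have [m [mm mq]] := hahn_banach_mean qs.
exists m; split=> // t.
rewrite -oppr_le0 -meanN//; apply: le_trans (mq _ (bddN (ub t))) _.
have Pt : P [:: (1, t)] by apply/List.Forall_cons_iff.
apply: le_trans (leq _ _ (bddN (ub t)) Pt) _.
apply: sB => [|x]; first by apply: bc; exact: bddN.
by rewrite /cm big_seq1 mul1r addNr.
Qed.

End Sublinear.

HB.instance Definition _ (G : group) := gen_eqMixin (gcar G).
HB.instance Definition _ (G : group) := gen_choiceMixin (gcar G).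


Section GroupTheory.
Variable G : group.
Implicit Types x y z g : G.

Lemma gmulVr x : x ** ginv x = gone G.
Proof.
rewrite -[LHS]gmul1 -{1}(gmulV (ginv x)) -gmulA (gmulA (ginv x)) gmulV gmul1.
by rewrite gmulV.
Qed.

Lemma gmul1r x : x ** gone G = x.
Proof. by rewrite -(gmulV x) gmulA gmulVr gmul1. Qed.

Lemma gmulK x y : x ** y ** ginv y = x.
Proof. by rewrite -gmulA gmulVr gmul1r. Qed.

Lemma gmulVK x y : x ** ginv y ** y = x.
Proof. by rewrite -gmulA gmulV gmul1r. Qed.

Lemma gmulI x y z : x ** y = x ** z -> y = z.
Proof. by move=> h; rewrite -[y]gmul1 -(gmulV x) -gmulA h gmulA gmulV gmul1. Qed.

Lemma ginvK x : ginv (ginv x) = x.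
Proof. by apply: (@gmulI (ginv x)); rewrite gmulVr gmulV. Qed.

Lemma ginv1 : ginv (gone G) = gone G.
Proof. by rewrite -[LHS]gmul1 gmulVr. Qed.

Lemma ginvM x y : ginv (x ** y) = ginv y ** ginv x.
Proof. by apply: (@gmulI (x ** y)); rewrite gmulVr gmulA gmulK gmulVr. Qed.

Definition grpE := (ginvM, ginvK, ginv1, gmul1r, gmul1, gmulA, gmulVr, gmulV, gmulK, gmulVK).

Lemma subgroup_translate (K : set G) k x : is_subgroup K -> K k -> K (k ** x) <-> K x.
Proof.
move=> [_ [KM KV]] Kk; split=> [h|]; last exact: KM.
by have := KM _ _ (KV _ Kk) h; rewrite !grpE.
Qed.

End GroupTheory.

(** * Invariant means on subgroups and the amenable radical *)

Section InvariantMean.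
Variables (R : realType) (G : group).
Implicit Types (K N H : set G) (m : (G -> R) -> R) (f : G -> R).

Definition inv_mean K m := mean m /\
  forall k f, K k -> bdd f -> m (fun x => f (k ** x)) = m f.

Definition has_inv_mean K := exists m, inv_mean K m.

(** An ultralimit of means is a mean, and each [k] in [K] preserves almost all of them. This serves
    both directed unions and Chabauty limits of subgroups. *)
Lemma has_inv_mean_ulim (I : Type) (U : set_system I) (Ns : I -> set G) K :
  UltraFilter U -> (forall i, has_inv_mean (Ns i)) ->
  (forall k, K k -> U [set i | Ns i k]) -> has_inv_mean K.
Proof.
move=> UU /choice[m mN] KU.
have mm i : mean (m i) := (mN i).1.
have mb f : bdd f -> bdd (fun i => m i f).
  move=> [B fB]; exists B => i.
  have fb : bdd f by exists B.
  have h x : - B <= f x /\ f x <= B by move: (fB x); rewrite ler_norml => /andP.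
  rewrite ler_norml; apply/andP; split.
    by apply: mean_ge => // x; exact: (h x).1.
  by apply: (mm i).2.2 => // x; exact: (h x).2.
exists (fun f => ulim U (fun i => m i f)); split; first split; [|split|].
- move=> f g fb gb; rewrite -ulimD//; try exact: mb.
  by congr ulim; apply/funext => i; rewrite (mm i).1.
- move=> c f fb; rewrite -ulimZ//; last exact: mb.
  by congr ulim; apply/funext => i; rewrite (mm i).2.1.
- move=> f B fb fB; apply: ulim_le; first exact: mb.
  by apply: filterS (@filterT _ U _) => i _; exact: (mm i).2.2.
- move=> k f Kk fb.
  have fkb : bdd (fun x => f (k ** x)) by exact: bdd_comp fb.
  apply/eqP; rewrite -subr_eq0 -mulN1r -ulimZ -?ulimD//; try by [exact: mb|exact/bddZ/mb].
  apply/eqP; apply: ulim_near; first by apply: bddD; [exact: mb|exact/bddZ/mb].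
  apply: filterS (KU k Kk) => i Nk /=; rewrite (mN i).2//; ring.
Qed.

(** The mean is pushed forward along [pr], which maps [G] to [K] and commutes with left translation
    by [K]. *)
Lemma inv_mean_supported K : is_subgroup K -> has_inv_mean K ->
  exists m, inv_mean K m /\
    forall f g, bdd f -> bdd g -> (forall x, K x -> f x = g x) -> m f = m g.
Proof.
move=> Ks [m [mm mK]].
have [K1 [KM KV]] := Ks.
(* A representative of the coset [K x]; the default is never taken, since [x] itself qualifies. *)
pose r (x : G) : G := xget (gone G) [set y | K (y ** ginv x)].
have rK x : K (r x ** ginv x).
  by rewrite /r; case: xgetP => [y _ //|/(_ x)]; rewrite /= gmulVr.
have rk k x : K k -> r (k ** x) = r x.
  move=> Kk; rewrite /r; congr xget; apply/seteqP; split=> y /=.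
    by move=> /KM/(_ Kk); rewrite !grpE.
  by move=> /KM/(_ (KV _ Kk)); rewrite !grpE.
pose pr x := x ** ginv (r x).
have prK x : K (pr x) by have := KV _ (rK x); rewrite !grpE.
have prk k x : K k -> pr (k ** x) = k ** pr x by move=> Kk; rewrite /pr rk// gmulA.
exists (fun f => m (fun x => f (pr x))); split; first split; first split; [|split|..].
- by move=> f g fb gb; rewrite mm.1//; exact: bdd_comp.
- by move=> c f fb; rewrite mm.2.1//; exact: bdd_comp.
- by move=> f B fb fB; apply: mm.2.2 => //; exact: bdd_comp.
- move=> k f Kk fb; rewrite -[RHS](mK k)//; last exact: (bdd_comp pr fb).
  by congr m; apply/funext => x; rewrite prk.
- by move=> f g fb gb fg; congr m; apply/funext => x; exact: fg.
Qed.

Definition setprod N1 N2 : set G := [set z | exists x y, [/\ N1 x, N2 y & z = x ** y]].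

Lemma setprod_normal N1 N2 H : is_subgroup H -> normal_in N1 H -> normal_in N2 H ->
  normal_in (setprod N1 N2) H.
Proof.
move=> [H1 [HM HV]] [[I1 [M1 V1]] [s1 n1]] [[I2 [M2 V2]] [s2 n2]].
split; [split; [|split]|split].
- by exists (gone G), (gone G); rewrite gmul1.
- move=> _ _ [x [y [hx hy ->]]] [x' [y' [hx' hy' ->]]].
  exists (x ** (y ** x' ** ginv y)), (y ** y'); split; last by rewrite !grpE.
    by apply: M1 => //; apply: n1 => //; exact: s2.
  exact: M2.
- move=> _ [x [y [hx hy ->]]].
  exists (ginv y ** ginv x ** ginv (ginv y)), (ginv y); split; last by rewrite !grpE.
    by apply: n1; [exact/HV/s2|exact: V1].
  exact: V2.
- by move=> _ [x [y [hx hy ->]]]; apply: HM; [exact: s1|exact: s2].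
- move=> h _ Hh [x [y [hx hy ->]]].
  exists (h ** x ** ginv h), (h ** y ** ginv h); split; [exact: n1|exact: n2|].
  by rewrite !grpE.
Qed.

(** Integrate over [N2] inside and over [N1] outside. The outer mean must be supported on [N1],
    because [b x = x (x^-1 b x)] can be absorbed by the inner mean only when [x] normalizes [N2]. *)
Lemma setprod_has_inv_mean N1 N2 H : normal_in N1 H -> normal_in N2 H ->
  has_inv_mean N1 -> has_inv_mean N2 -> has_inv_mean (setprod N1 N2).
Proof.
move=> [s1 [N1H n1]] [s2 [N2H n2]] am1 [m2 [mm2 i2]].
have [m1 [[mm1 i1] sup1]] := inv_mean_supported s1 am1.
have [_ [_ V1]] := s1.
have b2 (F : G -> G -> R) : (exists B, forall x y, `|F x y| <= B) -> bdd (fun x => m2 (F x)).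
  move=> [B FB]; exists B => x.
  have Fb : bdd (F x) by exists B.
  have h y : - B <= F x y /\ F x y <= B by move: (FB x y); rewrite ler_norml => /andP.
  rewrite ler_norml; apply/andP; split.
    by apply: mean_ge => // y; exact: (h y).1.
  by apply: mm2.2.2 => // y; exact: (h y).2.
have bb f : bdd f -> bdd (fun x => m2 (fun y => f (x ** y))).
  by move=> [B fB]; apply: b2; exists B => x y.
exists (fun f => m1 (fun x => m2 (fun y => f (x ** y)))); split; first split; [|split|].
- move=> f g fb gb; rewrite -mm1.1; try exact: bb.
  by congr m1; apply/funext => x; rewrite mm2.1//; exact: bdd_comp.
- move=> c f fb; rewrite -mm1.2.1; last exact: bb.
  by congr m1; apply/funext => x; rewrite mm2.2.1//; exact: bdd_comp.
- move=> f B fb fB; apply: mm1.2.2 => [|x]; first exact: bb.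
  by apply: mm2.2.2 => //; exact: bdd_comp.
- move=> _ f [a [b [Na Nb ->]]] fb.
  have fab : bdd (fun z => f (a ** b ** z)) by exact: bdd_comp fb.
  transitivity (m1 (fun x => m2 (fun y => f (a ** x ** y)))).
    apply: sup1 => [||x Nx].
    + have := bb _ fab; congr bdd; apply/funext => x; congr m2; apply/funext => y; by rewrite !grpE.
    + have := bb _ (bdd_comp (fun z => a ** z) fb); congr bdd; apply/funext => x; congr m2.
      by apply/funext => y; rewrite !grpE.
    + have Nb' : N2 (ginv x ** b ** x).
        by have := n2 (ginv x) b; rewrite ginvK; apply => //; apply: N1H; exact: V1.
      rewrite -(i2 _ (fun y => f (a ** x ** y)) Nb'); last exact: bdd_comp fb.
      by congr m2; apply/funext => y; rewrite !grpE.
  by rewrite (i1 a (fun x => m2 (fun y => f (x ** y))))//; exact: bb.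
Qed.

(** The radical expressed through means of functions. By [amenable_has_inv_mean] it contains
    [amenable_radical], so its triviality is what has to be shown generically. *)
Definition mean_radical H : set G :=
  [set x | exists N, [/\ normal_in N H, has_inv_mean N & N x]].

Lemma triv_normal H : is_subgroup H -> normal_in [set gone G] H.
Proof.
move=> [H1 _]; split; [split; [|split]|split] => //.
- by move=> _ _ -> ->; rewrite /= gmul1.
- by move=> _ ->; rewrite /= ginv1.
- by move=> _ ->.
- by move=> h _ _ -> /=; rewrite !grpE.
Qed.

Lemma triv_has_inv_mean : has_inv_mean [set gone G].
Proof.
exists (fun f => f (gone G)); split; first split; [by []|split=> //|].
by move=> _ f -> _; rewrite gmul1.
Qed.

Lemma mean_radical_finite H (E : seq G) : is_subgroup H ->
  List.Forall (mean_radical H) E ->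
  exists N, [/\ normal_in N H, has_inv_mean N & List.Forall N E].
Proof.
move=> Hs; elim: E => [_|x E IHE /List.Forall_cons_iff[[N1 [n1 a1 N1x]] /IHE[N2 [n2 a2 N2E]]]].
  by exists [set gone G]; split; [exact: triv_normal|exact: triv_has_inv_mean|].
exists (setprod N1 N2); split; [exact: setprod_normal|exact: setprod_has_inv_mean n1 n2 _ _|].
have [[I1 _] _] := n1; have [[I2 _] _] := n2.
apply/List.Forall_cons_iff; split.
  by exists x, (gone G); rewrite gmul1r.
apply: List.Forall_impl N2E => y N2y.
by exists (gone G), y; rewrite gmul1.
Qed.

(** Every finite part of the radical lies in one normal subgroup with an invariant mean, namely a
    product; the means converge along the directed set of finite parts. *)
Lemma mean_radical_has_inv_mean H : is_subgroup H -> has_inv_mean (mean_radical H).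
Proof.
move=> Hs.
pose I := {E : seq G | List.Forall (mean_radical H) E}.
pose le (E F : I) := forall x, List.In x (sval E) -> List.In x (sval F).
have P0 : List.Forall (mean_radical H) [::] by [].
have [|||U [UU Ule]] := @directed_ultra I le (exist _ [::] P0).
- by move=> i x.
- by move=> i j k ij jk x /ij/jk.
- move=> [E PE] [F PF].
  have PEF : List.Forall (mean_radical H) (E ++ F) by apply/List.Forall_app.
  by exists (exist _ _ PEF); split=> x /= Ex; apply/List.in_app_iff; [left|right].
have /choice[N NP] : forall i : I, exists N, [/\ normal_in N H, has_inv_mean N & List.Forall N (sval i)].
  by move=> [E PE]; exact: mean_radical_finite.
apply: (has_inv_mean_ulim UU (Ns := N)) => [i|k Hk]; first by have [] := NP i.
have Pk : List.Forall (mean_radical H) [:: k] by apply/List.Forall_cons_iff.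
apply: filterS (Ule (exist _ _ Pk)) => i /(_ k (or_introl erefl)) ki /=.
by have [_ _ /List.Forall_forall] := NP i; exact.
Qed.

Lemma mean_radical_conjs H g x : is_subgroup H ->
  mean_radical (conjs g H) x -> mean_radical H (ginv g ** x ** g).
Proof.
move=> Hs [N [[[I1 [NM NV]] [NH nN]] [m [mm mi]] Nx]].
exists [set y | N (g ** y ** ginv g)]; split; last by rewrite /= !grpE.
- split; [split; [|split]|split] => /=.
  + by rewrite !grpE.
  + by move=> y z /NM h /h; rewrite !grpE.
  + by move=> y /NV; rewrite !grpE.
  + by move=> y /NH; rewrite /conjs /= !grpE.
  + move=> h n Hh Nn.
    have := nN (g ** h ** ginv g) _ _ Nn; rewrite !grpE; apply.
    by rewrite /conjs /= !grpE.
- exists (fun f => m (fun x => f (ginv g ** x))); split; first split; [|split|].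
  + by move=> f h fb hb; rewrite mm.1//; exact: bdd_comp.
  + by move=> c f fb; rewrite mm.2.1//; exact: bdd_comp.
  + by move=> f B fb fB; apply: mm.2.2 => //; exact: bdd_comp.
  + move=> k f Nk fb.
    rewrite -[RHS](mi _ _ Nk); last exact: (bdd_comp (fun x => ginv g ** x) fb).
    by congr m; apply/funext => y; rewrite !grpE.
Qed.

End InvariantMean.

(** * Integration against a finitely additive measure *)

Section Charge.
Variables (R : realType) (X : Type) (nu : set X -> R).
Hypothesis nu_ge0 : forall A, 0 <= nu A.
Hypothesis nu1 : nu setT = 1.
Hypothesis nuU : forall A B, A `&` B = set0 -> nu (A `|` B) = nu A + nu B.
Implicit Types (c d : seq (R * set X)) (f g : X -> R).

Definition simple_val c (x : X) : R := \sum_(w <- c) w.1 * `[< w.2 x >]%:R.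
Definition simple_int c : R := \sum_(w <- c) w.1 * nu w.2.

Lemma charge_split A B : nu A = nu (A `&` B) + nu (A `\` B).
Proof.
rewrite -nuU; last by apply/seteqP; split=> x //= [[_ ?] [_ ?]].
congr nu; apply/seteqP; split=> x /=; last by move=> [[]|[]].
by move=> Ax; have [Bx|Bx] := pselect (B x); [left|right].
Qed.

(** Positivity without disjoint normal forms: cut [E] along the first set of the list and add its
    coefficient to the constant [a] on the inner piece. *)
Lemma simple_int_ge0_on c (E : set X) (a : R) :
  (forall x, E x -> 0 <= simple_val c x + a) ->
  0 <= \sum_(w <- c) w.1 * nu (E `&` w.2) + a * nu E.
Proof.
elim: c E a => [|[b A] c IHc] E a h.
  rewrite big_nil add0r; have [->|/set0P[x Ex]] := eqVneq E set0.
    have := nuU (set0I (set0 : set X)); rewrite setU0 => /eqP.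
    by rewrite addrC -subr_eq subrr eq_sym => /eqP ->; rewrite mulr0.
  by rewrite mulr_ge0//; have := h x Ex; rewrite /simple_val big_nil add0r.
have h1 x : (E `&` A) x -> 0 <= simple_val c x + (a + b).
  move=> [Ex Ax]; have := h x Ex; rewrite /simple_val big_cons /= asboolT//= mulr1.
  by move=> /le_trans; apply; apply: eq_ler; ring.
have h2 x : (E `\` A) x -> 0 <= simple_val c x + a.
  by move=> [Ex Ax]; have := h x Ex; rewrite /simple_val big_cons /= asboolF//= mulr0 add0r.
have := addr_ge0 (IHc _ _ h1) (IHc _ _ h2); rewrite big_cons /=.
suff -> : \sum_(w <- c) w.1 * nu (E `&` w.2) =
  \sum_(w <- c) w.1 * nu (E `&` A `&` w.2) + \sum_(w <- c) w.1 * nu ((E `\` A) `&` w.2).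
  rewrite (charge_split E A) => /le_trans; apply; apply: eq_ler; ring.
rewrite -big_split; apply: eq_bigr => w _.
rewrite /= -mulrDr (charge_split _ A); congr (_ * (nu _ + nu _)); first by rewrite setIAC.
by apply/seteqP; split=> x /= [[]].
Qed.

Lemma simple_valD c d x : simple_val (c ++ d) x = simple_val c x + simple_val d x.
Proof. exact: big_cat. Qed.

Lemma simple_intD c d : simple_int (c ++ d) = simple_int c + simple_int d.
Proof. exact: big_cat. Qed.

Definition simple_scale (a : R) c := [seq (a * w.1, w.2) | w <- c].

Lemma simple_valZ a c x : simple_val (simple_scale a c) x = a * simple_val c x.
Proof. by rewrite /simple_val big_map mulr_sumr; apply: eq_bigr => w _; rewrite mulrA. Qed.

Lemma simple_intZ a c : simple_int (simple_scale a c) = a * simple_int c.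
Proof. by rewrite /simple_int big_map mulr_sumr; apply: eq_bigr => w _; rewrite mulrA. Qed.

Lemma simple_int_le c d (a : R) : (forall x, simple_val c x <= simple_val d x + a) ->
  simple_int c <= simple_int d + a.
Proof.
move=> h; have := @simple_int_ge0_on (d ++ simple_scale (-1) c) setT a.
under eq_bigr do rewrite setTI.
rewrite -/(simple_int _) simple_intD simple_intZ nu1 mulr1 mulN1r => h2.
rewrite -subr_ge0; have -> : simple_int d + a - simple_int c = simple_int d - simple_int c + a by ring.
apply: h2 => x _; rewrite simple_valD simple_valZ mulN1r.
by have := h x; lra.
Qed.

(** Bisection of the range: subtracting [L / 2] wherever [f] exceeds the midpoint halves the
    oscillation. *)
Lemma simple_approx_dyadic k (a L : R) f : (forall x, a <= f x <= a + L) ->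
  exists c, forall x, simple_val c x - L / 2 ^+ k <= f x <= simple_val c x.
Proof.
elim: k L f => [|k IHk] L f h.
  exists [:: (a + L, setT)] => x; rewrite /simple_val big_seq1 /= asboolT// mulr1 expr0.
  by have /andP[h1 h2] := h x; apply/andP; split; lra.
pose A := [set x | a + L / 2 < f x].
have [|c hc] := IHk (L / 2) (fun x => f x - L / 2 * `[< A x >]%:R).
  move=> x; have /andP[h1 h2] := h x.
  have [Ax|Ax] := pselect (A x).
    by rewrite asboolT// mulr1; move: Ax; rewrite /A /= => Ax; apply/andP; split; lra.
  rewrite asboolF// mulr0 subr0; apply/andP; split=> //.
  by rewrite leNgt; apply/negP.
exists ((L / 2, A) :: c) => x; have /andP[h1 h2] := hc x.
rewrite {1 2}/simple_val !big_cons /= -/(simple_val c x).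
have e : L / 2 ^+ k.+1 = L / 2 / 2 ^+ k.
  by rewrite exprS invfM mulrA.
rewrite e; apply/andP; split; lra.
Qed.

Lemma simple_approx f (e : R) : bdd f -> 0 < e ->
  exists c, forall x, simple_val c x - e <= f x <= simple_val c x.
Proof.
move=> [B fB] e0.
have hB x : - B <= f x <= - B + (`|B| + `|B|).
  have := fB x; rewrite ler_norml => /andP[h1 h2].
  by rewrite h1 /=; have := ler_norm B; lra.
pose L := `|B| + `|B|.
pose k := (Num.truncn (L / e)).+1.
have hk : L / 2 ^+ k <= e.
  rewrite ler_pdivrMr ?exprn_gt0// mulrC -ler_pdivrMr//.
  apply: le_trans (ltW (truncnS_gt _)) _; rewrite -/k.
  by rewrite -natrX ler_nat ltnW// ltn_expl.
have [c hc] := simple_approx_dyadic k hB.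
exists c => x; have /andP[h1 h2] := hc x; apply/andP; split=> //.
by apply: le_trans h1; rewrite lerD2l lerN2.
Qed.

Definition charge_int f : R := inf [set simple_int c | c in [set c | forall x, f x <= simple_val c x]].

Lemma charge_int_approx f c (e : R) :
  (forall x, simple_val c x - e <= f x <= simple_val c x) ->
  simple_int c - e <= charge_int f <= simple_int c.
Proof.
move=> h.
have lb : lbound [set simple_int c | c in [set c | forall x, f x <= simple_val c x]] (simple_int c - e).
  move=> _ [d hd <-]; rewrite lerBlDr; apply: simple_int_le => x.
  by have /andP[h1 _] := h x; have := hd x; lra.
have ne : [set simple_int c | c in [set c | forall x, f x <= simple_val c x]] (simple_int c).
  by exists c => // x; have /andP[] := h x.
apply/andP; split.
  by apply: lb_le_inf => //; exists (simple_int c).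
by apply: ge_inf => //; exists (simple_int c - e).
Qed.

Lemma charge_int_mean : mean charge_int.
Proof.
have ID f g : bdd f -> bdd g -> charge_int (fun x => f x + g x) = charge_int f + charge_int g.
  move=> fb gb; apply/eqP; rewrite -subr_eq0 -normr_eq0 eq_le normr_ge0 andbT.
  apply/ler_addgt0Pr => e e0; rewrite add0r.
  have e4 : 0 < e / 4 by lra.
  have [c hc] := simple_approx fb e4; have [d hd] := simple_approx gb e4.
  have /andP[h1 h2] := charge_int_approx hc.
  have /andP[h3 h4] := charge_int_approx hd.
  have /andP[h5 h6] : simple_int (c ++ d) - e / 2 <= charge_int (fun x => f x + g x) <= simple_int (c ++ d).
    apply: charge_int_approx => x; rewrite simple_valD.
    by move: (hc x) (hd x) => /andP[? ?] /andP[? ?]; apply/andP; split; lra.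
  move: h5 h6; rewrite simple_intD => h5 h6.
  by rewrite ler_norml; apply/andP; split; lra.
have IZ a f : 0 <= a -> bdd f -> charge_int (fun x => a * f x) = a * charge_int f.
  move=> a0 fb; apply/eqP; rewrite -subr_eq0 -normr_eq0 eq_le normr_ge0 andbT.
  apply/ler_addgt0Pr => e e0; rewrite add0r.
  have d0 : 0 < e / (a + 1) by apply: divr_gt0 => //; lra.
  have ad : a * (e / (a + 1)) <= e.
    by rewrite mulrA ler_pdivrMr ?ltr_wpDl// mulrC ler_wpM2l ?ltW// ltrDl.
  have [c hc] := simple_approx fb d0.
  have /andP[h1 h2] := charge_int_approx hc.
  have /andP[h3 h4] : simple_int (simple_scale a c) - a * (e / (a + 1)) <= charge_int (fun x => a * f x) <= simple_int (simple_scale a c).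
    apply: charge_int_approx => x; rewrite simple_valZ -mulrBr.
    by move: (hc x) => /andP[? ?]; apply/andP; split; apply: ler_wpM2l.
  rewrite simple_intZ in h3 h4.
  have h5 := ler_wpM2l a0 h1; have h6 := ler_wpM2l a0 h2.
  rewrite mulrBr in h5.
  by rewrite ler_norml; apply/andP; split; lra.
have I0 : charge_int (fun=> 0) = 0.
  by have := IZ 0 (fun=> 0) (lexx _) (@bdd_cst R X 0); under eq_fun do rewrite mul0r; rewrite mul0r.
split; [exact: ID|split].
- move=> c f fb; have [c0|c0] := leP 0 c; first exact: IZ.
  have := ID _ _ (bddZ c fb) (bddZ (- c) fb).
  have -> : (fun x => c * f x + - c * f x) = fun=> 0 by apply/funext => x; ring.
  rewrite I0 (IZ (- c))// ?oppr_ge0 ?(ltW c0)//; lra.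
- move=> f B fb fB; apply/ler_addgt0Pr => e e0.
  have [c hc] := simple_approx fb e0.
  have /andP[_ h1] := charge_int_approx hc; apply: (le_trans h1).
  have := @simple_int_le c [:: (B, setT)] e.
  rewrite /simple_int big_seq1 /= nu1 mulr1; apply => x.
  rewrite [simple_val [:: _] _]/simple_val big_seq1 /= asboolT// mulr1.
  by have /andP[? ?] := hc x; have := fB x; lra.
Qed.

Lemma charge_int_inv (u v : X -> X) f : cancel v u -> cancel u v ->
  (forall A, nu (u @^-1` A) = nu A) -> bdd f ->
  charge_int (fun x => f (u x)) = charge_int f.
Proof.
move=> vu uv nui fb; rewrite /charge_int; congr inf.
have key (w : X -> X) g g' : (forall x, g' x = g (w x)) -> (forall A, nu (w @^-1` A) = nu A) ->
  [set simple_int c | c in [set c | forall x, g x <= simple_val c x]] `<=`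
  [set simple_int c | c in [set c | forall x, g' x <= simple_val c x]].
  move=> gg' nuw _ [c hc <-]; exists [seq (a.1, w @^-1` a.2) | a <- c].
    by move=> x /=; rewrite gg'; apply: le_trans (hc (w x)) _; rewrite /simple_val big_map.
  by rewrite /simple_int big_map; apply: eq_bigr => a _ /=; rewrite nuw.
apply/seteqP; split; last exact: key.
apply: (key v) => [x|A]; first by rewrite vu.
rewrite -[LHS]nui; congr nu; apply/seteqP; split=> x /=; by rewrite uv.
Qed.

End Charge.

Lemma amenable_has_inv_mean (R : realType) (G : group) (N : set G) :
  is_subgroup N -> amenable R N -> has_inv_mean R N.
Proof.
move=> Ns [m [m0 [m1 [mU mi]]]].
pose nu (A : set G) := m (A `&` N).
have nu0 A : 0 <= nu A by apply: m0 => x [].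
have nu1 : nu setT = 1 by rewrite /nu setTI.
have nuU A B : A `&` B = set0 -> nu (A `|` B) = nu A + nu B.
  move=> AB; rewrite /nu setIUl mU//; try by move=> x [].
  by rewrite setIACA AB set0I.
exists (charge_int nu); split; first exact: charge_int_mean.
move=> k f Nk fb; apply: (@charge_int_inv _ _ nu (fun x => k ** x) (fun x => ginv k ** x) f) => //.
- by move=> x; rewrite !grpE.
- by move=> x; rewrite /= !grpE.
- move=> A; rewrite /nu -[LHS](mi k)//.
  congr m; apply/seteqP; split=> x /=.
    by move=> [y [Aky Ny] <-]; split=> //; apply/subgroup_translate.
  move=> [Ax Nx]; exists (ginv k ** x); last by rewrite !grpE.
  split; first by rewrite !grpE.
  by apply/(@subgroup_translate _ N k); rewrite ?grpE.
Qed.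

(** * A non-free boundary *)

Section MeanFacts.
Variables (R : realType) (X : Type).
Implicit Types (m : (X -> R) -> R) (f : X -> R).

Lemma mean_norm_le m f (B : R) : mean m -> (forall x, `|f x| <= B) -> `|m f| <= B.
Proof.
move=> mm fB; have fb : bdd f by exists B.
have h x : - B <= f x /\ f x <= B by move: (fB x); rewrite ler_norml => /andP.
rewrite ler_norml; apply/andP; split.
  by apply: mean_ge => // x; exact: (h x).1.
by apply: mm.2.2 => // x; exact: (h x).2.
Qed.

Lemma mean_sqrB m f (a : R) : mean m -> bdd f ->
  m (fun x => (f x - a) ^+ 2) = m (fun x => f x ^+ 2) - 2 * a * m f + a ^+ 2.
Proof.
move=> mm fb; have f2b : bdd (fun x => f x ^+ 2) by exact: bddM.
have -> : (fun x => (f x - a) ^+ 2) = (fun x => f x ^+ 2 - 2 * a * f x + a ^+ 2).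
  by apply/funext => x; ring.
rewrite mm.1//; last by apply: bddB => //; exact: bddZ.
by rewrite mean_cst// meanB//; [rewrite mm.2.1|exact: bddZ].
Qed.

Lemma mean_jensen m f : mean m -> bdd f -> m f ^+ 2 <= m (fun x => f x ^+ 2).
Proof.
move=> mm fb; have fab : bdd (fun x => f x - m f) by exact: bddB.
have := @mean_ge _ _ m _ 0 mm (bddM fab fab) (fun x => sqr_ge0 _).
rewrite (_ : (fun x => _) = (fun x => (f x - m f) ^+ 2)); last by apply/funext => x; ring.
by rewrite mean_sqrB//; lra.
Qed.

End MeanFacts.

Lemma le_sum_In (R : realType) (T : Type) (s : seq T) (F : T -> R) t :
  (forall i, 0 <= F i) -> List.In t s -> F t <= \sum_(i <- s) F i.
Proof.
move=> F0; elim: s => [//|a s IHs] /= [<-|/IHs h]; rewrite big_cons.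
  by rewrite lerDl sumr_ge0.
by apply: le_trans h _; rewrite lerDr.
Qed.

Section Boundary.
Variables (R : realType) (G : group).
Implicit Types (f : G -> R) (q mu : (G -> R) -> R) (E : seq {f : G -> R | bdd f}).

Definition act_mean (g : G) q f := q (fun x => f (g ** x)).

Definition stab q : set G := [set k | forall f, bdd f -> act_mean k q f = q f].

Lemma stab_subgroup q : is_subgroup (stab q).
Proof.
split; [|split].
- by move=> f _; rewrite /act_mean; under eq_fun do rewrite gmul1.
- move=> x y qx qy f fb.
  rewrite -[RHS](qx f fb) -[RHS](qy (fun z => f (x ** z)) (bdd_comp _ fb)).
  by rewrite /act_mean; congr q; apply/funext => z; rewrite gmulA.
- move=> x qx f fb; rewrite -[LHS](qx _ (bdd_comp _ fb)).
  by rewrite /act_mean; congr q; apply/funext => z; rewrite !grpE.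
Qed.

Lemma act_mean_mean g q : mean q -> mean (act_mean g q).
Proof.
move=> qm; split; [|split].
- by move=> f1 f2 b1 b2; rewrite /act_mean qm.1//; exact: bdd_comp.
- by move=> c f fb; rewrite /act_mean qm.2.1//; exact: bdd_comp.
- by move=> f B fb fB; apply: qm.2.2 => //; exact: bdd_comp.
Qed.

Lemma bdd_act_mean q f : mean q -> bdd f -> bdd (fun x => act_mean x q f).
Proof. by move=> qm [B fB]; exists B => x; exact: (mean_norm_le qm). Qed.

Lemma stab_conj q x k f : stab q (ginv x ** k ** x) -> bdd f ->
  act_mean x q (fun z => f (k ** z)) = act_mean x q f.
Proof.
move=> qk fb; rewrite /act_mean -[RHS]qk; last exact: (bdd_comp (fun z => x ** z) fb).
by congr q; apply/funext => z; rewrite !grpE.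
Qed.

(* [h] is the support function of a minimal invariant compact convex set of
   means, whose elements are those satisfying [below]. *)
Variable h : (G -> R) -> R.
Hypothesis h_sublin : sublin h.
Hypothesis h_inv : fun_inv [set u | exists g : G, u = gmul g] h.
Hypothesis h_min : forall p, sublin p -> fun_inv [set u | exists g : G, u = gmul g] p ->
  le_bdd p h -> le_bdd h p.

Definition below q := mean q /\ le_bdd q h.

Lemma below_act g q : below q -> below (act_mean g q).
Proof.
move=> [qm qh]; split; first exact: act_mean_mean.
move=> f fb; rewrite -(h_inv (u := gmul g) _ fb); last by exists g.
by apply: qh; exact: bdd_comp.
Qed.

(** The barycentre of the measure that [mu] induces on the orbit of [q]. *)
Lemma below_average q mu : below q -> mean mu ->
  below (fun f => mu (fun x => act_mean x q f)).
Proof.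
move=> qb mum; have [qm qh] := qb.
split; first split; [|split|].
- move=> f g fb gb; rewrite -mum.1; try exact: bdd_act_mean.
  by congr mu; apply/funext => x; rewrite (act_mean_mean x qm).1.
- move=> c f fb; rewrite -mum.2.1; last exact: bdd_act_mean.
  by congr mu; apply/funext => x; rewrite (act_mean_mean x qm).2.1.
- move=> f B fb fB; apply: mum.2.2; first exact: bdd_act_mean.
  by move=> x; exact: (act_mean_mean x qm).2.2.
- move=> f fb; apply: mum.2.2; first exact: bdd_act_mean.
  by move=> x; exact: (below_act x qb).2.
Qed.

(** The supremum over the orbit of [q] is itself sublinear, invariant and below [h], so it equals
    [h] by minimality: every orbit has the whole set as its closed convex hull. *)
Lemma orbit_sup q f (d : R) : below q -> bdd f -> 0 < d ->
  exists g, h f - d < act_mean g q f.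
Proof.
move=> qb fb d0; have [qm qh] := qb.
pose S f := [set act_mean g q f | g in [set: G]].
have hS f' : bdd f' -> has_sup (S f').
  move=> f'b; split; first by exists (act_mean (gone G) q f'), (gone G).
  by exists (h f') => _ [g _ <-]; exact: (below_act g qb).2.
have leS f' g : bdd f' -> act_mean g q f' <= sup (S f').
  by move=> f'b; apply: ub_le_sup; [exact: (hS _ f'b).2|exists g].
have geS f' B : bdd f' -> (forall g, act_mean g q f' <= B) -> sup (S f') <= B.
  by move=> f'b H; apply: ge_sup; [exact: (hS _ f'b).1|move=> _ [g _ <-]].
have sS : sublin (fun f => sup (S f)).
  split; [|split].
  - move=> f1 f2 b1 b2; apply: (geS _ _ (bddD b1 b2)) => g.
    by rewrite (act_mean_mean g qm).1//; apply: lerD; exact: leS.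
  - move=> c f1 c0 b1; apply/eqP; rewrite eq_le; apply/andP; split.
      apply: geS; first exact: bddZ.
      by move=> g; rewrite (act_mean_mean g qm).2.1//; apply: ler_wpM2l => //; exact: leS.
    move: c0; rewrite [0 <= c]le_eqVlt => /orP[/eqP <-|c0].
      rewrite mul0r; apply: le_trans (leS _ (gone G) (bddZ 0 b1)).
      by rewrite (act_mean_mean _ qm).2.1// mul0r.
    rewrite mulrC -ler_pdivlMr//; apply: (geS _ _ b1) => g; rewrite ler_pdivlMr// mulrC.
    by rewrite -(act_mean_mean _ qm).2.1//; apply: leS; exact: bddZ.
  - by move=> f1 B b1 f1B; apply: geS => // g; exact: (act_mean_mean g qm).2.2.
have iS : fun_inv [set u | exists g : G, u = gmul g] (fun f => sup (S f)).
  move=> _ f1 [k ->] b1; congr sup; apply/seteqP; split=> _ [g _ <-].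
    exists (k ** g) => //; rewrite /act_mean.
    by congr q; apply/funext => z; rewrite !grpE.
  exists (ginv k ** g) => //; rewrite /act_mean.
  by congr q; apply/funext => z; rewrite !grpE.
have := h_min sS iS (fun f1 b1 => geS f1 _ b1 (fun g => (below_act g qb).2 f1 b1)) fb.
move=> hle; have [_ [g _ <-] lt] := sup_adherent d0 (hS f fb).
by exists g; apply: le_lt_trans lt; rewrite lerD2r.
Qed.

Definition energy E q : R := \sum_(f <- E) q (sval f) ^+ 2.

(** Linearize the energy at [y]: the function [v] satisfies [y v = energy E y], and a point [z] of
    the orbit with [z v] almost [h v] has [energy E z >= 2 z v - energy E y]. *)
Lemma energy_orbit E q y (d : R) : below q -> below y -> 0 < d ->
  exists g, energy E y - d < energy E (act_mean g q).
Proof.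
move=> qb [ym yh] d0.
pose v := fun x => \sum_(f <- E) y (sval f) * sval f x.
have vb : bdd v by apply: bdd_sum => f; exact/bddZ/(svalP f).
have val p : mean p -> p v = \sum_(f <- E) y (sval f) * p (sval f).
  move=> pm; rewrite /v mean_sum//; last by move=> f; exact/bddZ/(svalP f).
  by apply: eq_bigr => f _; rewrite pm.2.1//; exact: svalP f.
have d2 : 0 < d / 2 by lra.
have [g hg] := orbit_sup qb vb d2; exists g.
have h1 : energy E y <= h v.
  by apply: le_trans (yh v vb); rewrite val//; apply: eq_ler; apply: eq_bigr => f _; ring.
rewrite (val (act_mean g q)) in hg; last exact: act_mean_mean qb.1.
have h2 : 2 * \sum_(f <- E) y (sval f) * act_mean g q (sval f) <=
    energy E y + energy E (act_mean g q).
  rewrite mulr_sumr -big_split; apply: ler_sum => f _ /=.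
  by rewrite -subr_ge0 (_ : _ - _ = (y (sval f) - act_mean g q (sval f)) ^+ 2) ?sqr_ge0//; ring.
lra.
Qed.

Lemma energy_max E (d : R) : (exists q, below q) -> 0 < d ->
  exists y, below y /\ forall z, below z -> energy E z <= energy E y + d.
Proof.
move=> [q0 q0b] d0; pose S := [set energy E q | q in below].
have hS : has_sup S.
  split; first by exists (energy E q0), q0.
  have [B hB] : exists B : R, forall q, mean q -> energy E q <= B.
    clear S; rewrite /energy; elim: E => [|[f [A fA]] E [B IH]].
      by exists 0 => q _; rewrite big_nil.
    exists (A ^+ 2 + B) => q qm; rewrite big_cons /=; apply: lerD; last exact: IH.
    rewrite -real_normK ?num_real//.
    by apply: lerXn2r; rewrite ?nnegrE//; [exact: le_trans (fA (gone G))|exact: mean_norm_le].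
  by exists B => _ [q [qm _] <-]; exact: hB.
have [_ [y yb <-] lt] := sup_adherent d0 hS.
exists y; split=> // z zb.
have : energy E z <= sup S by apply: ub_le_sup; [exact: hS.2|exists z].
lra.
Qed.

(* Moving [mu] so that its barycentre almost maximizes the energy makes it
   almost concentrated at the barycentre. *)
Lemma small_variance E q mu (d : R) : below q -> mean mu -> 0 < d ->
  exists g, forall f : {f : G -> R | bdd f}, List.In f E ->
    mu (fun x => act_mean (g ** x) q (sval f) ^+ 2) <=
    mu (fun x => act_mean (g ** x) q (sval f)) ^+ 2 + d.
Proof.
move=> qb mum d0; have [qm _] := qb.
have d3 : 0 < d / 3 by lra.
have [y [yb ymax]] := energy_max E (ex_intro _ q qb) d3.
have [g hg] := energy_orbit E (below_average qb mum) yb d3.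
exists g.
have eg f : act_mean g (fun f => mu (fun x => act_mean x q f)) f = mu (fun x => act_mean (g ** x) q f).
  rewrite {1}/act_mean; congr mu; apply/funext => x; rewrite /act_mean.
  by congr q; apply/funext => z; rewrite !grpE.
have eb f : bdd f -> bdd (fun x => act_mean (g ** x) q f).
  by move=> fb; exact: bdd_comp (bdd_act_mean qm fb).
pose V (f : {f : G -> R | bdd f}) := mu (fun x => act_mean (g ** x) q (sval f) ^+ 2) -
  mu (fun x => act_mean (g ** x) q (sval f)) ^+ 2.
have V0 (f : {f : G -> R | bdd f}) : 0 <= V f by rewrite subr_ge0; apply: mean_jensen => //; exact/eb/(svalP f).
(* Each variance is non-negative, so it suffices to bound their sum: the mean energy is at most
   [energy E y + d / 3] and that of the barycentre exceeds [energy E y - d / 3]. *)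
move=> f fE; rewrite -lerBlDl; apply: le_trans (le_sum_In V0 fE) _.
rewrite /V sumrB -mean_sum//; last by move=> f'; apply: bddM; exact/eb/(svalP f').
have h1 : mu (fun x => \sum_(i <- E) act_mean (g ** x) q (sval i) ^+ 2) <= energy E y + d / 3.
  apply: mum.2.2 => [|x]; first by apply: bdd_sum => f'; apply: bddM; exact/eb/(svalP f').
  by apply: ymax; exact: below_act.
move: hg; rewrite {2}/energy (eq_bigr _ (fun i _ => congr1 (fun z => z ^+ 2) (eg (sval i)))).
lra.
Qed.

(* The identity on squares says that the point [x . q], for [x] chosen according
   to [mu'], is almost surely equal to its barycentre. *)
Lemma dirac_limit q mu : below q -> mean mu -> exists mu', [/\ mean mu',
  forall f, bdd f -> mu' (fun x => act_mean x q f ^+ 2) = mu' (fun x => act_mean x q f) ^+ 2 &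
  forall (B : R) (phi : G -> R), bdd phi -> (forall g, mu (fun x => phi (g ** x)) <= B) -> mu' phi <= B].
Proof.
move=> qb mum; have [qm _] := qb.
pose I := seq {f : G -> R | bdd f}.
(* Inclusion makes every test function appear eventually; the size drives the tolerance
   [1 / (size E + 1)] to zero. *)
pose le (E F : I) := (forall f : {f : G -> R | bdd f}, List.In f E -> List.In f F) /\ (size E <= size F)%N.
have [|||U [UU Ule]] := @directed_ultra I le [::].
- by [].
- by move=> E F J [h1 s1] [h2 s2]; split; [move=> f /h1/h2|exact: leq_trans s2].
- move=> E F; exists (E ++ F); split; split; try by move=> f fE; apply/List.in_app_iff; auto.
    by rewrite size_cat leq_addr.
  by rewrite size_cat leq_addl.
have d0 (E : I) : 0 < (size E).+1%:R^-1 :> R by rewrite invr_gt0.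
have /choice[g gP] := fun E : I => small_variance E qb mum (d0 E).
have mb (phi : G -> R) : bdd phi -> bdd (fun E => mu (fun x => phi (g E ** x))).
  by move=> [B pB]; exists B => E; exact: mean_norm_le.
pose mu' phi := ulim U (fun E => mu (fun x => phi (g E ** x))).
have mum' : mean mu'.
  split; [|split].
  - move=> f1 f2 b1 b2; rewrite /mu' -ulimD; try exact: mb.
    by congr ulim; apply/funext => E; rewrite mum.1//; exact: bdd_comp.
  - move=> c f b; rewrite /mu' -ulimZ; last exact: mb.
    by congr ulim; apply/funext => E; rewrite mum.2.1//; exact: bdd_comp.
  - move=> f B fb fB; apply: ulim_le; first exact: mb.
    by apply: filterS (@filterT _ U _) => E _; apply: mum.2.2 => //; exact: bdd_comp.
exists mu'; split=> //.
- move=> f fb; have ab := bdd_act_mean qm fb.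
  have a2b : bdd (fun x => act_mean x q f ^+ 2) by exact: bddM.
  apply/eqP; rewrite eq_le mean_jensen// andbT; apply/ler_addgt0Pr => e e0.
  have b1 := mb _ ab; have b2 := mb _ a2b.
  have b3 := bddZ (-1) (bddM b1 b1).
  rewrite {2}/mu' expr2 -(ulimM UU b1 b1) addrC -lerBlDr -mulN1r -(ulimZ UU _ (bddM b1 b1)).
  rewrite /mu' -(ulimD UU b2 b3); apply: ulim_le; first exact: bddD b2 b3.
  pose fs : {f : G -> R | bdd f} := exist _ f fb.
  (* Repeating [fs] makes the list long enough for the tolerance to drop below [e]. *)
  apply: filterS (Ule (nseq (Num.truncn e^-1) fs ++ [:: fs])) => E [fE sE].
  have fsE : List.In fs E by apply: fE; apply/List.in_app_iff; right; left.
  have hE := gP E fs fsE.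
  rewrite [sval fs]/= in hE.
  have hs : (size E).+1%:R^-1 <= e.
    rewrite -[leRHS]invrK lef_pV2 ?posrE ?invr_gt0//.
    apply: le_trans (ltW (truncnS_gt _)) _.
    by rewrite ler_nat ltnS; apply: leq_trans sE; rewrite size_cat size_nseq leq_addr.
  by rewrite /= mulN1r -expr2 lerBlDl; apply: le_trans hE _; rewrite lerD2l.
- move=> B phi pb pB; apply: ulim_le; first exact: mb.
  by apply: filterS (@filterT _ U _) => E _; exact: pB.
Qed.

(** Average any point of the set along its orbit by the invariant mean of [K]. *)
Lemma fixed_below K : has_inv_mean R K -> exists q, below q /\ K `<=` stab q.
Proof.
move=> [m [mm mK]]; have [q0 [q0m q0h]] := hahn_banach_mean h_sublin.
exists (fun f => m (fun x => act_mean x q0 f)); split; first exact: below_average.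
move=> k Kk f fb; rewrite -[RHS](mK k)//; last exact: bdd_act_mean.
rewrite {1}/act_mean; congr m; apply/funext => x; rewrite /act_mean.
by congr q0; apply/funext => z; rewrite !grpE.
Qed.

Definition orbit_fixed_by (F : seq G) q :=
  forall g, exists s, List.In s F /\ stab q (ginv g ** s ** g).

(** Without such weights, [minimax] yields a mean under which each non-trivial [t] fixes [x . q]
    with mass at most 3/4. Concentration at a barycentre [y], with a translate of [y] moved by all
    of [F], then forces a conjugate of [s0] to fix [x . q] with mass 1. *)
Lemma stab_weights q (s0 : G) (F : seq G) : below q ->
  orbit_fixed_by (s0 :: F) q -> s0 <> gone G ->
  (forall y, below y -> ~ orbit_fixed_by F y) ->
  exists c : seq (R * G), List.Forall (fun w => 0 <= w.1 /\ w.2 <> gone G) c /\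
    forall g, \sum_(w <- c) w.1 * (3 / 4 - `[< stab q (ginv g ** w.2 ** g) >]%:R) < 0.
Proof.
move=> qb qF s01 Fmin; have [qm _] := qb.
pose T := {t : G | t <> gone G}.
pose u (t : T) (g : G) : R := 3 / 4 - `[< stab q (ginv g ** sval t ** g) >]%:R.
have ub t : bdd (u t) by apply: bddB.
apply: contrapT => nc.
have [|mu [mum mu0]] := @minimax R G T u (inhabits (gone G)) ub.
  move=> c Pc; apply: contrapT => nx; apply: nc.
  exists [seq (w.1, sval w.2) | w <- c]; split.
    apply/List.Forall_map; apply: List.Forall_impl Pc => w w0; split=> //=.
    exact: svalP w.2.
  move=> g; rewrite big_map ltNge; apply/negP => g0; apply: nx.
  by exists g.
have [mu' [mum' mudirac mule]] := dirac_limit qb mum.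
(* The bound for [mu] holds at all conjugates of [t], that is for all translates of [mu]; this
   uniformity is what lets it pass to [mu']. *)
have mu'le t : t <> gone G -> mu' (fun x => `[< stab q (ginv x ** t ** x) >]%:R) <= 3 / 4.
  move=> t1; apply: mule => // g.
  have tg : ginv g ** t ** g <> gone G.
    move=> e; apply: t1; have : g ** (ginv g ** t ** g) ** ginv g = gone G by rewrite e !grpE.
    by rewrite !grpE.
  have := mu0 (exist _ (ginv g ** t ** g) tg); rewrite /u /= meanB// mean_cst// subr_ge0.
  congr (_ <= _); congr mu; apply/funext => x; congr ((asbool (stab q _))%:R).
  by rewrite !grpE.
pose y f := mu' (fun x => act_mean x q f).
have yb : below y by exact: below_average.
(* No [s] in [F] fixes [g0 . y], so no [k s] fixes [y]; [f s] is a function detecting this. *)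
have /existsNP[g0 g0F] := Fmin y yb.
pose k s := ginv g0 ** s ** g0.
have /choice[f fP] : forall s, exists f, bdd f /\ (List.In s F -> y (fun x => f (k s ** x)) - y f != 0).
  move=> s; have [sF|sF] := pselect (List.In s F); last by exists (fun=> 0).
  apply: contrapT => /forallNP nf; apply: g0F; exists s; split=> // f fb.
  apply/eqP; rewrite -subr_eq0; apply: contrapT => /negP e0; apply: (nf f); split=> //.
pose phi s := fun x => f s (k s ** x) - f s x.
have phib s : bdd (phi s) by apply: bddB; [exact: bdd_comp (fP s).1|exact: (fP s).1].
have phi0 s x : stab q (ginv x ** k s ** x) -> act_mean x q (phi s) = 0.
  move=> sx; rewrite /phi.
  rewrite (meanB (act_mean_mean x qm)); [|exact: bdd_comp (fP s).1|exact: (fP s).1].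
  by rewrite stab_conj ?subrr//; exact: (fP s).1.
have yphi s : List.In s F -> y (phi s) != 0.
  move=> sF; have := (fP s).2 sF; rewrite /phi (meanB yb.1)//; first exact: bdd_comp (fP s).1.
  exact: (fP s).1.
(* The squared deviation has [mu']-mean zero by concentration. Its normalization makes it 1 wherever
   [k s] fixes [x . q], since there [phi s] is killed. *)
pose D s x := (y (phi s))^-1 ^+ 2 * (act_mean x q (phi s) - y (phi s)) ^+ 2.
have Db s : bdd (D s).
  by apply: bddZ; apply: bddM; apply: bddB => //; exact: bdd_act_mean.
have D0 s x : 0 <= D s x by rewrite mulr_ge0 ?sqr_ge0.
have muD s : mu' (D s) = 0.
  rewrite /D mum'.2.1; last by apply: bddM; apply: bddB => //; exact: bdd_act_mean.
  rewrite mean_sqrB//; last exact: bdd_act_mean.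
  by rewrite mudirac// -/(y (phi s)); ring.
have k1 : k s0 <> gone G.
  move=> e; apply: s01; have : g0 ** (k s0) ** ginv g0 = gone G by rewrite e !grpE.
  by rewrite /k !grpE.
have := mu'le _ k1; apply/negP; rewrite -ltNge.
suff : 1 <= mu' (fun x => `[< stab q (ginv x ** k s0 ** x) >]%:R) by lra.
rewrite -[leRHS]addr0 -[X in _ + X](_ : \sum_(s <- F) mu' (D s) = 0); last first.
  by apply: big1 => s _; exact: muD.
rewrite -mean_sum// -mum'.1//; last exact: bdd_sum.
apply: mean_ge => // [|x]; first by apply: bddD => //; exact: bdd_sum.
(* At each [x] the element supplied is either [s0], counted by the indicator, or some [s] in [F],
   for which [D s x = 1]. *)
have [s [sF sx]] := qF (g0 ** x).
have {}sx : stab q (ginv x ** k s ** x) by move: sx; rewrite /k !grpE.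
case: sF => [<-|sF] in sx *.
  by rewrite asboolT// lerDl sumr_ge0.
rewrite -[leLHS]add0r; apply: lerD => //.
apply: le_trans (le_sum_In (D0 ^~ x) sF).
rewrite /D phi0// sub0r sqrrN -exprMn mulVf ?expr1n//.
exact: yphi.
Qed.

End Boundary.

Lemma amenable_stabilizer_weights (R : realType) (G : group) (K : set G) (F : seq G) :
  has_inv_mean R K -> List.Forall (fun s => s <> gone G) F ->
  (forall g, exists s, List.In s F /\ K (ginv g ** s ** g)) ->
  exists K' (c : seq (R * G)), [/\ is_subgroup K', has_inv_mean R K',
    List.Forall (fun w => 0 <= w.1 /\ w.2 <> gone G) c &
    forall g, \sum_(w <- c) w.1 * (3 / 4 - `[< K' (ginv g ** w.2 ** g) >]%:R) < 0].
Proof.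
move=> Km F1 KF.
have [|h [h_sublin h_inv _ h_min]] :=
    @minimal_sublin R G [set u | exists g : G, u = gmul g] _ (sup_sublin R (inhabits (gone G))).
  move=> _ f [g ->] fb; congr sup; apply/seteqP; split=> _ [x _ <-]; first by exists (g ** x).
  by exists (ginv g ** x) => //; rewrite !grpE.
have [q [qb Kq]] := fixed_below h_sublin h_inv Km.
(* The length of [F] is minimized over all points of the set at once, so that no other point admits
   the tail of the list. *)
pose P n := `[< exists F' y, [/\ size F' = n, List.Forall (fun s => s <> gone G) F',
  below h y & orbit_fixed_by F' y] >].
have exP : exists n, P n.
  exists (size F); apply/asboolP; exists F, q; split=> // g.
  by have [s [sF Ks]] := KF g; exists s; split=> //; exact: Kq.
case: (ex_minnP exP) => n /asboolP[F' [y [sF' F'1 yb yF']]] nmin.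
case: F' => [|s0 F''] in sF' F'1 yF'.
  by have [s []] := yF' (gone G).
have /List.Forall_cons_iff[s01 F''1] := F'1.
have [c [c1 c2]] : exists c : seq (R * G), List.Forall (fun w => 0 <= w.1 /\ w.2 <> gone G) c /\
    forall g, \sum_(w <- c) w.1 * (3 / 4 - `[< stab y (ginv g ** w.2 ** g) >]%:R) < 0.
  apply: (stab_weights h_inv h_min yb yF' s01) => z zb zF.
  have : P (size F'') by apply/asboolP; exists F'', z.
  by move=> /nmin; rewrite -sF' ltnn.
exists (stab y), c; split=> //; first exact: stab_subgroup.
by exists y; split; [exact: yb.1|move=> k f yk fb; exact: yk].
Qed.

(** * The group algebra and positive forms *)

Section ComplexParts.
Variable R : realType.
Implicit Types z w : R[i].

Lemma reD z w : complex.Re (z + w) = complex.Re z + complex.Re w.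
Proof. by case: z w => [a b] [c d]. Qed.

Lemma reZ (r : R) z : complex.Re ((r%:C)%C * z) = r * complex.Re z.
Proof. by case: z => a b; rewrite /= mul0r subr0. Qed.

Lemma re_conj z : complex.Re (conjc z) = complex.Re z.
Proof. by case: z. Qed.

Lemma re_sum (I : Type) (s : seq I) (F : I -> R[i]) :
  complex.Re (\sum_(i <- s) F i) = \sum_(i <- s) complex.Re (F i).
Proof. by elim: s => [|i s IHs]; rewrite ?big_nil// !big_cons reD IHs. Qed.

Lemma conjcM z w : conjc (z * w) = conjc z * conjc w.
Proof. exact: rmorphM. Qed.

Lemma conjcD z w : conjc (z + w) = conjc z + conjc w.
Proof. exact: rmorphD. Qed.

Lemma conjc_sum (I : Type) (s : seq I) (F : I -> R[i]) :
  conjc (\sum_(i <- s) F i) = \sum_(i <- s) conjc (F i).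
Proof. by elim: s => [|i s IHs]; rewrite ?big_nil ?conjc0// !big_cons conjcD IHs. Qed.

Lemma mul_conjc z : z * conjc z = ((csq z)%:C)%C.
Proof. by case: z => a b; rewrite /csq /=; simpc; congr (Complex _ _); ring. Qed.

Lemma csq_ge0 z : 0 <= csq z.
Proof. by case: z => a b; rewrite /csq addr_ge0 ?sqr_ge0. Qed.

Lemma csqM z w : csq (z * w) = csq z * csq w.
Proof. by case: z w => [a b] [c d]; rewrite /csq /=; ring. Qed.

Lemma csqN z : csq (- z) = csq z.
Proof. by case: z => [a b]; rewrite /csq /= !sqrrN. Qed.

Lemma csq0 : csq (0 : R[i]) = 0.
Proof. by rewrite /csq /= expr0n addr0. Qed.

Lemma csq1 : csq (1 : R[i]) = 1.
Proof. by rewrite /csq /= expr0n addr0 expr1n. Qed.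

Lemma csq_real (r : R) : csq ((r%:C)%C) = r ^+ 2.
Proof. by rewrite /csq /= expr0n addr0. Qed.

End ComplexParts.

(* Elements of the group algebra are encoded as the functionals
   [F |-> \sum_g a_g F(g)], so that equality is Leibniz equality and convolution
   is a composition. *)
Section GroupAlgebra.
Variables (R : realType) (G : group).
Local Notation C := R[i].

Definition ev (s : seq (C * G)) (F : G -> C) : C := \sum_(p <- s) p.1 * F p.2.

Record galg := GAlg { galg_val :> (G -> C) -> C; galgP : exists s, galg_val = ev s }.

Lemma galg_eq (a b : galg) : (forall F, a F = b F) -> a = b.
Proof.
case: a b => [a aP] [b bP] /= /funext ab; case: b / ab in bP *.
by congr GAlg; exact: Prop_irrelevance.
Qed.

HB.instance Definition _ := gen_eqMixin galg.
HB.instance Definition _ := gen_choiceMixin galg.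

Definition galg_of s : galg := GAlg (ex_intro _ s erefl).

Lemma galg_ofP (a : galg) : exists s, a = galg_of s.
Proof. by have [s e] := galgP a; exists s; apply: galg_eq => F; rewrite e. Qed.

Lemma galgD (a : galg) F H : a (fun x => F x + H x) = a F + a H.
Proof.
have [s ->] := galgP a; rewrite /ev -big_split.
by apply: eq_bigr => p _; rewrite mulrDr.
Qed.

Lemma galgZ (a : galg) c F : a (fun x => c * F x) = c * a F.
Proof.
have [s ->] := galgP a; rewrite /ev mulr_sumr.
by apply: eq_bigr => p _; rewrite mulrCA.
Qed.

Lemma galg_sum (a : galg) (I : Type) (s : seq I) (F : I -> G -> C) :
  a (fun x => \sum_(i <- s) F i x) = \sum_(i <- s) a (F i).
Proof.
elim: s => [|i s IHs].
  have -> : (fun x : G => \sum_(i <- [::]) F i x) = (fun x => 0 * 0).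
    by apply/funext => x; rewrite big_nil mul0r.
  by rewrite galgZ mul0r big_nil.
rewrite big_cons -IHs -galgD; congr (galg_val a _).
by apply/funext => x; rewrite big_cons.
Qed.

Lemma galg_zero_subproof : exists s, (fun=> 0) = ev s.
Proof. by exists [::]; apply/funext => F; rewrite /ev big_nil. Qed.
Definition galg_zero := GAlg galg_zero_subproof.

Lemma galg_add_subproof (a b : galg) : exists s, (fun F => a F + b F) = ev s.
Proof.
have [s es] := galgP a; have [t et] := galgP b.
by exists (s ++ t); apply/funext => F; rewrite es et /ev big_cat.
Qed.
Definition galg_add a b := GAlg (galg_add_subproof a b).

Lemma galg_scale_subproof (c : C) (a : galg) : exists s, (fun F => c * a F) = ev s.
Proof.
have [s es] := galgP a; exists [seq (c * p.1, p.2) | p <- s].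
by apply/funext => F; rewrite es /ev big_map mulr_sumr; apply: eq_bigr => p _; rewrite mulrA.
Qed.
Definition galg_scale c a := GAlg (galg_scale_subproof c a).

Definition galg_opp a := galg_scale (-1) a.

Definition dl (g : G) : galg := galg_of [:: (1, g)].

Lemma dlE g F : dl g F = F g.
Proof. by rewrite /= /ev big_seq1 mul1r. Qed.

Lemma galg_mul_subproof (a b : galg) :
  exists s, (fun F => a (fun x => b (fun y => F (x ** y)))) = ev s.
Proof.
have [s es] := galgP a; have [t et] := galgP b.
exists [seq (p.1 * q.1, p.2 ** q.2) | p <- s, q <- t].
apply/funext => F; rewrite es et /ev big_allpairs_dep; apply: eq_bigr => p _.
by rewrite mulr_sumr; apply: eq_bigr => q _; rewrite mulrA.
Qed.
Definition galg_mul a b := GAlg (galg_mul_subproof a b).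

Lemma galg_addA : associative galg_add.
Proof. by move=> a b c; apply: galg_eq => F /=; rewrite addrA. Qed.
Lemma galg_addC : commutative galg_add.
Proof. by move=> a b; apply: galg_eq => F /=; rewrite addrC. Qed.
Lemma galg_add0 : left_id galg_zero galg_add.
Proof. by move=> a; apply: galg_eq => F /=; rewrite add0r. Qed.
Lemma galg_addN : left_inverse galg_zero galg_opp galg_add.
Proof. by move=> a; apply: galg_eq => F /=; rewrite mulN1r addNr. Qed.
HB.instance Definition _ := GRing.isZmodule.Build galg galg_addA galg_addC galg_add0 galg_addN.

Lemma galg_mulA : associative galg_mul.
Proof.
move=> a b c; apply: galg_eq => F /=; congr (galg_val a _); apply/funext => x.
congr (galg_val b _); apply/funext => y; congr (galg_val c _); apply/funext => z.
by rewrite gmulA.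
Qed.
Lemma galg_mul1 : left_id (dl (gone G)) galg_mul.
Proof.
move=> a; apply: galg_eq => F; rewrite [LHS]dlE; congr (galg_val a _).
by apply/funext => x; rewrite gmul1.
Qed.
Lemma galg_1mul : right_id (dl (gone G)) galg_mul.
Proof.
move=> a; apply: galg_eq => F; congr (galg_val a _); apply/funext => x.
by rewrite [LHS]dlE gmul1r.
Qed.
Lemma galg_mulDl : left_distributive galg_mul +%R.
Proof. by move=> a b c; apply: galg_eq. Qed.
Lemma galg_mulDr : right_distributive galg_mul +%R.
Proof. by move=> a b c; apply: galg_eq => F /=; rewrite -galgD. Qed.
Lemma galg_1neq0 : dl (gone G) != 0.
Proof.
apply/eqP => /(congr1 (fun a : galg => a (fun=> 1))); rewrite dlE /=.
by apply/eqP; exact: oner_neq0.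
Qed.
HB.instance Definition _ := GRing.Zmodule_isNzRing.Build galg
  galg_mulA galg_mul1 galg_1mul galg_mulDl galg_mulDr galg_1neq0.

Lemma galg_scaleA (c d : C) (a : galg) : galg_scale c (galg_scale d a) = galg_scale (c * d) a.
Proof. by apply: galg_eq => F /=; rewrite mulrA. Qed.
Lemma galg_scale1 : left_id 1 galg_scale.
Proof. by move=> a; apply: galg_eq => F /=; rewrite mul1r. Qed.
Lemma galg_scaleDr : right_distributive galg_scale +%R.
Proof. by move=> c a b; apply: galg_eq => F /=; rewrite mulrDr. Qed.
Lemma galg_scaleDl (a : galg) : {morph galg_scale^~ a : c d / c + d}.
Proof. by move=> c d; apply: galg_eq => F /=; rewrite mulrDl. Qed.
HB.instance Definition _ := GRing.Zmodule_isLmodule.Build C galg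
  galg_scaleA galg_scale1 galg_scaleDr galg_scaleDl.

Lemma galg_scaleAl (c : C) (a b : galg) : c *: (a * b) = (c *: a) * b.
Proof. exact: galg_eq. Qed.
HB.instance Definition _ := GRing.Lmodule_isLalgebra.Build C galg galg_scaleAl.

Lemma galg_scaleAr (c : C) (a b : galg) : c *: (a * b) = a * (c *: b).
Proof. by apply: galg_eq => F /=; rewrite -galgZ. Qed.
HB.instance Definition _ := GRing.Lalgebra_isAlgebra.Build C galg galg_scaleAr.

Lemma galg_addE (a b : galg) F : (a + b) F = a F + b F. Proof. by []. Qed.
Lemma galg_scaleE c (a : galg) F : (c *: a) F = c * a F. Proof. by []. Qed.
Lemma galg_mulE (a b : galg) F : (a * b) F = a (fun x => b (fun y => F (x ** y))).
Proof. by []. Qed.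
Lemma galg_oppE (a : galg) F : (- a) F = - a F.
Proof. exact: mulN1r. Qed.
Lemma galg_oneE F : (1 : galg) F = F (gone G). Proof. exact: dlE. Qed.
Lemma dl_mul g h : dl g * dl h = dl (g ** h).
Proof. by apply: galg_eq => F; rewrite galg_mulE !dlE. Qed.
Lemma galg_sumE (I : Type) (s : seq I) (a : I -> galg) F :
  (\sum_(i <- s) a i) F = \sum_(i <- s) a i F.
Proof. by elim: s => [|i s IHs]; rewrite ?big_nil// !big_cons galg_addE IHs. Qed.
Lemma galg_of_sum s : galg_of s = \sum_(p <- s) p.1 *: dl p.2.
Proof.
apply: galg_eq => F; rewrite galg_sumE; apply: eq_bigr => p _.
by rewrite galg_scaleE dlE.
Qed.

End GroupAlgebra.

(** * Positive forms on the group algebra and operator bounds *)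

Section Form.
Variables (R : realType) (G : group).
Local Notation C := R[i].
Local Notation A := (galg R G).
Implicit Types (phi psi : G -> R) (a b c xi eta : A).

(** The form of the Gelfand-Naimark-Segal construction for [phi], before completion. The function
    [delta1] gives the regular representation, the indicator of [K] the one on [l^2(G/K)]. *)
Definition hip phi a b : C :=
  a (fun x => conjc (b (fun y => ((phi (ginv y ** x))%:C)%C))).

Definition ip phi a b : R := complex.Re (hip phi a b).

(** In the representation attached to [phi], the operator of [a] has norm at most [M]. *)
Definition bd phi a (M : R) := 0 <= M /\
  forall xi, ip phi (a * xi) (a * xi) <= M ^+ 2 * ip phi xi xi.

Lemma hip_of phi s t : hip phi (galg_of s) (galg_of t) =
  \sum_(p <- s) \sum_(q <- t) p.1 * conjc q.1 * ((phi (ginv q.2 ** p.2))%:C)%C.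
Proof.
apply: eq_bigr => p _; rewrite /ev conjc_sum mulr_sumr.
by apply: eq_bigr => q _; rewrite conjcM conjc_real mulrA.
Qed.

Lemma hipDl phi a b c : hip phi (a + b) c = hip phi a c + hip phi b c.
Proof. by []. Qed.

Lemma hipZl phi z a b : hip phi (z *: a) b = z * hip phi a b.
Proof. by []. Qed.

Lemma hipDr phi a b c : hip phi a (b + c) = hip phi a b + hip phi a c.
Proof. by rewrite /hip -galgD; congr (galg_val a _); apply/funext => x; rewrite galg_addE conjcD. Qed.

Lemma hipZr phi z a b : hip phi a (z *: b) = conjc z * hip phi a b.
Proof. by rewrite /hip -galgZ; congr (galg_val a _); apply/funext => x; rewrite galg_scaleE conjcM. Qed.

Lemma hip_dl phi g a b : hip phi (dl R g * a) (dl R g * b) = hip phi a b.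
Proof.
rewrite /hip galg_mulE dlE; congr (galg_val a _); apply/funext => x.
rewrite galg_mulE dlE; congr (conjc (galg_val b _)); apply/funext => y.
by rewrite !grpE.
Qed.

Lemma ip_dl phi g a b : ip phi (dl R g * a) (dl R g * b) = ip phi a b.
Proof. by rewrite /ip hip_dl. Qed.

Lemma ip_dlV phi g a b : ip phi (dl R g * a) b = ip phi a (dl R (ginv g) * b).
Proof. by rewrite -(ip_dl phi (ginv g)) mulrA dl_mul gmulV mul1r. Qed.

Lemma ipDl phi a b c : ip phi (a + b) c = ip phi a c + ip phi b c.
Proof. by rewrite /ip hipDl reD. Qed.

Lemma ipDr phi a b c : ip phi a (b + c) = ip phi a b + ip phi a c.
Proof. by rewrite /ip hipDr reD. Qed.

Lemma ipZl phi (r : R) a b : ip phi ((r%:C)%C *: a) b = r * ip phi a b.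
Proof. by rewrite /ip hipZl reZ. Qed.

Lemma ipZr phi (r : R) a b : ip phi a ((r%:C)%C *: b) = r * ip phi a b.
Proof. by rewrite /ip hipZr conjc_real reZ. Qed.

Lemma ipNl phi a b : ip phi (- a) b = - ip phi a b.
Proof. by rewrite -scaleN1r (_ : -1 = ((-1 : R)%:C)%C) ?ipZl ?mulN1r// rmorphN1. Qed.

Lemma ipNr phi a b : ip phi a (- b) = - ip phi a b.
Proof. by rewrite -scaleN1r (_ : -1 = ((-1 : R)%:C)%C) ?ipZr ?mulN1r// rmorphN1. Qed.

Lemma ip0l phi b : ip phi 0 b = 0.
Proof. by have := ipZl phi 0 0 b; rewrite scaler0 mul0r. Qed.

Lemma ip_suml phi (I : Type) (s : seq I) (F : I -> A) b :
  ip phi (\sum_(i <- s) F i) b = \sum_(i <- s) ip phi (F i) b.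
Proof. by elim: s => [|i s IHs]; rewrite ?big_nil ?ip0l// !big_cons ipDl IHs. Qed.

Lemma ip_scale phi z a : ip phi (z *: a) (z *: a) = csq z * ip phi a a.
Proof. by rewrite /ip hipZl hipZr mulrA mul_conjc reZ. Qed.

Section Positive.
Variable phi : G -> R.
Hypothesis phi_sym : forall x, phi (ginv x) = phi x.

Lemma ipC a b : ip phi a b = ip phi b a.
Proof.
have [s ->] := galg_ofP a; have [t ->] := galg_ofP b.
rewrite /ip !hip_of exchange_big !re_sum; apply: eq_bigr => p _.
rewrite !re_sum; apply: eq_bigr => q _; rewrite -re_conj !conjcM conjcK conjc_real.
by rewrite [conjc _ * _]mulrC -phi_sym !grpE.
Qed.

Lemma ipDD a b : ip phi (a + b) (a + b) = ip phi a a + 2 * ip phi a b + ip phi b b.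
Proof. by rewrite ipDl !ipDr [ip phi b a]ipC; ring. Qed.

Hypothesis phi_psd : forall a, 0 <= ip phi a a.

Lemma ip_young (s t : R) a b : 2 * s * t * ip phi a b <= s ^+ 2 * ip phi a a + t ^+ 2 * ip phi b b.
Proof.
have := phi_psd ((s%:C)%C *: a - (t%:C)%C *: b).
rewrite ipDD ipNl !ipNr !ipZl !ipZr; lra.
Qed.

Lemma ip_le_half a b : 2 * ip phi a b <= ip phi a a + ip phi b b.
Proof. by have := ip_young 1 1 a b; rewrite !mulr1 expr1n !mul1r. Qed.

Lemma ip_minkowski a b (s t : R) : 0 <= s -> 0 <= t ->
  ip phi a a <= s ^+ 2 -> ip phi b b <= t ^+ 2 -> ip phi (a + b) (a + b) <= (s + t) ^+ 2.
Proof.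
move=> s0 t0 as2 bt2; rewrite ipDD.
suff : ip phi a b <= s * t by lra.
apply/ler_addgt0Pr => e e0.
(* Cauchy-Schwarz is derived from [ip_young] with weights [t + d] and [s + d], which stay positive
   if [s] or [t] vanishes; [d] is chosen so that their product is at most [s * t + e]. *)
pose d := Num.min 1 (e / (s + t + 1)).
have d0 : 0 < d by rewrite lt_min ltr01 divr_gt0//; lra.
have d1 : d <= 1 by rewrite ge_min lexx.
have de : d * (s + t + 1) <= e by rewrite -ler_pdivlMr ?ge_min ?lexx ?orbT//; lra.
have dd : d * d <= d by rewrite ler_piMr// ltW.
have h := ip_young (t + d) (s + d) a b.
have h1 : (t + d) ^+ 2 * ip phi a a <= (t + d) ^+ 2 * (s + d) ^+ 2.
  by apply: ler_wpM2l; [exact: sqr_ge0|apply: le_trans as2 _; rewrite ler_sqr ?nnegrE; lra].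
have h2 : (s + d) ^+ 2 * ip phi b b <= (s + d) ^+ 2 * (t + d) ^+ 2.
  by apply: ler_wpM2l; [exact: sqr_ge0|apply: le_trans bt2 _; rewrite ler_sqr ?nnegrE; lra].
have P0 : 0 < (t + d) * (s + d) by apply: mulr_gt0; lra.
have : ip phi a b <= (t + d) * (s + d).
  rewrite -(ler_pM2l P0); lra.
by move=> /le_trans; apply; lra.
Qed.

Lemma bd_le a (M M' : R) : bd phi a M -> M <= M' -> bd phi a M'.
Proof.
move=> [M0 h] MM'; split; first exact: le_trans MM'.
move=> xi; apply: le_trans (h xi) _; apply: ler_wpM2r; first exact: phi_psd.
by rewrite ler_sqr ?nnegrE//; exact: le_trans MM'.
Qed.

Lemma bdD a b (M N : R) : bd phi a M -> bd phi b N -> bd phi (a + b) (M + N).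
Proof.
move=> [M0 ha] [N0 hb]; split; first exact: addr_ge0.
move=> xi; rewrite mulrDl -[ip phi xi xi]sqr_sqrtr ?phi_psd// -exprMn mulrDl.
by apply: ip_minkowski; rewrite ?mulr_ge0 ?sqrtr_ge0// exprMn sqr_sqrtr.
Qed.

Lemma bdM a b (M N : R) : bd phi a M -> bd phi b N -> bd phi (a * b) (M * N).
Proof.
move=> [M0 ha] [N0 hb]; split; first exact: mulr_ge0.
move=> xi; rewrite -mulrA; apply: le_trans (ha _) _.
by apply: le_trans (ler_wpM2l (sqr_ge0 M) (hb xi)) _; rewrite exprMn mulrA.
Qed.

Lemma bdZ z a (r M : R) : 0 <= r -> csq z <= r ^+ 2 -> bd phi a M -> bd phi (z *: a) (r * M).
Proof.
move=> r0 zr [M0 ha]; split; first exact: mulr_ge0.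
move=> xi; rewrite -scalerAl ip_scale exprMn -mulrA.
by apply: ler_pM => //; exact: csq_ge0.
Qed.

Lemma bdN a (M : R) : bd phi a M -> bd phi (- a) M.
Proof.
move=> ha; rewrite -scaleN1r -[M]mul1r; apply: bdZ => //.
by rewrite csqN csq1 expr1n.
Qed.

Lemma bd_dl g : bd phi (dl R g) 1.
Proof. by split=> // xi; rewrite ip_dl expr1n mul1r. Qed.

Lemma bd1 : bd phi 1 1. Proof. exact: bd_dl. Qed.

Lemma bd0 : bd phi 0 0.
Proof. by split=> // xi; rewrite mul0r ip0l expr0n mul0r. Qed.

Lemma bd_contraction_ip z xi : bd phi z 1 -> ip phi (z * xi) xi <= ip phi xi xi.
Proof.
move=> [_ hz]; have := hz xi; rewrite expr1n mul1r => h.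
by have := ip_le_half (z * xi) xi; lra.
Qed.

Lemma ip_dl_ge g xi : - ip phi xi xi <= ip phi (dl R g * xi) xi.
Proof. by have := phi_psd (dl R g * xi + xi); rewrite ipDD ip_dl; lra. Qed.

Definition selfadj u := forall a b, ip phi (u * a) b = ip phi a (u * b).

(** The squared norm expands to [|xi|^2 - 2 |u xi|^2 + |u u xi|^2], whose last term is at most
    [|u xi|^2]. *)
Lemma bd_one_sub_sqr u : selfadj u -> bd phi u 1 -> bd phi (1 - u * u) 1.
Proof.
move=> uS [_ u1]; split=> // xi; rewrite mulrBl mul1r ipDD ipNl !ipNr expr1n mul1r opprK.
have := u1 xi; have := u1 (u * xi); rewrite expr1n !mul1r !mulrA => h1 h2.
have -> : ip phi xi (u * u * xi) = ip phi (u * xi) (u * xi) by rewrite uS mulrA.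
have := phi_psd (u * xi); lra.
Qed.

Lemma coercive_lower (c : R) v xi : 0 <= c -> c * ip phi xi xi <= ip phi (v * xi) xi ->
  c ^+ 2 * ip phi xi xi <= ip phi (v * xi) (v * xi).
Proof.
move=> c0 h; have := ip_young 1 c (v * xi) xi.
rewrite mulr1 expr1n mul1r.
have := ler_wpM2l c0 h; lra.
Qed.

End Positive.

Definition coef a (x : G) : C := a (fun y => (y == x)%:R).

Lemma galg_expand a : exists D : seq G, [/\ uniq D, forall x, x \notin D -> coef a x = 0 &
  forall F, a F = \sum_(x <- D) coef a x * F x].
Proof.
have [s ->] := galg_ofP a; exists (undup [seq p.2 | p <- s]); split.
- exact: undup_uniq.
- move=> x; rewrite mem_undup => xs; rewrite /coef /= /ev big_seq big1// => p ps.
  case: eqP => [e|]; last by rewrite mulr0.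
  by case/negP: xs; rewrite -e; exact: map_f.
- move=> F; rewrite /coef /= /ev.
  under [RHS]eq_bigr do rewrite mulr_suml.
  rewrite exchange_big big_seq [RHS]big_seq; apply: eq_bigr => p ps /=.
  rewrite (bigD1_seq p.2) ?undup_uniq ?mem_undup ?map_f//= eqxx mulr1 big1 ?addr0// => x.
  by rewrite eq_sym => /negPf ->; rewrite mulr0 mul0r.
Qed.

Definition delta1 (x : G) : R := (x == gone G)%:R.

Lemma delta1_sym x : delta1 (ginv x) = delta1 x.
Proof.
rewrite /delta1; congr (_%:R); congr nat_of_bool; apply/eqP/eqP => [h|->]; last exact: ginv1.
by rewrite -[x]ginvK h ginv1.
Qed.

Lemma delta1_eq (x y : G) : ((delta1 (ginv y ** x))%:C)%C = (y == x)%:R :> C.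
Proof.
rewrite /delta1 (_ : (ginv y ** x == gone G) = (y == x)).
  by case: eqP.
apply/eqP/eqP => [h|->]; last exact: gmulV.
by apply/esym; rewrite -[x]gmul1 -(gmulVr y) -gmulA h gmul1r.
Qed.

Lemma ip_delta1 a : exists D : seq G, [/\ uniq D, forall x, x \notin D -> coef a x = 0 &
  ip delta1 a a = \sum_(x <- D) csq (coef a x)].
Proof.
have [D [uD D0 aD]] := galg_expand a; exists D; split=> //.
rewrite /ip /hip aD re_sum; apply: eq_bigr => x _.
under eq_fun do rewrite delta1_eq.
by rewrite -/(coef a x) mul_conjc.
Qed.

Lemma delta1_psd a : 0 <= ip delta1 a a.
Proof. by have [D [_ _ ->]] := ip_delta1 a; apply: sumr_ge0 => x _; exact: csq_ge0. Qed.

(** For fixed [a] the form involves only the finitely many values of [phi] at quotients of support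
    points. *)
Lemma ip_approx phi a (e : R) : 0 < e -> exists E : seq G, exists2 d : R, 0 < d &
  forall psi, (forall k, k \in E -> `|psi k - phi k| <= d) -> `|ip psi a a - ip phi a a| <= e.
Proof.
move=> e0; have [s ->] := galg_ofP a.
pose w (p q : C * G) : R := `|complex.Re (p.1 * conjc q.1)|.
pose W := \sum_(p <- s) \sum_(q <- s) w p q.
have W0 : 0 <= W by apply: sumr_ge0 => p _; apply: sumr_ge0 => q _; exact: normr_ge0.
exists [seq ginv q.2 ** p.2 | p <- s, q <- s], (e / (W + 1)).
  by rewrite divr_gt0// ltr_wpDl.
move=> psi h; rewrite /ip !hip_of !re_sum -sumrB.
apply: (@le_trans _ _ (W * (e / (W + 1)))); last first.
  by rewrite mulrA ler_pdivrMr ?ltr_wpDl// mulrC ler_wpM2l ?ltW// ltrDl.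
rewrite mulr_suml; apply: le_trans (ler_norm_sum _ _ _) _.
rewrite big_seq [leRHS]big_seq; apply: ler_sum => p ps.
rewrite !re_sum -sumrB mulr_suml; apply: le_trans (ler_norm_sum _ _ _) _.
rewrite big_seq [leRHS]big_seq; apply: ler_sum => q qs.
rewrite ![_ * ((_)%:C)%C]mulrC !reZ -mulrBl normrM mulrC ler_wpM2l//.
by apply: h; apply/allpairsP; exists (p, q).
Qed.

End Form.

(** * Weak containment *)

Section WeakContainment.
Variables (R : realType) (G : group) (K : set G).
Hypothesis K_subgroup : is_subgroup K.
Hypothesis K_mean : has_inv_mean R K.
Local Notation C := R[i].
Local Notation A := (galg R G).

(* Day's convexity argument, with boolean test functions. *)
Lemma reiter (E : seq G) (e : R) : 0 < e ->
  exists c : seq (R * G), [/\ List.Forall (fun w => 0 <= w.1 /\ K w.2) c,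
    0 < \sum_(w <- c) w.1 &
    forall k (phi : G -> bool), k \in E -> K k ->
      \sum_(w <- c) w.1 * ((phi w.2)%:R - (phi (ginv k ** w.2))%:R) <= e * \sum_(w <- c) w.1].
Proof.
move=> e0; pose E' := undup [seq k <- E | `[< K k >]].
have E'K k : k \in E' -> K k by rewrite mem_undup mem_filter => /andP[/asboolP].
(* A test function is a family indexed by [k], so one mean on [X] handles all of [E']
   simultaneously. *)
pose T := {z : G | K z}; pose X := G -> G -> bool.
pose u (z : T) (phi : X) : R :=
  \sum_(k <- E') ((phi k (sval z))%:R - (phi k (ginv k ** sval z))%:R) - e.
have ub z : bdd (u z) by apply: bddB => //; apply: bdd_sum => k; apply: bddB.
apply: contrapT => nc.
have [|om [omm om0]] := @minimax R X T u (inhabits (fun _ _ => false)) ub.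
  move=> c Pc; apply: contrapT => nx; apply: nc.
  have neg phi : \sum_(w <- c) w.1 * u w.2 phi < 0.
    by rewrite ltNge; apply/negP => h; apply: nx; exists phi.
  exists [seq (w.1, sval w.2) | w <- c]; split.
  - by apply/List.Forall_map; apply: List.Forall_impl Pc => w w0; split=> //=; exact: svalP w.2.
  - rewrite big_map.
    have u0 z : u z (fun _ _ => false) = - e.
      by rewrite /u big1 => [|k _]; rewrite ?subrr// sub0r.
    have := neg (fun _ _ => false).
    rewrite (eq_bigr (fun w => - (w.1 * e))) => [|w _]; last by rewrite u0 mulrN.
    by rewrite sumrN oppr_lt0 -mulr_suml pmulr_lgt0.
  - move=> k phi kE Kk; rewrite !big_map mulr_sumr -subr_le0 -sumrB /=.
    (* The family vanishing except at index [k] isolates a single term of the sum, since [E'] has no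
       duplicates. *)
    have := neg (fun k' z => (k' == k) && phi z) => /ltW/(le_trans _); apply.
    apply: eq_ler; apply: eq_bigr => w _; rewrite [e * _]mulrC -mulrBr; congr (_ * (_ - _)).
    have kE' : k \in E' by rewrite mem_undup mem_filter kE andbT; apply/asboolP.
    rewrite (bigD1_seq k) ?undup_uniq//= eqxx /= big1 ?addr0// => k' /negPf ->.
    by rewrite subrr.
have [m [[mm mK] msup]] := inv_mean_supported K_subgroup K_mean.
pose ph k z := om (fun phi => (phi k z)%:R).
have phb k : bdd (ph k).
  by exists 1 => z; apply: mean_norm_le => // phi; rewrite normr_nat; case: (phi k z).
(* The contradiction: [F >= e] on [K], whereas its invariant mean is a sum of differences of
   translates, hence 0. Off [K] nothing is known, so [F'] takes the value [e] there. *)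
pose F z := \sum_(k <- E') (ph k z - ph k (ginv k ** z)).
have Fb : bdd F by apply: bdd_sum => k; apply: bddB => //; exact: bdd_comp (phb k).
have Fe z : K z -> e <= F z.
  move=> Kz; have := om0 (exist _ z Kz); rewrite /u meanB//; last first.
    by apply: bdd_sum => k; apply: bddB.
  rewrite mean_cst// subr_ge0 mean_sum//; last by move=> k; apply: bddB.
  by move=> /le_trans; apply; apply: eq_ler; apply: eq_bigr => k _; rewrite meanB.
pose F' z := if `[< K z >] then F z else e.
have F'b : bdd F'.
  have [B FB] := Fb; exists (Num.max B `|e|) => z; rewrite /F' le_max.
  by case: ifP => _; rewrite ?FB// lexx orbT.
have h1 : e <= m F'.
  by apply: mean_ge => // z; rewrite /F'; case: ifPn => [/asboolP/Fe|].
have h2 : m F' = m F by apply: msup => // z Kz; rewrite /F' asboolT.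
have h3 : m F = 0.
  rewrite /F mean_sum//; last by move=> k; apply: bddB => //; exact: bdd_comp (phb k).
  rewrite big_seq big1// => k /E'K Kk.
  rewrite meanB//; last exact: bdd_comp (phb k).
  rewrite (mK (ginv k) (ph k)) ?subrr//.
  by have [_ [_ KV]] := K_subgroup; exact: KV.
by move: h1; rewrite h2 h3 leNgt e0.
Qed.

Definition subgroup_ind (x : G) : R := `[< K x >]%:R.

Lemma sum_pick (D : seq G) (F : G -> R) y : uniq D -> (forall z, z \notin D -> F z = 0) ->
  \sum_(z <- D) F z * (y == z)%:R = F y.
Proof.
move=> uD FD; have [yD|yD] := boolP (y \in D).
  rewrite (bigD1_seq y)//= eqxx mulr1 big1 ?addr0// => z.
  by rewrite eq_sym => /negPf ->; rewrite mulr0.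
rewrite FD// big_seq big1// => z zD; case: eqP => [e|]; last by rewrite mulr0.
by rewrite e zD in yD.
Qed.

(** The vector [b] is the square root of the density [p] from [reiter], and [psi] is its matrix
    coefficient. Off [K] it vanishes exactly, because [x] and [k x] cannot both lie in [K]. *)
Lemma almost_invariant (E : seq G) (e : R) : 0 < e ->
  exists (b : A) (psi : G -> R),
    (forall k, hip (@delta1 R G) (dl R k * b) b = ((psi k)%:C)%C) /\
    forall k, k \in E -> `|psi k - subgroup_ind k| <= e.
Proof.
move=> e0; have [c [cP W0 cE]] := reiter E e0.
have cP' w : List.In w c -> 0 <= w.1 /\ K w.2 by move: cP => /List.Forall_forall; apply.
set W := \sum_(w <- c) w.1 in W0 cE.
pose p y := (\sum_(w <- c) w.1 * (w.2 == y)%:R) / W.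
pose D := undup [seq w.2 | w <- c].
have uD : uniq D by exact: undup_uniq.
have p0 y : 0 <= p y.
  rewrite /p divr_ge0 ?(ltW W0)//; elim: c cP' {cP W0 cE W p D uD} => [|w c IHc] cP.
    by rewrite big_nil.
  rewrite big_cons addr_ge0//; first by rewrite mulr_ge0//; exact: (cP w (or_introl erefl)).1.
  by apply: IHc => v vc; apply: cP; right.
have pD y : y \notin D -> p y = 0.
  rewrite mem_undup => yD; rewrite /p big_seq big1 ?mul0r// => w wc.
  case: eqP => [ey|]; last by rewrite mulr0.
  by case/negP: yD; rewrite -ey; exact: map_f.
have pK y : ~ K y -> p y = 0.
  move=> Ky; rewrite /p; suff -> : \sum_(w <- c) w.1 * (w.2 == y)%:R = 0 by rewrite mul0r.
  elim: c cP' {cP W0 cE W p D uD p0 pD} => [|w c IHc] cP; first by rewrite big_nil.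
  rewrite big_cons IHc ?addr0; last by move=> v vc; apply: cP; right.
  case: eqP => [ey|]; last by rewrite mulr0.
  by case: Ky; rewrite -ey; exact: (cP w (or_introl erefl)).2.
have sumE (F : G -> R) : \sum_(y <- D) p y * F y = (\sum_(w <- c) w.1 * F w.2) / W.
  rewrite /p; under eq_bigr do rewrite mulrAC mulr_suml.
  rewrite -mulr_suml exchange_big; congr (_ / _); rewrite big_seq [RHS]big_seq.
  apply: eq_bigr => w wc.
  rewrite (bigD1_seq w.2) ?mem_undup ?map_f//= eqxx mulr1 big1 ?addr0// => y.
  by rewrite eq_sym => /negPf ->; rewrite mulr0 mul0r.
have p1 : \sum_(y <- D) p y = 1.
  have := sumE (fun=> 1); under eq_bigr do rewrite mulr1; move=> ->.
  by under eq_bigr do rewrite mulr1; rewrite divff// gt_eqF.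
pose v y := Num.sqrt (p y).
have vD y : y \notin D -> v y = 0 by move=> /pD; rewrite /v => ->; rewrite sqrtr0.
pose b : A := \sum_(y <- D) ((v y)%:C)%C *: dl R y.
have bE F : b F = \sum_(y <- D) ((v y)%:C)%C * F y.
  by rewrite galg_sumE; apply: eq_bigr => y _; rewrite galg_scaleE dlE.
pose psi k := \sum_(x <- D) v x * v (k ** x).
have psiE k : hip (@delta1 R G) (dl R k * b) b = ((psi k)%:C)%C.
  rewrite /hip galg_mulE dlE bE /psi rmorph_sum; apply: eq_bigr => x _ /=.
  rewrite rmorphM; congr (_ * _); rewrite bE conjc_sum.
  rewrite -(sum_pick (k ** x) uD vD) rmorph_sum; apply: eq_bigr => y _.
  by rewrite conjcM !conjc_real delta1_eq rmorphM /= rmorph_nat eq_sym.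
exists b, psi; split=> // k kE.
have [Kk|Kk] := pselect (K k); last first.
  rewrite /subgroup_ind asboolF// subr0 /psi big1 ?normr0 ?ltW// => x _.
  have [Kx|Kx] := pselect (K x); last by rewrite /v (pK x)// sqrtr0 mul0r.
  rewrite /v (pK (k ** x)) ?sqrtr0 ?mulr0// => Kkx; apply: Kk.
  have [_ [KM KV]] := K_subgroup.
  by have := KM _ _ Kkx (KV _ Kx); rewrite !grpE.
rewrite /subgroup_ind asboolT// distrC ger0_norm; last first.
  have hb : ip (@delta1 R G) b b = 1.
    have := psiE (gone G); rewrite -[dl R (gone G)]/(1 : A) mul1r /ip => ->.
    rewrite /= /psi -p1; apply: eq_bigr => x _.
    by rewrite gmul1 -expr2 sqr_sqrtr.
  have := bd_contraction_ip (@delta1_sym R G) (@delta1_psd R G) b (bd_dl (@delta1 R G) k).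
  by rewrite hb /ip psiE /= subr_ge0.
(* The set where translation by [k] lowers [p]. As [sqrt s * sqrt t >= min s t], the defect
   [1 - psi k] is at most the loss of mass on it, which [reiter] bounds. *)
pose phi x := (x \in D) && (p (k ** x) < p x).
have := cE k phi kE Kk.
rewrite -ler_pdivrMr// -(sumE (fun z => (phi z)%:R - (phi (ginv k ** z))%:R)) => h.
apply: le_trans h.
under [leRHS]eq_bigr do rewrite mulrBr.
rewrite sumrB.
have phD z : z \notin D -> (phi z)%:R = 0 :> R by rewrite /phi => /negPf ->.
have -> : \sum_(z <- D) p z * (phi (ginv k ** z))%:R = \sum_(x <- D) p (k ** x) * (phi x)%:R.
  under eq_bigr do rewrite -(sum_pick _ uD phD) mulr_sumr.
  rewrite exchange_big; apply: eq_bigr => x _ /=.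
  rewrite -(sum_pick (k ** x) uD pD) mulr_suml; apply: eq_bigr => z _.
  rewrite (_ : (ginv k ** z == x) = (k ** x == z)); first by ring.
  by apply/eqP/eqP => [<-|<-]; rewrite !grpE.
rewrite -[X in X - psi k]p1 /psi -!sumrB big_seq [leRHS]big_seq.
apply: ler_sum => x xD; rewrite /phi xD /= -mulrBl.
have hmin (s t : R) : 0 <= s -> s <= t -> s <= Num.sqrt s * Num.sqrt t.
  move=> s0 st; rewrite -{1}(sqr_sqrtr s0) expr2 ler_wpM2l ?sqrtr_ge0// ler_wsqrtr//.
case: ltP => hlt.
  by rewrite mulr1 lerD2l lerN2 mulrC; apply: hmin => //; exact: ltW.
by rewrite mulr0 subr_le0; exact: hmin.
Qed.

Lemma hip_suml phi (I : Type) (s : seq I) (F : I -> A) b :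
  hip phi (\sum_(i <- s) F i) b = \sum_(i <- s) hip phi (F i) b.
Proof. exact: galg_sumE. Qed.

Lemma hip_sumr phi (I : Type) (s : seq I) (F : I -> A) b :
  hip phi b (\sum_(i <- s) F i) = \sum_(i <- s) hip phi b (F i).
Proof.
elim: s => [|i s IHs]; last by rewrite !big_cons hipDr IHs.
by rewrite !big_nil -(scale0r (0 : A)) hipZr conjc0 mul0r.
Qed.

(** Right multiplication by [b] commutes with left multiplication and carries the form of [psi]
    isometrically into the regular form. *)
Lemma hip_right_mul (b : A) psi (a a' : A) :
  (forall k, hip (@delta1 R G) (dl R k * b) b = ((psi k)%:C)%C) ->
  hip (@delta1 R G) (a * b) (a' * b) = hip psi a a'.
Proof.
move=> h; have [s ->] := galg_ofP a; have [t ->] := galg_ofP a'.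
rewrite hip_of !galg_of_sum !mulr_suml hip_suml; apply: eq_bigr => p _.
rewrite hip_sumr; apply: eq_bigr => q _.
rewrite -[(p.1 *: _) * b]scalerAl -[(q.1 *: _) * b]scalerAl hipZl hipZr mulrA; congr (_ * _).
by rewrite -h -(hip_dl _ (ginv q.2)) !mulrA !dl_mul gmulV [dl R (gone G) * _]mul1r.
Qed.

(** One [b] serves two elements because comparing norms requires [a * xi] and [xi] together. *)
Lemma ind_approx (a a' : A) (e : R) : 0 < e -> exists b : A,
  `|ip (@delta1 R G) (a * b) (a * b) - ip subgroup_ind a a| <= e /\
  `|ip (@delta1 R G) (a' * b) (a' * b) - ip subgroup_ind a' a'| <= e.
Proof.
move=> e0; have [E1 [d1 d10 h1]] := ip_approx subgroup_ind a e0.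
have [E2 [d2 d20 h2]] := ip_approx subgroup_ind a' e0.
have d0 : 0 < Num.min d1 d2 by rewrite lt_min d10.
have [b [psi [hb hE]]] := almost_invariant (E1 ++ E2) d0.
exists b; rewrite /ip !(hip_right_mul _ _ hb); split.
- apply: h1 => k kE; have := hE k; rewrite mem_cat kE => /(_ isT).
  by rewrite le_min => /andP[].
- apply: h2 => k kE; have := hE k; rewrite mem_cat kE orbT => /(_ isT).
  by rewrite le_min => /andP[].
Qed.

Lemma ind_sym x : subgroup_ind (ginv x) = subgroup_ind x.
Proof.
have [_ [_ KV]] := K_subgroup.
rewrite /subgroup_ind; congr (_%:R); congr nat_of_bool; apply: asbool_equiv_eq.
by split=> [/KV|/KV//]; rewrite ginvK.
Qed.

Lemma ind_psd (a : A) : 0 <= ip subgroup_ind a a.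
Proof.
rewrite -oppr_le0; apply/ler_addgt0Pr => e e0; rewrite add0r.
have [b [h _]] := ind_approx a a e0.
have := delta1_psd (a * b); move: h; rewrite ler_norml => /andP[]; lra.
Qed.

(* Since [K] is amenable, the quasi-regular representation on [l^2(G/K)] is
   weakly contained in the regular one. *)
Lemma weak_containment (a : A) (M : R) : bd (@delta1 R G) a M -> bd subgroup_ind a M.
Proof.
move=> [M0 h]; split=> // xi; apply/ler_addgt0Pr => e e0.
have d0 : 0 < e / (M ^+ 2 + 1) by rewrite divr_gt0// ltr_wpDl ?sqr_ge0.
have [b []] := ind_approx (a * xi) xi d0.
have := h (xi * b); rewrite !mulrA !ler_norml => h1 /andP[h2 _] /andP[_ h3].
have {}h3 := ler_wpM2l (sqr_ge0 M) h3.
set d := e / _ in d0 h2 h3.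
have ed : (M ^+ 2 + 1) * d = e by rewrite /d mulrC divfK// gt_eqF// ltr_wpDl ?sqr_ge0.
rewrite -ed; lra.
Qed.

End WeakContainment.

(** * An element of the kernel *)

Section Coercive.
Variables (R : realType) (G : group) (K : set G).
Hypothesis K_subgroup : is_subgroup K.
Hypothesis K_mean : has_inv_mean R K.
Local Notation C := R[i].
Local Notation A := (galg R G).
Local Notation ind := (@subgroup_ind R G K).
Implicit Types (W : G -> R) (a b xi eta : A).

Lemma galg_mulfun_subproof W a : exists s, (fun F => a (fun x => ((W x)%:C)%C * F x)) = ev s.
Proof.
have [s es] := galgP a; exists [seq (p.1 * ((W p.2)%:C)%C, p.2) | p <- s].
by apply/funext => F; rewrite es /ev big_map; apply: eq_bigr => p _; rewrite mulrA.
Qed.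
Definition mulfun W a : A := GAlg (galg_mulfun_subproof W a).

Lemma mulfunE W a F : mulfun W a F = a (fun x => ((W x)%:C)%C * F x).
Proof. by []. Qed.

(** Such a [W] is a function on [G/K], and [mulfun W] then induces a self-adjoint multiplication
    operator there. *)
Definition right_inv W := forall x k, K k -> W (x ** k) = W x.

Lemma ind_cases x : (K x /\ ind x = 1) \/ (~ K x /\ ind x = 0).
Proof. by rewrite /subgroup_ind; have [h|h] := pselect (K x); [left; rewrite asboolT|right; rewrite asboolF]. Qed.

Lemma ip_mulfun W a b : right_inv W -> ip ind (mulfun W a) b = ip ind a (mulfun W b).
Proof.
move=> Wi; rewrite /ip /hip mulfunE; congr (complex.Re (galg_val a _)); apply/funext => x.
rewrite -[((W x)%:C)%C]conjc_real -conjcM -galgZ; congr (conjc (galg_val b _)).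
apply/funext => y; have [[h ->]|[_ ->]] := ind_cases (ginv y ** x); last by rewrite !mulr0.
by have := Wi y _ h; rewrite !grpE => ->.
Qed.

Lemma mulfun_comp W W' a : mulfun W (mulfun W' a) = mulfun (fun x => W x * W' x) a.
Proof.
apply: galg_eq => F; rewrite !mulfunE; congr (galg_val a _); apply/funext => x.
by rewrite rmorphM mulrA [_ * ((W' x)%:C)%C]mulrC.
Qed.

Lemma mulfun1 a : mulfun (fun=> 1) a = a.
Proof.
apply: galg_eq => F; rewrite mulfunE; congr (galg_val a _); apply/funext => x.
by rewrite mul1r.
Qed.

Lemma mulfunD W W' a : mulfun (fun x => W x + W' x) a = mulfun W a + mulfun W' a.
Proof.
apply: galg_eq => F; rewrite galg_addE !mulfunE -galgD; congr (galg_val a _).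
by apply/funext => x; rewrite rmorphD mulrDl.
Qed.

Lemma mulfunZ (r : R) W a : mulfun (fun x => r * W x) a = ((r%:C)%C : C) *: mulfun W a.
Proof.
apply: galg_eq => F; rewrite galg_scaleE !mulfunE -galgZ; congr (galg_val a _).
by apply/funext => x; rewrite rmorphM mulrA.
Qed.

Lemma mulfun0 a : mulfun (fun=> 0) a = 0.
Proof.
have -> : (fun=> 0) = (fun x : G => 0 * 0 : R) by apply/funext => x; rewrite mul0r.
by rewrite (mulfunZ 0 (fun=> 0)) rmorph0 scale0r.
Qed.

Lemma ip_mulfun_ge0 W a : right_inv W -> (forall x, 0 <= W x) -> 0 <= ip ind (mulfun W a) a.
Proof.
move=> Wi W0; pose V x := Num.sqrt (W x).
have -> : W = (fun x => V x * V x) by apply/funext => x; rewrite -expr2 sqr_sqrtr.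
rewrite -mulfun_comp ip_mulfun; first exact: ind_psd.
by move=> x k Kk; rewrite /V Wi.
Qed.

(** The indicator of the cosets [x K] fixed by [t]. *)
Definition fixset (t x : G) : R := ind (ginv x ** t ** x).

Lemma fixset_right_inv t : right_inv (fixset t).
Proof.
move=> x k Kk; rewrite /fixset /subgroup_ind; congr (_%:R); congr nat_of_bool; apply: asbool_equiv_eq.
have [_ [KM KV]] := K_subgroup.
split=> h; last by have := KM _ _ (KM _ _ (KV _ Kk) h) Kk; rewrite !grpE.
by have := KM _ _ (KM _ _ Kk h) (KV _ Kk); rewrite !grpE.
Qed.

Lemma fixset_idem t x : fixset t x * fixset t x = fixset t x.
Proof. by rewrite /fixset; have [[_ ->]|[_ ->]] := ind_cases (ginv x ** t ** x); rewrite ?mulr1 ?mulr0. Qed.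

(** On fixed cosets [t] acts trivially in [l^2(G/K)] though not in the group algebra, so the
    identity holds only inside the form. *)
Lemma ip_dl_fixset t xi eta : ip ind (dl R t * mulfun (fixset t) xi) eta = ip ind (mulfun (fixset t) xi) eta.
Proof.
rewrite /ip /hip galg_mulE dlE !mulfunE; congr (complex.Re (galg_val xi _)).
apply/funext => x; rewrite /fixset.
have [[h ->]|[_ ->]] := ind_cases (ginv x ** t ** x); last by rewrite !mul0r.
congr (_ * conjc (galg_val eta _)); apply/funext => y; congr ((_%:C)%C).
rewrite /subgroup_ind; congr (_%:R); congr nat_of_bool; apply: asbool_equiv_eq.
have [_ [KM KV]] := K_subgroup.
split=> h'; last by have := KM _ _ h' h; rewrite !grpE.
by have := KM _ _ h' (KV _ h); rewrite !grpE.
Qed.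

Lemma dl_mulfun_fixset t xi : dl R t * mulfun (fixset t) xi = mulfun (fixset t) (dl R t * xi).
Proof.
apply: galg_eq => F; rewrite galg_mulE dlE !mulfunE galg_mulE dlE; congr (galg_val xi _).
by apply/funext => x; rewrite /fixset !grpE.
Qed.

(* Split [xi] into the part supported on the points of [G/K] fixed by [t] and
   the rest: [t] acts trivially on the first part and isometrically on the other. *)
Lemma ip_dl_fixed_part t xi :
  2 * ip ind (mulfun (fixset t) xi) xi - ip ind xi xi <= ip ind (dl R t * xi) xi.
Proof.
set p := mulfun (fixset t) xi; pose n := xi - p.
have Pi := @fixset_right_inv t.
have ixi : xi = p + n by rewrite /n addrC subrK.
have Pn : mulfun (fixset t) n = 0.
  have -> : n = mulfun (fun x => 1 + -1 * fixset t x) xi.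
    by rewrite mulfunD mulfun1 mulfunZ rmorphN1 scaleN1r.
  rewrite mulfun_comp -[RHS](mulfun0 xi); congr mulfun; apply/funext => x.
  by rewrite mulrDr mulr1 mulrCA fixset_idem mulN1r subrr.
have pn : ip ind p n = 0 by rewrite ip_mulfun// Pn (ipC (ind_sym R K_subgroup)) ip0l.
have tnp : ip ind (dl R t * n) p = 0.
  by rewrite -ip_mulfun// -dl_mulfun_fixset Pn mulr0 ip0l.
have pxi : ip ind p xi = ip ind p p by rewrite {1}ixi ipDr pn addr0.
have nxi : ip ind xi xi = ip ind p p + ip ind n n.
  by rewrite {1 2}ixi (ipDD (ind_sym R K_subgroup)) pn mulr0 addr0.
have e : ip ind (dl R t * xi) xi = ip ind p p + ip ind (dl R t * n) n.
  by rewrite {1}ixi mulrDr ipDl ip_dl_fixset -/p pxi {1}ixi ipDr tnp add0r.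
rewrite e pxi nxi.
have := ip_dl_ge (ind_sym R K_subgroup) (ind_psd K_subgroup K_mean) t n; lra.
Qed.

Variable c : seq (R * G).
Hypothesis c_pos : List.Forall (fun w => 0 <= w.1 /\ w.2 <> gone G) c.
Hypothesis c_fix : forall g, \sum_(w <- c) w.1 * (3 / 4 - `[< K (ginv g ** w.2 ** g) >]%:R) < 0.

Let W0 := \sum_(w <- c) w.1.

Let sum_le (F H : R * G -> R) : (forall w, 0 <= w.1 -> w.2 <> gone G -> F w <= H w) ->
  \sum_(w <- c) F w <= \sum_(w <- c) H w.
Proof.
move=> FH; elim: c c_pos => [|w d IHd]; first by rewrite !big_nil.
by move=> /List.Forall_cons_iff[[w0 w1] /IHd h]; rewrite !big_cons lerD// FH.
Qed.

Let sum_eq (F H : R * G -> R) : (forall w, 0 <= w.1 -> w.2 <> gone G -> F w = H w) ->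
  \sum_(w <- c) F w = \sum_(w <- c) H w.
Proof.
by move=> FH; apply/eqP; rewrite eq_le !sum_le// => w w0 w1; rewrite FH.
Qed.

Let W0_gt0 : 0 < W0.
Proof.
have := c_fix (gone G); rewrite ltNge => /negP h; rewrite ltNge; apply/negP => h'; apply: h.
(* Each factor is at least [3 / 4 - 1], so a total weight [W0 <= 0] would make the sum
   non-negative. *)
apply: (@le_trans _ _ (- (1 / 4) * W0)); first by lra.
rewrite mulr_sumr; apply: sum_le => w w0 _; rewrite mulrC ler_wpM2l//.
by have := @ler01 R; case: (`[< _ >]) => /=; lra.
Qed.

Let al (w : R * G) : R := w.1 / W0.

Let al_ge0 w : 0 <= w.1 -> 0 <= al w.
Proof. by move=> w0; rewrite divr_ge0// ltW. Qed.

Let al_sum : \sum_(w <- c) al w = 1.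
Proof. by rewrite -mulr_suml divff// gt_eqF. Qed.

Definition avg : A := \sum_(w <- c) ((al w)%:C)%C *: dl R w.2.
Definition avgV : A := \sum_(w <- c) ((al w)%:C)%C *: dl R (ginv w.2).
(** The shift 1/4 is halfway between the trace 0 and the lower bound 1/2 of the real part on
    [l^2(G/K)], leaving a margin on both sides. The outer factor 1/2 brings the norm below 1, as the
    square root iteration needs. *)
Definition shifted : A := (((1 / 2 : R)%:C)%C : C) *: ((((1 / 2 : R)%:C)%C : C) *: (avg + avgV) - (((1 / 4 : R)%:C)%C : C) *: 1).

Lemma ip_avg phi a b : ip phi (avg * a) b = \sum_(w <- c) al w * ip phi (dl R w.2 * a) b.
Proof. by rewrite mulr_suml ip_suml; apply: eq_bigr => w _; rewrite -scalerAl ipZl. Qed.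

Lemma ip_avgV phi a b : ip phi (avgV * a) b = \sum_(w <- c) al w * ip phi (dl R (ginv w.2) * a) b.
Proof. by rewrite mulr_suml ip_suml; apply: eq_bigr => w _; rewrite -scalerAl ipZl. Qed.

Section AnyForm.
Variable phi : G -> R.
Hypotheses (phi_sym : forall x, phi (ginv x) = phi x) (phi_psd : forall a, 0 <= ip phi a a).

Lemma ip_avg_adj a b : ip phi (avg * a) b = ip phi a (avgV * b).
Proof.
rewrite ip_avg (ipC phi_sym) ip_avgV; apply: eq_bigr => w _.
by rewrite ip_dlV (ipC phi_sym).
Qed.

Lemma ip_shifted a b : ip phi (shifted * a) b =
  1 / 2 * (1 / 2 * (ip phi (avg * a) b + ip phi (avgV * a) b) - 1 / 4 * ip phi a b).
Proof.
rewrite /shifted -!scalerAl ipZl mulrBl ipDl ipNl -!scalerAl !ipZl [1 * a]mul1r mulrDl ipDl.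
by [].
Qed.

Lemma shifted_selfadj : selfadj phi shifted.
Proof.
move=> a b; rewrite [RHS](ipC phi_sym) !ip_shifted ip_avg_adj (ip_avg_adj b a).
by rewrite [ip phi a (avgV * b)](ipC phi_sym) [ip phi b (avgV * a)](ipC phi_sym) [ip phi b a](ipC phi_sym) [X in _ * (_ * X - _)]addrC.
Qed.

Lemma bd_avg_gen (f : R * G -> G) : bd phi (\sum_(w <- c) ((al w)%:C)%C *: dl R (f w)) 1.
Proof.
rewrite -al_sum; move: al al_ge0 => be be0.
elim: c c_pos => [|w d IHd]; first by move=> _; rewrite !big_nil; exact: bd0.
move=> /List.Forall_cons_iff[[w0 _] /IHd h]; rewrite !big_cons; apply: bdD => //.
by rewrite -[X in bd _ _ X]mulr1; apply: bdZ => //; [exact: be0|rewrite csq_real|exact: bd_dl].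
Qed.

Lemma shifted_bd : bd phi shifted 1.
Proof.
have h := bdD phi_sym phi_psd (bd_avg_gen (fun w => w.2)) (bd_avg_gen (fun w => ginv w.2)).
have h1 : bd phi ((((1 / 2 : R)%:C)%C : C) *: (avg + avgV)) ((1 / 2) * (1 + 1)).
  by apply: bdZ => //; [lra|rewrite csq_real].
have h2 : bd phi ((((1 / 4 : R)%:C)%C : C) *: (1 : A)) ((1 / 4) * 1).
  by apply: bdZ => //; [lra|rewrite csq_real|exact: bd1].
have h3 := bdD phi_sym phi_psd h1 (bdN phi_psd h2).
apply: (@bd_le _ _ _ phi_psd _ (1 / 2 * (1 / 2 * (1 + 1) + 1 / 4 * 1))); last by lra.
by apply: bdZ => //; [lra|rewrite csq_real].
Qed.

End AnyForm.

Lemma shifted_coercive xi : 1 / 8 * ip ind xi xi <= ip ind (shifted * xi) xi.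
Proof.
have isym := ind_sym R K_subgroup; have ipsd := ind_psd K_subgroup K_mean.
have ha : 1 / 2 * ip ind xi xi <= ip ind (avg * xi) xi.
  rewrite ip_avg.
  (* The excess over 3/4 of the weight fixing the coset of [x], non-negative by [c_fix]. With
     [ip_dl_fixed_part] it gives the constant [2 * (3 / 4) - 1 = 1 / 2]. *)
  pose W x := \sum_(w <- c) al w * (fixset w.2 x + - (3 / 4)).
  have Wi : right_inv W.
    by move=> x k Kk; apply: eq_bigr => w _; rewrite fixset_right_inv.
  have Wpos x : 0 <= W x.
    have := ltW (c_fix x); rewrite -oppr_ge0 -sumrN -(pmulr_lge0 _ (_ : 0 < W0^-1)) ?invr_gt0//.
    rewrite mulr_suml => /le_trans; apply; apply: eq_ler; apply: eq_bigr => w _.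
    by rewrite /al /fixset /subgroup_ind; ring.
  have := ip_mulfun_ge0 xi Wi Wpos.
  have -> : mulfun W xi = \sum_(w <- c) (((al w)%:C)%C : C) *: (mulfun (fixset w.2) xi - ((3 / 4)%:C)%C *: xi).
    apply: galg_eq => F; rewrite galg_sumE mulfunE.
    under eq_bigr do rewrite galg_scaleE galg_addE galg_oppE galg_scaleE mulfunE -galgZ -mulN1r -galgZ -galgD -galgZ.
    rewrite -galg_sum; congr (galg_val xi _); apply/funext => x.
    rewrite /W rmorph_sum mulr_suml; apply: eq_bigr => w _.
    by rewrite rmorphM rmorphD rmorphN /=; ring.
  rewrite ip_suml => h.
  have h2 : \sum_(w <- c) al w * (2 * ip ind (mulfun (fixset w.2) xi) xi - ip ind xi xi) <=
      \sum_(w <- c) al w * ip ind (dl R w.2 * xi) xi.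
    by apply: sum_le => w w0 _; apply: ler_wpM2l; [exact: al_ge0|exact: ip_dl_fixed_part].
  apply: le_trans h2.
  have e1 : \sum_(w <- c) ip ind ((((al w)%:C)%C : C) *: (mulfun (fixset w.2) xi - ((3 / 4)%:C)%C *: xi)) xi =
    \sum_(w <- c) al w * ip ind (mulfun (fixset w.2) xi) xi - 3 / 4 * ip ind xi xi.
    under eq_bigr do rewrite ipZl ipDl ipNl ipZl mulrBr.
    by rewrite sumrB -mulr_suml al_sum mul1r.
  have e2 : \sum_(w <- c) al w * (2 * ip ind (mulfun (fixset w.2) xi) xi - ip ind xi xi) =
    2 * \sum_(w <- c) al w * ip ind (mulfun (fixset w.2) xi) xi - ip ind xi xi.
    under eq_bigr do rewrite mulrBr.
    rewrite sumrB -mulr_suml al_sum mul1r mulr_sumr; congr (_ - _).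
    by apply: eq_bigr => w _; ring.
  by rewrite e1 in h; rewrite e2; lra.
rewrite ip_shifted (_ : ip ind (avgV * xi) xi = ip ind (avg * xi) xi); first lra.
by rewrite (ip_avg_adj isym) (ipC isym).
Qed.

Lemma shifted_trace : ip (@delta1 R G) shifted 1 = - (1 / 8).
Proof.
have e t : ip (@delta1 R G) (dl R t * 1) 1 = delta1 R t.
  by rewrite mulr1 /ip /hip dlE galg_oneE conjc_real !grpE.
have h1 : ip (@delta1 R G) (avg * 1) 1 = 0.
  rewrite ip_avg; rewrite (sum_eq (H := fun=> 0)); first by rewrite big1.
  by move=> w _ w1; rewrite e /delta1; case: eqP w1 => //; rewrite mulr0.
have h2 : ip (@delta1 R G) (avgV * 1) 1 = 0.
  rewrite ip_avgV; rewrite (sum_eq (H := fun=> 0)); first by rewrite big1.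
  by move=> w _ w1; rewrite e delta1_sym /delta1; case: eqP w1 => //; rewrite mulr0.
rewrite -[shifted]mulr1 ip_shifted h1 h2.
have := e (gone G); rewrite -[dl R (gone G)]/(1 : A) mulr1 /delta1 eqxx => -> /=; lra.
Qed.

End Coercive.

(** * Iterative square root in the group algebra *)

Section SquareRoot.
Variables (R : realType) (G : group).
Local Notation C := R[i].
Local Notation A := (galg R G).
Local Notation half := (((1 / 2 : R)%:C)%C : C).
Variable u : A.

(* [1 - sqrt_iter n] converges to [|u|], the square root of [u * u]; [sqrt_num]
   is the same iteration on norms. *)
Fixpoint sqrt_iter n : A :=
  if n is n'.+1 then half *: ((1 - u * u) + sqrt_iter n' * sqrt_iter n') else 0.

Fixpoint sqrt_num n : R := if n is n'.+1 then 1 / 2 * (1 + sqrt_num n' * sqrt_num n') else 0.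

Lemma sqrt_num_bounds n : 0 <= sqrt_num n <= 1.
Proof.
elim: n => [|n /andP[h1 h2]] /=; first by rewrite lexx ler01.
have h3 : sqrt_num n * sqrt_num n <= 1 by rewrite mulr_ile1.
have h4 : 0 <= sqrt_num n * sqrt_num n by rewrite mulr_ge0.
by apply/andP; split; lra.
Qed.

Lemma sqrt_num_incr n : sqrt_num n <= sqrt_num n.+1.
Proof.
rewrite /= -subr_ge0 (_ : _ - _ = 1 / 2 * (1 - sqrt_num n) ^+ 2); first by rewrite mulr_ge0 ?sqr_ge0//; lra.
by field.
Qed.

Lemma sqrt_num_mono n m : (n <= m)%N -> sqrt_num n <= sqrt_num m.
Proof.
move=> nm; rewrite -(subnK nm); elim: (m - n)%N => [//|k IHk].
by apply: le_trans IHk _; exact: sqrt_num_incr.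
Qed.

Lemma sqrt_num_cauchy (e : R) : 0 < e -> exists n, forall m, (n <= m)%N ->
  sqrt_num m - sqrt_num n <= e.
Proof.
move=> e0; pose S := [set sqrt_num n | n in [set: nat]].
have hS : has_sup S.
  split; first by exists (sqrt_num 0), 0%N.
  by exists 1 => _ [n _ <-]; have /andP[] := sqrt_num_bounds n.
have [_ [n _ <-] lt] := sup_adherent e0 hS.
exists n => m nm; have : sqrt_num m <= sup S by apply: ub_le_sup; [exact: hS.2|exists m].
by lra.
Qed.

Lemma sqrt_iter_comm n : sqrt_iter n * u = u * sqrt_iter n.
Proof.
elim: n => [|n IHn] /=; first by rewrite mul0r mulr0.
rewrite -scalerAl -scalerAr; congr (_ *: _).
rewrite mulrDl mulrDr mulrBl mulrBr mul1r mulr1 -!mulrA; congr (_ + _).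
by rewrite IHn mulrA IHn mulrA.
Qed.

(** A difference of squares, as the iterate commutes with [u]; by the recursion, [(1 - z)^2 - u^2]
    is twice the next increment. *)
Lemma sqrt_iter_factor n : (1 - sqrt_iter n + u) * (1 - sqrt_iter n - u) =
  (((2 : R)%:C)%C : C) *: (sqrt_iter n.+1 - sqrt_iter n).
Proof.
set z := sqrt_iter n; have zu : z * u = u * z := sqrt_iter_comm n.
have -> : (((2 : R)%:C)%C : C) *: (sqrt_iter n.+1 - z) = (1 - u * u + z * z) - z - z.
  rewrite /= -/z scalerBr scalerA -rmorphM (_ : 2 * (1 / 2) = 1 :> R); last by field.
  rewrite scale1r -[RHS]addrA; congr (_ + _).
  rewrite (_ : ((2 : R)%:C)%C = 1 + 1 :> C); last by rewrite -[in RHS](rmorph1 (real_complex R)) -rmorphD.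
  by rewrite scalerDl scale1r opprD.
have -> : (1 - z + u) * (1 - z - u) = (1 - z) * (1 - z) - u * u.
  rewrite mulrDl [X in X + _ = _]mulrBr [X in _ + X = _]mulrBr; have -> : u * (1 - z) = (1 - z) * u by rewrite mulrBr mulrBl zu mul1r mulr1.
  by rewrite addrA subrK.
rewrite mulrBl mul1r mulrBr mulr1 opprB !addrA.
by rewrite [LHS]addrAC [1 - z + z * z - u * u]addrAC [1 - z - u * u]addrAC [1 - u * u - z + z * z]addrAC.
Qed.

Section Bounds.
Variable phi : G -> R.
Hypotheses (phi_sym : forall x, phi (ginv x) = phi x) (phi_psd : forall a, 0 <= ip phi a a).
Hypotheses (u_selfadj : selfadj phi u) (u_bd : bd phi u 1).

Let half_csq : csq half <= (1 / 2) ^+ 2. Proof. by rewrite csq_real. Qed.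
Let half_ge0 : 0 <= 1 / 2 :> R. Proof. by lra. Qed.

Lemma sqrt_iter_bd n : bd phi (sqrt_iter n) (sqrt_num n).
Proof.
elim: n => [|n IHn] /=; first exact: bd0.
apply: bdZ => //; apply: bdD => //; last exact: bdM.
exact: bd_one_sub_sqr.
Qed.

(** The increments obey the same recursion as their scalar counterparts. A bounded monotone scalar
    sequence thus controls convergence, with no rate needed. *)
Lemma sqrt_iter_step_bd n : bd phi (sqrt_iter n.+1 - sqrt_iter n) (sqrt_num n.+1 - sqrt_num n).
Proof.
elim: n => [|n IHn]; first by rewrite !subr0; exact: (sqrt_iter_bd 1).
set z := sqrt_iter n; set z' := sqrt_iter n.+1.
have -> : sqrt_iter n.+2 - z' = half *: (z' * (z' - z) + (z' - z) * z).
  rewrite mulrBr mulrBl addrA subrK -[in LHS]/(half *: (1 - u * u + z' * z')).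
  rewrite {2}/z' /= -/z -scalerBr; congr (_ *: _).
  by rewrite opprD addrACA subrr add0r.
have -> : sqrt_num n.+2 - sqrt_num n.+1 = 1 / 2 * (sqrt_num n.+1 * (sqrt_num n.+1 - sqrt_num n) +
   (sqrt_num n.+1 - sqrt_num n) * sqrt_num n) by rewrite /=; field.
apply: bdZ => //; apply: bdD => //; apply: bdM => //; exact: sqrt_iter_bd.
Qed.

Lemma sqrt_iter_sub_bd n m : (n <= m)%N ->
  bd phi (sqrt_iter m - sqrt_iter n) (sqrt_num m - sqrt_num n).
Proof.
move=> nm; rewrite -(subnK nm); elim: (m - n)%N => [|k IHk].
  by rewrite add0n !subrr; exact: bd0.
have := bdD phi_sym phi_psd (sqrt_iter_step_bd (k + n)) IHk.
by rewrite addrA subrK addrA subrK.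
Qed.

Lemma one_sub_sqrt_iter_pos n xi : 0 <= ip phi ((1 - sqrt_iter n) * xi) xi.
Proof.
rewrite mulrBl mul1r ipDl ipNl subr_ge0; apply: bd_contraction_ip => //.
by apply: bd_le (sqrt_iter_bd n) _ => //; have /andP[] := sqrt_num_bounds n.
Qed.

(** With [u >= d] and [1 - z >= 0] the factor [1 - z + u] is bounded below by [d], so the other
    factor is at most [1 / d] times the product, which is a small increment. *)
Lemma sqrt_iter_coercive (d : R) n : 0 < d ->
  (forall xi, d * ip phi xi xi <= ip phi (u * xi) xi) ->
  bd phi (1 - sqrt_iter n - u) (2 / d * (sqrt_num n.+1 - sqrt_num n)).
Proof.
move=> d0 hd; have s0 : 0 <= sqrt_num n.+1 - sqrt_num n by rewrite subr_ge0 sqrt_num_incr.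
split; first by rewrite mulr_ge0// divr_ge0// ltW.
move=> xi; set v := 1 - sqrt_iter n - u.
have h1 : d * ip phi (v * xi) (v * xi) <= ip phi ((1 - sqrt_iter n + u) * (v * xi)) (v * xi).
  rewrite [(1 - sqrt_iter n + u) * _]mulrDl [leRHS]ipDl.
  by have := one_sub_sqrt_iter_pos n (v * xi); have := hd (v * xi); lra.
have := coercive_lower phi_sym phi_psd (ltW d0) h1.
rewrite mulrA sqrt_iter_factor => h2.
have b2 : bd phi ((((2 : R)%:C)%C : C) *: (sqrt_iter n.+1 - sqrt_iter n)) (2 * (sqrt_num n.+1 - sqrt_num n)).
  by apply: bdZ => //; [rewrite csq_real|exact: sqrt_iter_step_bd].
have h3 := le_trans h2 (b2.2 xi).
rewrite -(ler_pM2l (_ : 0 < d ^+ 2)) ?exprn_gt0//; apply: le_trans h3 _.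
by apply: eq_ler; field; rewrite gt_eqF.
Qed.

End Bounds.
End SquareRoot.

(* A sequence converging in the reduced C*-algebra to a nonzero element that the
   quasi-regular representation on [l^2(G/K)] kills: with [u] coercive there but
   of negative trace, take the limit of [|u| - u]. *)
Lemma kernel_sequence (R : realType) (G : group) (K : set G) (c : seq (R * G)) :
  is_subgroup K -> has_inv_mean R K ->
  List.Forall (fun w => 0 <= w.1 /\ w.2 <> gone G) c ->
  (forall g, \sum_(w <- c) w.1 * (3 / 4 - `[< K (ginv g ** w.2 ** g) >]%:R) < 0) ->
  exists v : nat -> galg R G, [/\
    forall e, 0 < e -> exists n, forall m, (n <= m)%N -> bd (@delta1 R G) (v m - v n) e,
    forall e, 0 < e -> exists n, forall m, (n <= m)%N -> bd (subgroup_ind R K) (v m) e &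
    forall n, 1 / 8 <= ip (@delta1 R G) (v n) 1].
Proof.
move=> Ks Km c1 c2; pose u := shifted c.
have dsym := @delta1_sym R G; have dpsd := @delta1_psd R G.
have isym := ind_sym R Ks; have ipsd := ind_psd Ks Km.
have ud : selfadj (@delta1 R G) u by exact: shifted_selfadj.
have ui : selfadj (subgroup_ind R K) u by exact: shifted_selfadj.
have bud : bd (@delta1 R G) u 1 by exact: (shifted_bd c1 c2).
have bui : bd (subgroup_ind R K) u 1 by exact: (shifted_bd c1 c2).
exists (fun n => 1 - sqrt_iter u n - u); split.
- move=> e e0; have [n hn] := sqrt_num_cauchy e0; exists n => m nm.
  have -> : 1 - sqrt_iter u m - u - (1 - sqrt_iter u n - u) = - (sqrt_iter u m - sqrt_iter u n).
    by rewrite [1 - _ - _]addrAC [1 - sqrt_iter u n - _]addrAC [RHS]opprB opprB [LHS]addrC addrA subrK.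
  apply: bdN => //; apply: bd_le (hn m nm) => //; exact: sqrt_iter_sub_bd.
(* The factor 16 is [2 / d] for the coercivity constant [d = 1 / 8]. *)
- move=> e e0; have e16 : 0 < e / 16 by rewrite divr_gt0.
  have [n hn] := sqrt_num_cauchy e16; exists n => m nm.
  have d0 : 0 < 1 / 8 :> R by lra.
  have := sqrt_iter_coercive isym ipsd ui bui m d0 (shifted_coercive Ks Km c1 c2).
  move=> /(bd_le ipsd); apply.
  have := hn m.+1 (leqW nm); have := sqrt_num_mono R nm; lra.
- move=> n; rewrite ipDl ipNl (shifted_trace c1).
  have := one_sub_sqrt_iter_pos dsym dpsd ud bud n 1; rewrite mulr1; lra.
Qed.

(** * Operators on l^2(G) *)

Lemma In_mem (T : eqType) (x : T) (s : seq T) : List.In x s <-> x \in s.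
Proof.
elim: s => [//|y s IHs] /=; rewrite inE; split.
  by move=> [->|/IHs ->]; rewrite ?eqxx ?orbT.
by move=> /orP[/eqP ->|/IHs]; [left|right].
Qed.

Lemma NoDup_uniq (T : eqType) (s : seq T) : List.NoDup s <-> uniq s.
Proof.
elim: s => [|x s IHs] /=; first by split=> // _; exact: List.NoDup_nil.
split=> [/List.NoDup_cons_iff[xs /IHs ->]|/andP[xs /IHs us]].
  by rewrite andbT; apply/negP => /In_mem.
by apply/List.NoDup_cons_iff; split=> // /In_mem; apply/negP.
Qed.

Section L2.
Variables (R : realType) (G : group).
Local Notation C := R[i].
Local Notation A := (galg R G).
Implicit Types (f h : G -> C) (T S : op G R) (a b xi : A).

(** Finite sums express membership in [l2] and the bound on [l2norm] together, avoiding suprema. *)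
Definition nb f (M : R) := 0 <= M /\ forall s : seq G, uniq s -> \sum_(g <- s) csq (f g) <= M ^+ 2.

Lemma nb_l2 f M : nb f M -> l2 f /\ l2norm f <= M.
Proof.
move=> [M0 fM]; have ub : ubound (sqsums f) (M ^+ 2).
  by move=> _ [s [/NoDup_uniq us ->]]; exact: fM.
split; first by exists (M ^+ 2).
rewrite /l2norm -[leRHS]ger0_norm// -sqrtr_sqr ler_wsqrtr//; apply: ge_sup => //.
by exists 0, [::]; split; [exact: List.NoDup_nil|rewrite big_nil].
Qed.

Lemma l2_nb f : l2 f -> nb f (l2norm f).
Proof.
move=> f2; have h s : uniq s -> \sum_(g <- s) csq (f g) <= sup (sqsums f).
  by move=> us; apply: ub_le_sup => //; exists s; split=> //; apply/NoDup_uniq.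
split; first exact: sqrtr_ge0.
move=> s us; rewrite sqr_sqrtr; first exact: h.
by have := h [::] isT; rewrite big_nil.
Qed.

Lemma l2norm_ge0 f : 0 <= l2norm f. Proof. exact: sqrtr_ge0. Qed.

Lemma nb_le f (M N : R) : M <= N -> nb f M -> nb f N.
Proof.
move=> MN [M0 fM]; have N0 := le_trans M0 MN; split=> // s us.
by apply: le_trans (fM s us) _; rewrite ler_sqr ?nnegrE.
Qed.

Lemma nb_closure f M : (forall e, 0 < e -> nb f (M + e)) -> nb f M.
Proof.
move=> h; have M0 : 0 <= M by apply/ler_addgt0Pr => e /h[].
split=> // s us; apply/ler_addgt0Pr => e e0.
pose d := Num.min 1 (e / (2 * M + 1)).
have P0 : 0 < 2 * M + 1 by lra.
have d0 : 0 < d by rewrite lt_min ltr01 divr_gt0.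
have d1 : d <= 1 by rewrite ge_min lexx.
have de : d * (2 * M + 1) <= e by rewrite -ler_pdivlMr// ge_min lexx orbT.
have dd : d * d <= d by rewrite ler_piMr// ltW.
apply: le_trans ((h d d0).2 s us) _; lra.
Qed.

Lemma nbD f h (M N : R) : nb f M -> nb h N -> nb (fun x => f x + h x) (M + N).
Proof.
move=> fM hN; apply: nb_closure => e e0.
have M0 : 0 < M + e / 2 by have := fM.1; lra.
have N0 : 0 < N + e / 2 by have := hN.1; lra.
have {}fM : nb f (M + e / 2) by apply: nb_le fM; lra.
have {}hN : nb h (N + e / 2) by apply: nb_le hN; lra.
rewrite (_ : M + N + e = (M + e / 2) + (N + e / 2)); last by field.
move: (M + e / 2) (N + e / 2) M0 N0 fM hN => {}M {}N M0 N0 [_ fM] [_ hN].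
split=> [|s us]; first by lra.
have MN0 : 0 < M * N by exact: mulr_gt0.
have h1 := fM s us; have h2 := hN s us.
rewrite -(ler_pM2l MN0).
(* The convexity inequality [|x + y|^2 <= (M + N) (|x|^2 / M + |y|^2 / N)] cleared of denominators;
   positive [M] and [N] were arranged through [nb_closure]. *)
apply: (@le_trans _ _ ((M + N) * (N * (\sum_(g <- s) csq (f g)) + M * (\sum_(g <- s) csq (h g))))).
  rewrite !mulr_sumr -big_split mulr_sumr; apply: ler_sum => g _ /=.
  case: (f g) (h g) => [x y] [x' y']; rewrite /csq /= -subr_ge0.
  rewrite (_ : _ - _ = (N * x - M * x') ^+ 2 + (N * y - M * y') ^+ 2); first by rewrite addr_ge0 ?sqr_ge0.
  by ring.
rewrite (_ : M * N * (M + N) ^+ 2 = (M + N) * (N * M ^+ 2 + M * N ^+ 2)); last by ring.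
by rewrite ler_pM2l ?addr_gt0// lerD// ler_pM2l.
Qed.

Lemma nbZ z f (r M : R) : 0 <= r -> csq z <= r ^+ 2 -> nb f M -> nb (fun x => z * f x) (r * M).
Proof.
move=> r0 zr [M0 fM]; split; first exact: mulr_ge0.
move=> s us; under eq_bigr do rewrite csqM.
by rewrite -mulr_sumr exprMn ler_pM ?csq_ge0 ?fM// sumr_ge0// => g _; exact: csq_ge0.
Qed.

Lemma nb0 : nb (fun=> 0) 0.
Proof. by split=> // s _; rewrite expr0n big1// => g _; rewrite csq0. Qed.

Lemma l20 : l2 (fun _ : G => 0 : C). Proof. exact: (nb_l2 nb0).1. Qed.

Lemma l2norm0 : l2norm (fun _ : G => 0 : C) = 0.
Proof. by apply/eqP; rewrite eq_le l2norm_ge0 andbT; exact: (nb_l2 nb0).2. Qed.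

Definition lin_op T := forall z f h, l2 f -> l2 h ->
  T (fun x => z * f x + h x) = (fun x => z * T f x + T h x).

Definition ob T (M : R) := 0 <= M /\ forall f, l2 f -> nb (T f) (M * l2norm f).

Lemma lin_op0 T : lin_op T -> T (fun=> 0) = fun=> 0.
Proof.
move=> TL; have := TL 1 _ _ l20 l20.
have -> : (fun x : G => 1 * 0 + 0 : C) = fun=> 0 by apply/funext => x; rewrite mul1r addr0.
move=> e; apply/funext => x; have /(congr1 (fun F => F x)) := e.
by rewrite mul1r => /eqP; rewrite -subr_eq0 opprD addrA subrr sub0r oppr_eq0 => /eqP.
Qed.

Lemma lin_opZ T z f : lin_op T -> l2 f -> T (fun x => z * f x) = (fun x => z * T f x).
Proof.
move=> TL f2; have := TL z _ _ f2 l20; rewrite (lin_op0 TL).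
under eq_fun do rewrite addr0.
by move=> ->; apply/funext => x; rewrite addr0.
Qed.

Lemma bounded_opP T : bounded_op T <-> lin_op T /\ exists M, ob T M.
Proof.
split=> [[T2 [TL [M TM]]]|[TL [M [M0 TM]]]].
  split=> //; exists `|M|; split=> // f f2.
  apply: nb_le (l2_nb (T2 f f2)); apply: le_trans (TM f f2) _.
  by apply: ler_wpM2r; [exact: l2norm_ge0|exact: ler_norm].
split; [|split=> //]; first by move=> f /TM/nb_l2[].
by exists M => f /TM/nb_l2[].
Qed.

Lemma opnorm_le T M : ob T M -> opnorm T <= M.
Proof.
move=> [M0 TM]; apply: ge_sup.
  exists (l2norm (T (fun=> 0))), (fun=> 0); split; first exact: l20.
  by rewrite l2norm0.
move=> _ [f [f2 [f1 ->]]]; apply: le_trans (nb_l2 (TM f f2)).2 _.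
by rewrite -[leRHS]mulr1 ler_wpM2l.
Qed.

Lemma opnorm_ob T : bounded_op T -> ob T (opnorm T).
Proof.
move=> Tb; have [TL [M [M0 TM]]] := (bounded_opP T).1 Tb; have T2 := Tb.1.
pose S := [set r | exists f, l2 f /\ l2norm f <= 1 /\ r = l2norm (T f)].
have leS f : l2 f -> l2norm f <= 1 -> l2norm (T f) <= opnorm T.
  move=> f2 f1; apply: ub_le_sup; last by exists f.
  exists M => _ [h [h2 [h1 ->]]]; apply: le_trans (nb_l2 (TM h h2)).2 _.
  by rewrite -[leRHS]mulr1 ler_wpM2l.
have o0 : 0 <= opnorm T.
  by apply: le_trans (l2norm_ge0 _) (leS _ l20 _); rewrite l2norm0.
split=> // f f2; have := l2norm_ge0 f; rewrite le_eqVlt => /orP[/eqP n0|n0].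
  by have := TM f f2; rewrite -n0 !mulr0.
set n := l2norm f in n0 *.
have h1 : nb (fun x => ((n^-1)%:C)%C * f x) (n^-1 * n).
  by apply: nbZ (l2_nb f2); [rewrite invr_ge0 ltW|rewrite csq_real].
rewrite mulVf ?gt_eqF// in h1.
have [g2 g1] := nb_l2 h1.
have -> : f = (fun x => (n%:C)%C * (((n^-1)%:C)%C * f x)).
  by apply/funext => x; rewrite mulrA -rmorphM mulfV ?gt_eqF// mul1r.
rewrite (lin_opZ _ TL g2) mulrC; apply: nbZ; [exact: ltW|by rewrite csq_real|].
exact: nb_le (leS _ g2 g1) (l2_nb (T2 _ g2)).
Qed.

Lemma ob_le T M N : M <= N -> ob T M -> ob T N.
Proof.
move=> MN [M0 TM]; split; first exact: le_trans MN.
by move=> f f2; apply: nb_le (TM f f2); rewrite ler_wpM2r// l2norm_ge0.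
Qed.

Lemma obD T S M N : ob T M -> ob S N -> ob (fun f x => T f x + S f x) (M + N).
Proof.
move=> [M0 TM] [N0 SN]; split; first exact: addr_ge0.
by move=> f f2; rewrite mulrDl; apply: nbD; [exact: TM|exact: SN].
Qed.

Lemma obZ z T (r M : R) : 0 <= r -> csq z <= r ^+ 2 -> ob T M -> ob (fun f x => z * T f x) (r * M).
Proof.
move=> r0 zr [M0 TM]; split; first exact: mulr_ge0.
by move=> f f2; rewrite -mulrA; apply: nbZ => //; exact: TM.
Qed.

Lemma ob_comp T S M N : ob T M -> ob S N -> ob (fun f => T (S f)) (M * N).
Proof.
move=> [M0 TM] [N0 SN]; split; first exact: mulr_ge0.
move=> f f2; have [Sf2 Sfn] := nb_l2 (SN f f2).
by apply: nb_le (TM _ Sf2); rewrite -mulrA ler_wpM2l.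
Qed.

Lemma obB T S M N : ob T M -> ob S N -> ob (opsub T S) (M + N).
Proof.
move=> TM SN; have := obD TM (obZ (z := -1) (r := 1) ler01 _ SN).
rewrite csqN csq1 expr1n mul1r => /(_ (lexx _)).
by congr ob; apply/funext => f; apply/funext => x; rewrite mulN1r.
Qed.

Lemma bounded_op_l2 T f : bounded_op T -> l2 f -> l2 (T f).
Proof. by move=> [T2 _]; exact: T2. Qed.

Lemma bounded_opD T S : bounded_op T -> bounded_op S -> bounded_op (fun f x => T f x + S f x).
Proof.
move=> /bounded_opP[TL [M TM]] /bounded_opP[SL [N SN]]; apply/bounded_opP; split.
  by move=> z f h f2 h2; rewrite TL// SL//; apply/funext => x; ring.
by exists (M + N); exact: obD.
Qed.

Lemma bounded_opZ z T : bounded_op T -> bounded_op (fun f x => z * T f x).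
Proof.
move=> /bounded_opP[TL [M TM]]; apply/bounded_opP; split.
  by move=> w f h f2 h2; rewrite TL//; apply/funext => x; ring.
by exists (Num.sqrt (csq z) * M); apply: obZ => //; [exact: sqrtr_ge0|rewrite sqr_sqrtr ?csq_ge0].
Qed.

Lemma bounded_opB T S : bounded_op T -> bounded_op S -> bounded_op (opsub T S).
Proof.
move=> Tb Sb; have := bounded_opD Tb (bounded_opZ (-1) Sb).
by congr bounded_op; apply/funext => f; apply/funext => x; rewrite mulN1r.
Qed.

Lemma bounded_op_comp T S : bounded_op T -> bounded_op S -> bounded_op (fun f => T (S f)).
Proof.
move=> Tb Sb; have /bounded_opP[TL [M TM]] := Tb; have /bounded_opP[SL [N SN]] := Sb.
apply/bounded_opP; split.
  by move=> z f h f2 h2; rewrite SL// TL//; exact: bounded_op_l2.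
by exists (M * N); exact: ob_comp.
Qed.

Definition lam a : op G R := fun f x => a (fun g => f (ginv g ** x)).

Lemma lincomb_lam s : lincomb s = lam (galg_of s).
Proof. by []. Qed.

Lemma lam_lin a : lin_op (lam a).
Proof. by move=> z f h _ _; apply/funext => x; rewrite /lam galgD galgZ. Qed.

Lemma lamD a b f x : lam (a + b) f x = lam a f x + lam b f x.
Proof. by []. Qed.

Lemma lamZ z a f x : lam (z *: a) f x = z * lam a f x.
Proof. by []. Qed.

Lemma lamB a b f x : lam (a - b) f x = lam a f x - lam b f x.
Proof. by rewrite /lam galg_addE galg_oppE. Qed.

Lemma lamM a b f : lam (a * b) f = lam a (lam b f).
Proof.
apply/funext => x; rewrite /lam galg_mulE; congr (galg_val a _); apply/funext => g.
by congr (galg_val b _); apply/funext => k; rewrite !grpE.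
Qed.

Lemma coefM a b : coef (a * b) = lam a (coef b).
Proof.
apply/funext => x; rewrite /coef galg_mulE /lam; congr (galg_val a _); apply/funext => g.
congr (galg_val b _); apply/funext => k; congr (_%:R); congr nat_of_bool.
by apply/eqP/eqP => [<-|->]; rewrite !grpE.
Qed.

Lemma coef_nb a : nb (coef a) (Num.sqrt (ip (@delta1 R G) a a)).
Proof.
split=> [|s us]; first exact: sqrtr_ge0.
rewrite sqr_sqrtr ?delta1_psd//; have [D [uD D0 ->]] := ip_delta1 a.
rewrite (bigID (mem D)) /= [X in _ + X]big1 ?addr0; last by move=> x /D0 ->; rewrite csq0.
rewrite [leRHS](bigID (mem s)) /= -[leLHS]addr0 lerD ?sumr_ge0//; last by move=> *; exact: csq_ge0.
rewrite -[leLHS]big_filter -[leRHS]big_filter; apply: eq_ler; apply: perm_big; apply: uniq_perm; rewrite ?filter_uniq// => x.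
by rewrite !mem_filter andbC.
Qed.

(** Finitely many output coordinates depend on [f] only through the finite set [B], so the bound for
    the truncation [xi] in the group algebra suffices. *)
Lemma lam_ob a M : bd (@delta1 R G) a M -> ob (lam a) M.
Proof.
move=> [M0 aM]; split=> // f f2; split; first by rewrite mulr_ge0 ?l2norm_ge0.
move=> s us; have [D [_ _ aD]] := galg_expand a.
pose B := undup [seq ginv g ** x | g <- D, x <- s].
pose xi : A := \sum_(y <- B) f y *: dl R y.
have cxi y : coef xi y = if y \in B then f y else 0.
  rewrite /coef galg_sumE; under eq_bigr do rewrite galg_scaleE dlE.
  case: ifP => yB.
    rewrite (bigD1_seq y) ?undup_uniq//= eqxx mulr1 big1 ?addr0// => z /negPf ->.
    by rewrite mulr0.
  rewrite big_seq big1// => z zB; case: eqP => [e|]; last by rewrite mulr0.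
  by rewrite -e zB in yB.
have -> : \sum_(g <- s) csq (lam a f g) = \sum_(g <- s) csq (coef (a * xi) g).
  rewrite big_seq [RHS]big_seq; apply: eq_bigr => x xs; congr csq.
  rewrite coefM /lam !aD big_seq [RHS]big_seq; apply: eq_bigr => g gD; congr (_ * _).
  rewrite cxi mem_undup ifT//; apply/allpairsP; exists (g, x); split=> //.
have [_ /(_ s us)] := coef_nb (a * xi); rewrite sqr_sqrtr ?delta1_psd// => /le_trans; apply.
apply: le_trans (aM xi) _; rewrite exprMn ler_wpM2l ?sqr_ge0//.
have [D' [uD' _ ->]] := ip_delta1 xi.
have -> : \sum_(x <- D') csq (coef xi x) = \sum_(x <- [seq x <- D' | x \in B]) csq (f x).
  rewrite big_filter [RHS]big_mkcond; apply: eq_bigr => x _; rewrite cxi.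
  by case: ifP; rewrite ?csq0.
by apply: (l2_nb f2).2; exact: filter_uniq.
Qed.

Lemma ob_lam a M : ob (lam a) M -> bd (@delta1 R G) a M.
Proof.
move=> [M0 aM]; split=> // xi.
have [D [uD _ ->]] := ip_delta1 (a * xi); rewrite coefM.
have [x2 xn] := nb_l2 (coef_nb xi).
apply: le_trans ((aM _ x2).2 D uD) _; rewrite exprMn ler_wpM2l ?sqr_ge0//.
by rewrite -[leRHS]sqr_sqrtr ?delta1_psd// ler_sqr ?nnegrE ?l2norm_ge0 ?sqrtr_ge0.
Qed.

Lemma galg_bd a : exists M, bd (@delta1 R G) a M.
Proof.
have [s ->] := galg_ofP a; rewrite galg_of_sum; elim: s => [|p s [M IH]].
  by exists 0; rewrite big_nil; exact: bd0.
exists (Num.sqrt (csq p.1) * 1 + M); rewrite big_cons; apply: bdD => //.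
- exact: delta1_sym.
- exact: delta1_psd.
- apply: bdZ => //; [exact: delta1_psd|exact: sqrtr_ge0|by rewrite sqr_sqrtr ?csq_ge0|exact: bd_dl].
Qed.

Lemma lam_bounded a : bounded_op (lam a).
Proof.
apply/bounded_opP; split; first exact: lam_lin.
by have [M aM] := galg_bd a; exists M; exact: lam_ob.
Qed.

Lemma CredP T : Cred T <-> bounded_op T /\
  forall e, 0 < e -> exists a, ob (opsub T (lam a)) e.
Proof.
split=> [[Tb h]|[Tb h]]; split=> // e e0.
  have [s hs] := h e e0; exists (galg_of s); apply: ob_le (ltW hs) _.
  by apply: opnorm_ob; apply: bounded_opB => //; exact: lam_bounded.
have e2 : 0 < e / 2 by lra.
have [a ha] := h _ e2; have [s es] := galg_ofP a; exists s.
rewrite lincomb_lam -es; apply: le_lt_trans (opnorm_le ha) _; lra.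
Qed.

End L2.

(** * A non-trivial closed ideal of the reduced C*-algebra *)

Section KernelIdeal.
Variables (R : realType) (G : group) (K : set G).
Hypothesis K_subgroup : is_subgroup K.
Hypothesis K_mean : has_inv_mean R K.
Local Notation C := R[i].
Local Notation A := (galg R G).
Local Notation ind := (@subgroup_ind R G K).
Implicit Types (T S : op G R) (a b : A).

Let isym := ind_sym R K_subgroup.
Let ipsd := ind_psd K_subgroup K_mean.

(* The kernel of the quasi-regular representation on [l^2(G/K)]. *)
Definition kernel_ideal : set (op G R) := [set T | bounded_op T /\
  forall e, 0 < e -> exists a, ob (opsub T (lam a)) e /\ bd ind a e].

Lemma kernel_ideal_Cred : kernel_ideal `<=` Cred (G := G) (R := R).
Proof.
move=> T [Tb h]; apply/CredP; split=> // e e0.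
by have [a [ha _]] := h e e0; exists a.
Qed.

Lemma kernel_ideal_mul T S : Cred T -> kernel_ideal S ->
  kernel_ideal (fun f => T (S f)) /\ kernel_ideal (fun f => S (T f)).
Proof.
move=> /CredP[Tb hT] [Sb hS].
have [tT sS] := (opnorm_ob Tb, opnorm_ob Sb).
set t := opnorm T in tT; set s := opnorm S in sS.
have [t0 s0] := (tT.1, sS.1).
suff key e : 0 < e -> exists a b, [/\ ob (opsub (fun f => T (S f)) (lam (a * b))) e,
    ob (opsub (fun f => S (T f)) (lam (b * a))) e, bd ind (a * b) e & bd ind (b * a) e].
  split; split; try exact: bounded_op_comp.
    by move=> e /key[a [b [h1 h2 h3 h4]]]; exists (a * b).
  by move=> e /key[a [b [h1 h2 h3 h4]]]; exists (b * a).
(* Small enough for the errors [t * d + d * (s + d)] and [s * d + d * (t + d)] and for the kernel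
   bound [(t + d) * d] to be at most [e]. *)
move=> e0; pose d := Num.min 1 (e / (t + s + 2)).
have P0 : 0 < t + s + 2 by lra.
have d0 : 0 < d by rewrite lt_min ltr01 divr_gt0.
have d1 : d <= 1 by rewrite ge_min lexx.
have de : d * (t + s + 2) <= e by rewrite -ler_pdivlMr// ge_min lexx orbT.
have dd : d * d <= d by rewrite ler_piMr// ltW.
have ds : 0 <= d * s by rewrite mulr_ge0// ltW.
have dt : 0 <= d * t by rewrite mulr_ge0// ltW.
have [a ha] := hT d d0; have [b [hb hbi]] := hS d d0.
have la : ob (lam a) (t + d).
  have := obB tT ha; congr ob; apply/funext => f; apply/funext => x; rewrite /opsub; ring.
have lb : ob (lam b) (s + d).
  have := obB sS hb; congr ob; apply/funext => f; apply/funext => x; rewrite /opsub; ring.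
(* Here amenability of [K] enters: an approximant of [T] is bounded in the quasi-regular form by its
   regular norm. *)
have ba : bd ind a (t + d) by apply: weak_containment => //; exact: ob_lam.
have TL := ((bounded_opP T).1 Tb).1; have SL := ((bounded_opP S).1 Sb).1.
have Tsub f h : l2 f -> l2 h -> T (fun x => f x - h x) = (fun x => T f x - T h x).
  move=> f2 h2; have := TL (-1) h f h2 f2.
  have -> : (fun x => -1 * h x + f x) = (fun x => f x - h x) by apply/funext => x; ring.
  by move=> ->; apply/funext => x; ring.
have Ssub f h : l2 f -> l2 h -> S (fun x => f x - h x) = (fun x => S f x - S h x).
  move=> f2 h2; have := SL (-1) h f h2 f2.
  have -> : (fun x => -1 * h x + f x) = (fun x => f x - h x) by apply/funext => x; ring.
  by move=> ->; apply/funext => x; ring.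
(* The decomposition [T S - a b = T (S - b) + (T - a) b], and its mirror image next. *)
have h1 : ob (fun f x => T (opsub S (lam b) f) x + opsub T (lam a) (lam b f) x) (t * d + d * (s + d)).
  by apply: obD; apply: ob_comp.
have h2 : ob (fun f x => S (opsub T (lam a) f) x + opsub S (lam b) (lam a f) x) (s * d + d * (t + d)).
  by apply: obD; apply: ob_comp.
exists a, b; split.
- apply: (@ob_le _ _ _ (t * d + d * (s + d))); first by lra.
  split=> [|f f2]; first exact: h1.1.
  have := h1.2 f f2; congr nb; apply/funext => x.
  have b2 : l2 (lam b f) by exact: bounded_op_l2 (lam_bounded b) f2.
  have S2 : l2 (S f) by exact: bounded_op_l2.
  by rewrite /opsub Tsub// lamM; ring.
- apply: (@ob_le _ _ _ (s * d + d * (t + d))); first by lra.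
  split=> [|f f2]; first exact: h2.1.
  have := h2.2 f f2; congr nb; apply/funext => x.
  have a2 : l2 (lam a f) by exact: bounded_op_l2 (lam_bounded a) f2.
  have T2 : l2 (T f) by exact: bounded_op_l2.
  by rewrite /opsub Ssub// lamM; ring.
- by apply: (bd_le ipsd (bdM ba hbi)); lra.
- by apply: (bd_le ipsd (bdM hbi ba)); lra.
Qed.

Lemma kernel_ideal_closed : closed_ideal kernel_ideal.
Proof.
split; first exact: kernel_ideal_Cred.
split; [|split; [|split; [|split]]].
- split.
    apply/bounded_opP; split; last by exists 0; split=> // f f2; rewrite mul0r; exact: nb0.
    by move=> z f h _ _; apply/funext => x; rewrite mulr0 addr0.
  move=> e e0; exists 0; split; last by apply: (bd_le ipsd (bd0 ind)); exact: ltW.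
  split=> [|f f2]; first exact: ltW.
  apply: (@nb_le _ _ _ 0); first by rewrite mulr_ge0 ?l2norm_ge0// ltW.
  by have := @nb0 R G; congr nb; apply/funext => x; rewrite /opsub subr0.
- move=> T S [Tb hT] [Sb hS]; split; first exact: bounded_opD.
  move=> e e0; have e2 : 0 < e / 2 by lra.
  have [a [ha ai]] := hT _ e2; have [b [hb bi]] := hS _ e2.
  exists (a + b); rewrite [e]splitr; split; last exact: bdD.
  have := obD ha hb; congr ob; apply/funext => f; apply/funext => x.
  by rewrite /opsub lamD; ring.
- move=> z T [Tb hT]; split; first exact: bounded_opZ.
  move=> e e0; pose r := Num.sqrt (csq z) + 1.
  have r0 : 0 < r by rewrite ltr_wpDl ?sqrtr_ge0.
  have zr : csq z <= r ^+ 2.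
    rewrite -[csq z]sqr_sqrtr ?csq_ge0// ler_sqr ?nnegrE ?sqrtr_ge0 ?(ltW r0)//.
    by rewrite lerDl.
  have [a [ha ai]] := hT _ (divr_gt0 e0 r0).
  have re : r * (e / r) = e by rewrite mulrC divfK// gt_eqF.
  exists (z *: a); rewrite -re; split; last by apply: bdZ => //; exact: ltW.
  have := obZ (ltW r0) zr ha; congr ob; apply/funext => f; apply/funext => x.
  by rewrite /opsub lamZ mulrBr.
- exact: kernel_ideal_mul.
- move=> T /CredP[Tb _] hT; split=> // e e0; have e2 : 0 < e / 2 by lra.
  have [S [[Sb hS] TS]] := hT _ e2; have [a [ha ai]] := hS _ e2.
  exists a; split; last by apply: (bd_le ipsd ai); lra.
  have h1 : ob (opsub T S) (e / 2).
    by apply: ob_le (ltW TS) _; apply: opnorm_ob; exact: bounded_opB.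
  rewrite [e]splitr; have := obD h1 ha; congr ob; apply/funext => f; apply/funext => x.
  by rewrite /opsub; ring.
Qed.

(** If the identity belonged to the kernel, weak containment would bound its quasi-regular norm by
    [1 / 4 + 1 / 4], yet [ind] is 1 at the identity. *)
Lemma kernel_ideal_proper : ~ (Cred (G := G) (R := R) `<=` kernel_ideal).
Proof.
move=> sub; have : kernel_ideal (lam 1).
  apply: sub; apply/CredP; split; first exact: lam_bounded.
  move=> e e0; exists 1; split=> [|f f2]; first exact: ltW.
  apply: (@nb_le _ _ _ 0); first by rewrite mulr_ge0 ?l2norm_ge0// ltW.
  by have := @nb0 R G; congr nb; apply/funext => x; rewrite /opsub subrr.
have q0 : 0 < 1 / 4 :> R by lra.
move=> [_ /(_ _ q0)[a [ha ai]]].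
have h1 : bd (@delta1 R G) (1 - a) (1 / 4).
  apply: ob_lam; have := ha; congr ob; apply/funext => f; apply/funext => x.
  by rewrite lamB.
have h2 := weak_containment K_subgroup K_mean h1.
have := bdD isym ipsd h2 ai; rewrite subrK => -[_ /(_ 1)].
rewrite mulr1; have -> : ip ind 1 1 = 1.
  rewrite /ip /hip !galg_oneE conjc_real /= !grpE /subgroup_ind asboolT//; exact: K_subgroup.1.
lra.
Qed.

Variable v : nat -> A.
Hypothesis v_cauchy : forall e, 0 < e -> exists n, forall m, (n <= m)%N ->
  bd (@delta1 R G) (v m - v n) e.
Hypothesis v_kernel : forall e, 0 < e -> exists n, forall m, (n <= m)%N -> bd ind (v m) e.
Hypothesis v_trace : forall n, 1 / 8 <= ip (@delta1 R G) (v n) 1.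

Lemma delta_nb : nb (fun x : G => (x == gone G)%:R : C) 1.
Proof.
split=> // s us; rewrite expr1n; have [e|e] := boolP (gone G \in s); last first.
  rewrite big_seq big1// => x xs; case: eqP => [ex|]; last by rewrite csq0.
  by rewrite -ex xs in e.
rewrite (bigD1_seq (gone G))//= eqxx csq1 big1 ?addr0// => x /negPf ->.
by rewrite csq0.
Qed.

(** The limit [T] of the operators [lam (v n)] lies in the kernel ideal, and its entry at the
    identity has real part at least 1/8; so this proper ideal contains an operator of non-zero
    norm. *)
Lemma not_Cstar_simple : ~ Cstar_simple G R.
Proof.
move=> simple.
have [n0 hn0] := v_cauchy ltr01.
have [M0 vM0] := galg_bd (v n0).
(* Discarding the first [n0] terms gives a uniform norm bound, which makes every entry a bounded
   sequence. *)
pose w n := v (n + n0).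
have wM n : ob (lam (w n)) (1 + M0).
  apply: lam_ob; have := bdD (@delta1_sym R G) (@delta1_psd R G) (hn0 (n + n0)%N (leq_addl _ _)) vM0.
  by rewrite subrK.
have [U [UU Un]] := nat_ultra.
have Uall (P : nat -> Prop) n : (forall m, (n <= m)%N -> P m) -> U [set m | P m].
  by move=> h; apply: filterS (Un n).
pose re f x n := complex.Re (lam (w n) f x).
pose im f x n := complex.Im (lam (w n) f x).
pose T : op G R := fun f x => Complex (ulim U (re f x)) (ulim U (im f x)).
have wbd f x n : l2 f -> csq (lam (w n) f x) <= ((1 + M0) * l2norm f) ^+ 2.
  by move=> f2; have := ((wM n).2 f f2).2 [:: x] isT; rewrite big_seq1.
have ab f x n : l2 f -> `|re f x n| <= (1 + M0) * l2norm f /\ `|im f x n| <= (1 + M0) * l2norm f.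
  move=> f2; have B0 : 0 <= (1 + M0) * l2norm f by exact: ((wM n).2 f f2).1.
  have := wbd f x n f2; rewrite /re /im; case: (lam (w n) f x) => a b /=.
  rewrite /csq => h; have := sqr_ge0 a; have := sqr_ge0 b => hb ha.
  by split; rewrite -ler_sqr ?nnegrE// real_normK ?num_real//; lra.
have reb f x : l2 f -> bdd (re f x) by move=> f2; exists ((1 + M0) * l2norm f) => n; exact: (ab f x n f2).1.
have imb f x : l2 f -> bdd (im f x) by move=> f2; exists ((1 + M0) * l2norm f) => n; exact: (ab f x n f2).2.
have Tlin : lin_op T.
  move=> [z1 z2] f h f2 h2; apply/funext => x; rewrite /T.
  have -> : re (fun y => Complex z1 z2 * f y + h y) x = (fun n => z1 * re f x n + - z2 * im f x n + re h x n).
    apply/funext => n; rewrite /re /im (lam_lin (w n))//.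
    by case: (lam (w n) f x) (lam (w n) h x) => [a b] [c d] /=; ring.
  have -> : im (fun y => Complex z1 z2 * f y + h y) x = (fun n => z1 * im f x n + z2 * re f x n + im h x n).
    apply/funext => n; rewrite /re /im (lam_lin (w n))//.
    by case: (lam (w n) f x) (lam (w n) h x) => [a b] [c d] /=; ring.
  have [r1 i1] := (reb f x f2, imb f x f2); have [r2 i2] := (reb h x h2, imb h x h2).
  rewrite (ulimD UU (bddD (bddZ z1 r1) (bddZ (- z2) i1)) r2) (ulimD UU (bddZ z1 r1) (bddZ (- z2) i1)).
  rewrite (ulimD UU (bddD (bddZ z1 i1) (bddZ z2 r1)) i2) (ulimD UU (bddZ z1 i1) (bddZ z2 r1)).
  rewrite !ulimZ//; simpc; congr Complex; ring.
(* Pointwise ultralimits preserve finite sums of squares, so the Cauchy estimate passes to [T] in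
   operator norm. *)
have Tw e n : 0 <= e -> (forall m, (n <= m)%N -> bd (@delta1 R G) (w m - w n) e) -> ob (opsub T (lam (w n))) e.
  move=> e0 wn; split=> // f f2; split=> [|s us]; first by rewrite mulr_ge0 ?l2norm_ge0.
  pose q x m := csq (lam (w m) f x - lam (w n) f x).
  have qE x : q x = (fun m => (re f x m + - re f x n) * (re f x m + - re f x n) +
      (im f x m + - im f x n) * (im f x m + - im f x n)).
    apply/funext => m; rewrite /q /re /im.
    by case: (lam (w m) f x) (lam (w n) f x) => [a b] [c d]; rewrite /csq /=; ring.
  have r1 x : bdd (fun m => re f x m + - re f x n) by apply: bddD => //; exact: reb.
  have i1 x : bdd (fun m => im f x m + - im f x n) by apply: bddD => //; exact: imb.
  have qb x : bdd (q x) by rewrite qE; exact: bddD (bddM (r1 x) (r1 x)) (bddM (i1 x) (i1 x)).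
  have -> : \sum_(g <- s) csq (opsub T (lam (w n)) f g) = ulim U (fun m => \sum_(g <- s) q g m).
    rewrite ulim_sum//; apply: eq_bigr => x _; rewrite qE.
    rewrite (ulimD UU (bddM (r1 x) (r1 x)) (bddM (i1 x) (i1 x))).
    rewrite (ulimM UU (r1 x) (r1 x)) (ulimM UU (i1 x) (i1 x)).
    rewrite (ulimD UU (reb f x f2) (bdd_cst _ _)) (ulimD UU (imb f x f2) (bdd_cst _ _)) !(ulim_cst UU).
    rewrite /opsub /T /re /im; case: (lam (w n) f x) => c d; rewrite /csq /=; ring.
  apply: ulim_le; first by apply: bdd_sum.
  apply: (Uall _ n) => m nm; have := ((lam_ob (wn m nm)).2 f f2).2 s us.
  by under eq_bigr do rewrite lamB.
have Tker : kernel_ideal T.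
  split; first by apply/bounded_opP; split=> //; exists (1 + (1 + M0)); 
    have := obD (Tw 1 0%N ler01 (fun m _ => hn0 (m + n0)%N (leq_addl _ _))) (wM 0%N);
    congr ob; apply/funext => f; apply/funext => x; rewrite /opsub subrK.
  move=> e e0; have e2 : 0 < e / 2 by lra.
  have [n1 h1] := v_cauchy e2; have [n2 h2] := v_kernel e0.
  exists (w (maxn n1 n2)); split; last first.
    by apply: h2; apply: leq_trans (leq_maxr n1 n2) (leq_addr _ _).
  apply: Tw; first exact: ltW.
  move=> m nm; rewrite /w.
  have a1 : (n1 <= m + n0)%N by apply: leq_trans (leq_addr _ _); exact: leq_trans (leq_maxl _ _) nm.
  have a2 : (n1 <= maxn n1 n2 + n0)%N by apply: leq_trans (leq_addr _ _); exact: leq_maxl.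
  have -> : v (m + n0) - v (maxn n1 n2 + n0) = (v (m + n0) - v n1) + - (v (maxn n1 n2 + n0) - v n1).
    by rewrite opprB addrA subrK.
  rewrite [e]splitr; apply: bdD; [exact: delta1_sym|exact: delta1_psd|exact: h1|].
  by apply: bdN; [exact: delta1_psd|exact: h1].
have [h|] := simple kernel_ideal kernel_ideal_closed; last exact: kernel_ideal_proper.
have [_ obT] := opnorm_ob Tker.1; rewrite (h T Tker) in obT.
have [d2 _] := nb_l2 delta_nb.
have [_ /(_ [:: gone G] isT)] := obT _ d2.
rewrite big_seq1 mul0r expr0n /= /T /csq => hle.
set f := fun x : G => _ in d2 hle.
(* The entry of [lam (w n)] on the point mass at the identity is its trace. *)
have fre : 1 / 8 <= ulim U (re f (gone G)).
  rewrite -lerN2 -[leLHS]mulN1r -ulimZ//; last exact: reb.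
  apply: ulim_le; first by apply: bddZ; exact: reb.
  apply: (Uall _ 0%N) => n _; rewrite !mulN1r lerN2.
  apply: le_trans (v_trace (n + n0)) _; apply: eq_ler; rewrite /re /ip /hip /lam; congr complex.Re.
  congr (galg_val _ _); apply/funext => x; rewrite galg_oneE conjc_real !grpE /delta1 /f /=.
  by rewrite rmorph_nat; congr (_%:R); congr nat_of_bool; apply/eqP/eqP => [->|]; rewrite ?ginv1// => e; rewrite -[x]ginvK e ginv1.
have := sqr_ge0 (ulim U (im f (gone G))).
have h1 : 0 <= ulim U (re f (gone G)) - 1 / 8 by lra.
have h2 : 0 <= ulim U (re f (gone G)) + 1 / 8 by lra.
have := mulr_ge0 h1 h2; lra.
Qed.

End KernelIdeal.

(** * Genericity in the Chabauty topology *)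

Lemma Cstar_simple_amenable_subgroup (R : realType) (G : group) (K : set G) (F : seq G) :
  Cstar_simple G R -> has_inv_mean R K -> List.Forall (fun s => s <> gone G) F ->
  exists g, forall s, List.In s F -> ~ K (ginv g ** s ** g).
Proof.
move=> simple Km F1; apply: contrapT => /forallNP h.
have [|K' [c [K's K'm c1 c2]]] := amenable_stabilizer_weights Km F1.
  move=> g; apply: contrapT => /forallNP hg; apply: (h g) => s sF Ks.
  by apply: (hg s).
have [v [v1 v2 v3]] := kernel_sequence K's K'm c1 c2.
exact: (not_Cstar_simple K's K'm v1 v2 v3 simple).
Qed.

Section Chabauty.
Variables (G : group) (e : nat -> G) (num : G -> nat).
Hypothesis numK : forall g, e (num g) = g.
Implicit Types (H K : set G) (F : seq G) (Z : set (set G)).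

Definition agree F H K := forall x, List.In x F -> (K x <-> H x).

Lemma agree_refl F H : agree F H H. Proof. by []. Qed.

Lemma agree_trans F H K L : agree F H K -> agree F K L -> agree F H L.
Proof. by move=> HK KL x xF; rewrite KL// HK. Qed.

Lemma agree_sub F F' H K : (forall x, List.In x F -> List.In x F') -> agree F' H K -> agree F H K.
Proof. by move=> FF' HK x /FF'; exact: HK. Qed.

Definition first_elts n : seq G := [seq e i | i <- iota 0 n].

Lemma In_first_elts g n : (num g < n)%N -> List.In g (first_elts n).
Proof.
by move=> gn; apply/In_mem; rewrite -[g]numK; apply: map_f; rewrite mem_iota.
Qed.

(** Compactness of [{0,1}^G]: the set decided by [U] is a Chabauty limit of the given sets. *)
Lemma ultra_agree (I : Type) (U : set_system I) (Hs : I -> set G) F : UltraFilter U ->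
  U [set i | agree F [set x | U [set i | Hs i x]] (Hs i)].
Proof.
move=> UU; elim: F => [|x F IHF]; first by apply: filterS (@filterT _ U _) => i _ y [].
have [Ux|Ux] := in_ultra_setVsetC [set i | Hs i x] UU.
  by apply: filterS (filterI Ux IHF) => i /= [Hix IH] y /= [<-|/IH].
apply: filterS (filterI Ux IHF) => i /= [Hix IH] y /= [<-|/IH//]; split=> // Ux'.
by have [j /= []] := filter_ex (filterI Ux Ux').
Qed.

Section Uniform.
Variable Z : set (set G).
Hypothesis Z_URS : URS Z.

Let Z_closed : chab_closure Z `<=` Z. Proof. by have [_ [_ []]] := Z_URS. Qed.
Let Z_sub H : Z H -> is_subgroup H. Proof. by have [_ [h _]] := Z_URS; exact: h. Qed.
Let Z_conjs g H : Z H -> Z (conjs g H). Proof. by have [_ [_ [_ [h _]]]] := Z_URS; exact: h. Qed.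
Let Z_min H : Z H -> Z `<=` chab_closure [set conjs g H | g in [set: G]].
Proof. by have [_ [_ [_ [_ h]]]] := Z_URS; exact: h. Qed.

(** Otherwise some [Hs n] in [Z] escapes the first [n] conjugations; a limit point of these lies in
    [Z], and minimality supplies a conjugation [g] that also works for late terms. *)
Lemma URS_cover H0 F0 : Z H0 -> exists l : seq G, forall H, Z H ->
  exists g, List.In g l /\ agree F0 H0 (conjs g H).
Proof.
move=> ZH0; apply: contrapT => /forallNP nl.
have /choice[Hs HsP] : forall n, exists H, Z H /\ forall g, List.In g (first_elts n) -> ~ agree F0 H0 (conjs g H).
  move=> n; have /existsNP[H /not_implyP[ZH nH]] := nl (first_elts n).
  by exists H; split=> // g gn ag; apply: nH; exists g.
have [U [UU Un]] := nat_ultra.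
pose H : set G := [set x | U [set i | Hs i x]].
have ZH : Z H.
  apply: Z_closed => F; have [i /= Hi] := filter_ex (ultra_agree Hs F UU).
  by exists (Hs i); split=> //; exact: (HsP i).1.
have [_ [[g _ <-] gP]] := Z_min ZH ZH0 F0.
have [i /= [Hi gi]] := filter_ex (filterI (ultra_agree Hs [seq ginv g ** x ** g | x <- F0] UU) (Un (num g).+1)).
apply: (HsP i).2 (In_first_elts gi) _ => x xF; rewrite -gP// /conjs /=.
by apply: Hi; apply: (List.in_map (fun x => ginv g ** x ** g)).
Qed.

(** Were [H0] isolated, the finite cover would consist of conjugates of [H0] itself, and [Z] would
    be finite. *)
Lemma URS_perfect H0 F0 : ~ finite_set Z -> Z H0 -> exists H, [/\ Z H, agree F0 H0 H & H <> H0].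
Proof.
move=> Zinf ZH0; apply: contrapT => /forallNP nH; apply: Zinf.
have [l lP] := URS_cover F0 ZH0.
apply: (@sub_finite_set _ _ ((fun g => conjs (ginv g) H0) @` [set` l])); last first.
  exact/finite_image/finite_seq.
move=> H ZH; have [g [gl ag]] := lP H ZH.
exists g; first by apply/In_mem.
have -> : H0 = conjs g H.
  apply: contrapT => ne; apply: (nH (conjs g H)); split=> //; first exact: Z_conjs.
  by move=> eq; apply: ne.
by apply/seteqP; split=> x /=; rewrite /conjs /= !grpE.
Qed.

(** Baire's theorem, with finite sets on which agreement is required in place of shrinking open
    sets. *)
Lemma URS_baire (P : nat -> set (set G)) :
  (forall k H, Z H -> ~ P k H -> exists F, forall K, Z K -> agree F H K -> ~ P k K) ->
  (forall k H F, Z H -> exists K, [/\ Z K, agree F H K & ~ P k K]) ->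
  forall H0 F0, Z H0 -> exists H, [/\ Z H, agree F0 H0 H & forall k, ~ P k H].
Proof.
move=> Popen Pnd H0 F0 ZH0.
pose st := ({H | Z H} * seq G)%type.
have /choice[nx nxP] : forall kp : nat * st, exists p : st, [/\ agree kp.2.2 (sval kp.2.1) (sval p.1),
    forall x, List.In x kp.2.2 -> List.In x p.2, List.In (e kp.1) p.2 &
    forall K, Z K -> agree p.2 (sval p.1) K -> ~ P kp.1 K].
  move=> [k [[H ZH] F]] /=.
  have [H' [ZH' HH' nP]] := Pnd k H F ZH.
  have [F' F'P] := Popen k H' ZH' nP.
  (* [F'] secures avoidance of [P k], while [e k] makes the stages settle every element of the
     group. *)
  exists (exist _ H' ZH', F ++ e k :: F'); split=> //=.
  - by move=> x xF; apply/List.in_app_iff; left.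
  - by apply/List.in_app_iff; right; left.
  - move=> K ZK ag; apply: F'P => //; apply: agree_sub ag => x xF.
    by apply/List.in_app_iff; right; right.
pose p := fix p n : st := if n is n'.+1 then nx (n', p n') else (exist _ H0 ZH0, F0).
pose Hn n := sval (p n).1; pose Fn n := (p n).2.
have pP n : [/\ agree (Fn n) (Hn n) (Hn n.+1), forall x, List.In x (Fn n) -> List.In x (Fn n.+1),
    List.In (e n) (Fn n.+1) & forall K, Z K -> agree (Fn n.+1) (Hn n.+1) K -> ~ P n K].
  exact: nxP (n, p n).
have Fmono n m : (n <= m)%N -> forall x, List.In x (Fn n) -> List.In x (Fn m).
  move=> nm; rewrite -(subnK nm); elim: (m - n)%N => [//|k IHk] x /IHk.
  by have [_ + _ _] := pP (k + n)%N; apply.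
have Hmono n m : (n <= m)%N -> agree (Fn n) (Hn n) (Hn m).
  move=> nm; rewrite -(subnK nm); elim: (m - n)%N => [//|k IHk].
  apply: agree_trans IHk _; have [+ _ _ _] := pP (k + n)%N.
  by apply: agree_sub; apply: Fmono; rewrite leq_addl.
have numF x : List.In x (Fn (num x).+1) by have [_ _ + _] := pP (num x); rewrite numK.
(* Membership of [x] is frozen from stage [(num x).+1] on, the first at which [x] is known to be
   tested. *)
pose H : set G := [set x | Hn (num x).+1 x].
have HHn n : agree (Fn n) (Hn n) H.
  move=> x xF; rewrite /H /=; pose m := maxn n (num x).+1.
  by rewrite -(Hmono n m (leq_maxl _ _) x xF) -(Hmono _ m (leq_maxr _ _) x (numF x)).
have ZH : Z H.
  apply: Z_closed => F; pose m := \max_(x <- F) (num x).+1.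
  exists (Hn m); split; first exact: svalP (p m).1.
  move=> x /In_mem xF; rewrite (HHn m)//; apply: Fmono (numF x).
  by rewrite /m (big_rem x)//= leq_maxl.
exists H; split=> //; first exact: (HHn 0%N).
by move=> k; have [_ _ _] := pP k; apply => //; exact: HHn.
Qed.

End Uniform.

(** The witnessing normal subgroups have an ultralimit, which is normal in the limit of the [Ks] and
    inherits a limit of the invariant means. *)
Lemma mean_radical_closed (R : realType) Z H s :
  (forall n, exists K, [/\ Z K, agree (first_elts n) H K & mean_radical R K s]) ->
  mean_radical R H s.
Proof.
move=> /choice[Ks KP]; have [U [UU Un]] := nat_ultra.
have /choice[Ns NP] : forall n, exists N, [/\ normal_in N (Ks n), has_inv_mean R N & N s].
  by move=> n; have [_ _] := KP n.
have KH x : U [set n | Ks n x <-> H x].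
  by apply: filterS (Un (num x).+1) => n gn /=; have [_ + _] := KP n; apply; exact: In_first_elts.
have Uall (P : nat -> Prop) : (forall n, P n) -> U [set n | P n].
  by move=> h; apply: filterS (@filterT _ U _) => n _; exact: h.
exists [set x | U [set n | Ns n x]]; split; last by apply: Uall => n; have [] := NP n.
- split; [split; [|split]|split].
  + by apply: Uall => n; have [[[? _] _] _ _] := NP n.
  + move=> x y Nx Ny; apply: filterS (filterI Nx Ny) => n /= [nx ny].
    by have [[[_ [+ _]] _] _ _] := NP n; apply.
  + move=> x Nx; apply: filterS Nx => n /= nx.
    by have [[[_ [_ +]] _] _ _] := NP n; apply.
  + move=> x Nx; have [n /= [nx <-]] := filter_ex (filterI Nx (KH x)).
    by have [[_ [+ _]] _ _] := NP n; apply.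
  + move=> h n Hh Nn; apply: filterS (filterI Nn (KH h)) => i /= [ni Kh].
    by have [[_ [_ +]] _ _] := NP i; apply=> //; apply/Kh.
- by apply: (has_inv_mean_ulim UU (Ns := Ns)) => // n; have [] := NP n.
Qed.

End Chabauty.

Lemma amenable_triv (R : realType) (G : group) : amenable R [set gone G].
Proof.
exists (fun A => `[< A (gone G) >]%:R); split; [|split; [|split]].
- by move=> A _; rewrite ler0n.
- by rewrite asboolT.
- move=> A B _ _ AB.
  rewrite (_ : `[< (A `|` B) (gone G) >] = `[< A (gone G) >] || `[< B (gone G) >]).
    case: (asboolP (A (gone G))) => a; case: (asboolP (B (gone G))) => b; rewrite ?addr0 ?add0r//.
    by have : (A `&` B) (gone G) by []; rewrite AB.
  by rewrite -asbool_or.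
- move=> g A -> A1; congr (_%:R); congr nat_of_bool; apply: asbool_equiv_eq; split.
    by move=> [a Aa]; rewrite gmul1 => <-.
  by move=> A1'; exists (gone G); rewrite ?gmul1.
Qed.

Theorem theoremB (R : realType) (G : group) :
  countable [set: G] -> Cstar_simple G R ->
  forall Z : set (set G), URS Z -> ~ finite_set Z ->
  exists Y : set (set G),
    Y `<=` Z /\ ~ countable Y /\ Z `<=` chab_closure Y /\
    (forall H, Y H -> amenable_radical R H = [set gone G]).
Proof.
move=> /countable_injP[num num_inj] simple Z ZU Zinf.
pose e n := xget (gone G) [set g | num g = n].
have numK g : e (num g) = g.
  rewrite /e; case: xgetP => [x _ /= xg|h]; last by case: (h g).
  by apply: num_inj xg; rewrite inE.
have [_ [Z_sub [Z_closed [Z_conjs _]]]] := ZU.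
(* The identity lies in every radical, so its index must be excluded by hand. *)
pose bad k : set (set G) := [set H | e k <> gone G /\ mean_radical R H (e k)].
have bad_open k H : Z H -> ~ bad k H -> exists F, forall K, Z K -> agree F H K -> ~ bad k K.
  move=> ZH nb; apply: contrapT => /forallNP nF; apply: nb.
  have h n : exists K, [/\ Z K, agree (first_elts e n) H K & bad k K].
    apply: contrapT => /forallNP nK; apply: (nF (first_elts e n)) => K ZK ag bK.
    by apply: (nK K).
  split; first by have [K [_ _ []]] := h 0%N.
  apply: (mean_radical_closed numK (Z := Z)) => n.
  by have [K [ZK ag [_ bK]]] := h n; exists K.
have bad_nd k H F : Z H -> exists K, [/\ Z K, agree F H K & ~ bad k K].
  move=> ZH; apply: contrapT => /forallNP nK.
  have allbad K : Z K -> agree F H K -> bad k K.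
    by move=> ZK ag; apply: contrapT => nb; apply: (nK K).
  have [k1 _] := allbad H ZH (@agree_refl _ F H).
  have [l lP] := URS_cover numK ZU F ZH.
  (* These conjugates of [e k] meet every conjugate of the radical of [H]: for each [g] some [x] in
     [l] brings [conjs g H] into the neighbourhood where all points are bad. *)
  have [||g gP] := @Cstar_simple_amenable_subgroup R G (mean_radical R H) [seq ginv x ** e k ** x | x <- l] simple.
  - exact/mean_radical_has_inv_mean/Z_sub.
  - apply/List.Forall_map/List.Forall_forall => x _ ex; apply: k1.
    have : x ** (ginv x ** e k ** x) ** ginv x = gone G by rewrite ex !grpE.
    by rewrite !grpE.
  - have [x [xl ag]] := lP _ (Z_conjs g H ZH).
    have [_ /mean_radical_conjs h] := allbad _ (Z_conjs _ _ (Z_conjs _ _ ZH)) ag.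
    have {}h := mean_radical_conjs (Z_sub _ ZH) (h (Z_sub _ (Z_conjs _ _ ZH))).
    by apply: gP h; apply: (List.in_map (fun x => ginv x ** e k ** x)).
pose Y : set (set G) := [set H | Z H /\ forall k, ~ bad k H].
exists Y; split; [by move=> H []|split; [|split]].
- move=> /countable_injP[rk rk_inj].
  pose y n := xget set0 [set H | Y H /\ rk H = n].
  (* Interleave: the even conditions put the point in [Y], the odd ones separate it from each point
     of a supposed enumeration of [Y]. *)
  pose P n : set (set G) := if odd n then [set y n./2] else bad n./2.
  have [H0 ZH0] := ZU.1.
  have [||H [ZH _ nP]] := URS_baire numK ZU (P := P) _ _ [::] ZH0.
  + move=> k H ZH; rewrite /P; case: ifP => _; last exact: bad_open.
    (* A singleton is closed: a point approximated on every finite set by [y k./2] is equal to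
       it. *)
    move=> /= Hy; apply: contrapT => /forallNP nF; apply: Hy; apply/seteqP; split=> x.
      move=> Hx; have /existsNP[K /not_implyP[ZK /not_implyP[ag /contrapT <-]]] := nF [:: x].
      by apply/(ag x) => //; left.
    move=> yx; have /existsNP[K /not_implyP[ZK /not_implyP[ag /contrapT Ky]]] := nF [:: x].
    by apply/(ag x); [left|rewrite Ky].
  + move=> k H F ZH; rewrite /P; case: ifP => _; last exact: bad_nd.
    have [Hy|Hy] := pselect (H = y k./2); last by exists H.
    have [K [ZK ag KH]] := URS_perfect numK ZU F Zinf ZH.
    by exists K; split=> //= Ky; apply: KH; rewrite Ky.
  have YH : Y H.
    by split=> // k; have := nP k.*2; rewrite /P odd_double doubleK.
  have := nP (rk H).*2.+1; rewrite /P /= odd_double /= uphalf_double; apply.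
  rewrite /= /y; case: xgetP => [K _ [YK rK]|h]; last by case: (h H).
  by apply: rk_inj; rewrite ?inE.
- move=> H0 ZH0 F; have [H [ZH ag nP]] := URS_baire numK ZU bad_open bad_nd F ZH0.
  by exists H.
- move=> H [ZH nb]; apply/seteqP; split=> x.
    (* A non-trivial element of the amenable radical would also lie in [mean_radical], making its
       index bad. *)
    move=> [N [nN aN] Nx]; apply: contrapT => x1; apply: (nb (num x)).
    rewrite /bad /= numK; split=> //; exists N; split=> //.
    by apply: amenable_has_inv_mean => //; exact: nN.1.
  move=> ->; exists [set gone G] => //; split; last exact: amenable_triv.
  exact/triv_normal/Z_sub.
Qed.
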